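(* Let $\alpha>0$. For $n_1$ an even positive integer, let $n_2=\lfloor \alpha n_1/2\rfloor$. For $j\ge 2$, let $U_j$ denote the number of connected components with exactly $j$ vertices in a graph drawn uniformly at random from $\mathcal{G}_{n_1,n_2}$. Then, for every $j\ge 2$, as $n_1\to\infty$ along the even integers, \[ \mathbb{E}[U_j]\sim \frac{\alpha^{j-2}}{(1+\alpha)^{j-1}}\,\frac{n_1}{2} \qquad\text{and}\qquad \operatorname{Var}(U_j)=O\!\left(\frac{n_1}{2}\right). \] Furthermore, for any integer $q\ge 2$, as $n_1\to\infty$ along the even integers, the random vector \[ \frac{1}{\sqrt{n_1/2}}\left(U_j-\frac{\alpha^{j-2}}{(1+\alpha)^{j-1}}\,\frac{n_1}{2}\right)_{2\le j\le q} \] converges in distribution to a multivariate Gaussian $\mathcal{N}(\mathbf{0},\mathcal{H}(\alpha))$, where the positive semi-definite matrix $\mathcal{H}(\alpha)=(\mathcal{H}_{i,j}(\alpha))_{2\le i,j\le q}$ is given by \[ \mathcal{H}_{i,j}(\alpha)=-\frac{\alpha^{i+j-4}}{(1+\alpha)^{i+j-2}}\left(1+\frac{(i-2-\alpha)(j-2-\alpha)}{\alpha(1+\alpha)}\right)+\frac{\mathbb{1}_{i=j}}{1+\alpha}\left(\frac{\alpha}{1+\alpha}\right)^{i-2}. \]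
   Context: $\mathcal{G}_{n_1,n_2}$ denotes the set of labelled simple graphs (vertex set $\{1,\dots,n_1+n_2\}$) in which every vertex has degree $1$ or $2$, with exactly $n_1$ vertices of degree $1$ and $n_2$ vertices of degree $2$. The size of a connected component is its number of vertices. $\mathbb{1}_{i=j}$ is $1$ if $i=j$ and $0$ otherwise. *)

(* Defs.v *)
From HB Require Import structures.
From mathcomp Require Import all_boot all_order all_algebra.
From mathcomp Require Import all_classical all_reals all_analysis.

Set Implicit Arguments.
Unset Strict Implicit.
Unset Printing Implicit Defensive.

Import Order.TTheory GRing.Theory Num.Theory.
Import numFieldNormedType.Exports.
Local Open Scope classical_set_scope.
Local Open Scope ring_scope.

(* A labelled simple graph on vertex set 'I_N is given by its (symmetric,   *)
(* irreflexive) set of ordered adjacent pairs.                               *)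
Definition graph (N : nat) := {set ('I_N * 'I_N)}.

Definition simple_graph N (E : graph N) : bool :=
  [forall v, (v, v) \notin E] && [forall v, forall w, ((v, w) \in E) == ((w, v) \in E)].

Definition deg N (E : graph N) (v : 'I_N) : nat := #|[set w | (v, w) \in E]|.

Definition Gclass (n1 n2 : nat) : {set graph (n1 + n2)} :=
  [set E : graph (n1 + n2) | [&& simple_graph E,
     [forall v, (deg E v == 1%N) || (deg E v == 2%N)],
     #|[set v | deg E v == 1%N]| == n1 &
     #|[set v | deg E v == 2%N]| == n2]].

Definition comp N (E : graph N) (v : 'I_N) : {set 'I_N} :=
  [set w | connect (fun x y => (x, y) \in E) v w].

Definition Ucount N (j : nat) (E : graph N) : nat :=
  #|[set comp E v | v in 'I_N & #|comp E v| == j]|.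

Definition Eunif {R : realType} N (S : {set graph N}) (X : graph N -> R) : R :=
  (\sum_(E in S) X E) / #|S|%:R.

Definition Varunif {R : realType} N (S : {set graph N}) (X : graph N -> R) : R :=
  Eunif S (fun E => (X E - Eunif S X) ^+ 2).

(* n1 = 2m (even), n2 = floor(alpha * n1 / 2) = floor(alpha * m). *)
Definition n2_of {R : realType} (alpha : R) (m : nat) : nat :=
  Num.truncn (alpha * m%:R).

Definition Gm {R : realType} (alpha : R) (m : nat) :=
  Gclass (m.*2) (n2_of alpha m).

Definition Ucoef {R : realType} (alpha : R) (j : nat) : R :=
  alpha ^+ (j - 2) / (1 + alpha) ^+ (j - 1).

Definition Hent {R : realType} (alpha : R) (a b : nat) : R :=
  - (alpha ^+ (a + b - 4) / (1 + alpha) ^+ (a + b - 2))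
    * (1 + (a%:R - 2 - alpha) * (b%:R - 2 - alpha) / (alpha * (1 + alpha)))
  + (a == b)%:R / (1 + alpha) * (alpha / (1 + alpha)) ^+ (a - 2).

(* the matrix (H_{i,j})_{2<=i,j<=q}, re-indexed by 'I_(q-1) (index i <-> i+2) *)
Definition Hmat {R : realType} (alpha : R) (q : nat) : 'M[R]_(q.-1) :=
  \matrix_(i < q.-1, k < q.-1) Hent alpha (i + 2)%N (k + 2)%N.

Definition std_normal_density {R : realType} (x : R) : R :=
  expR (- (x ^+ 2) / 2) / Num.sqrt (pi *+ 2).

(* E[g(W)] for W a standard Gaussian row vector of dimension d,            *)
(* written as an iterated Lebesgue integral.                                *)
Fixpoint gauss_expect {R : realType} (d : nat) : ('rV[R]_d -> R) -> R :=
  match d return ('rV[R]_d -> R) -> R with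
  | 0 => fun g => g 0
  | d'.+1 => fun g =>
      Rintegral (@lebesgue_measure R) setT
        (fun x : R => std_normal_density x *
           gauss_expect (fun w : 'rV[R]_d' => g (row_mx (\row_(_ < 1) x) w)))
  end.

(* X_m converges in distribution to N(0, A A^T): for every bounded continuous f, *)
(* E[f(X_m)] -> E[f(Z)], where Z = W A^T with W standard Gaussian.          *)
Definition bounded_fun {R : realType} d (f : 'rV[R]_d -> R) : Prop :=
  exists M : R, forall x, `|f x| <= M.

Definition conv_distr_gauss {R : realType} (d : nat)
    (EX : ('rV[R]_d -> R) -> nat -> R) (A : 'M[R]_d) : Prop :=
  forall f : 'rV[R]_d -> R, continuous f -> bounded_fun f ->
    (EX f) @ \oo --> gauss_expect (fun w => f (w *m A^T)).

(* Main.v *)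
(* In a graph of the class, delete a vertex v of degree 2 with neighbours a and b: if ab is not an
   edge, join a to b, and otherwise remove the triangle vab.  Read backwards, the multiset of
   component sizes is built from m isolated edges by n2 steps of a Markov chain that subdivides an
   edge chosen uniformly at random, up to a triangle creation of probability O(1/m).  At time
   s = n/m the number of paths with x + 2 vertices is close to m s^x / (1 + s)^(x + 1).  A centred
   linear statistic of the counts with coefficients t satisfies, up to errors controlled by the
   expected number of cycles, one-step recursions for its second moment and its characteristic
   function in which t is replaced by t + (drift t)/m; the variances collected along the way
   integrate to a quadratic form which, at s = alpha, is the form of H(alpha).  Convergence of
   the characteristic functions and boundedness of the second moments give convergence in
   distribution: on a large box a bounded continuous function is uniformly close to a
   trigonometric polynomial with the same global bound, namely a multivariate Bernstein
   polynomial in the variables sin(x_i / tau). *)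
Require Import Defs.
From HB Require Import structures.
From mathcomp Require Import all_boot all_order all_algebra.
From mathcomp Require Import all_classical all_reals all_analysis.
From mathcomp Require Import measurable_realfun.
From mathcomp Require Import zify ring lra.
Set Implicit Arguments.
Unset Strict Implicit.
Unset Printing Implicit Defensive.
Import Order.TTheory GRing.Theory Num.Theory.
Import numFieldNormedType.Exports.
Local Open Scope ring_scope.

(** * Removing a vertex of degree 2 *)

(** Joining two adjacent neighbours would create a double edge; this is why the triangle is a
    separate term, which goes back three vertices at once. Test functions [t] that vanish from [d]
    on are carried backwards in time. The drift at [x] involves only [t x] and [t x.+1], so the
    support stays below [d], and a backward step is a convex combination, so the sup norm does not
    grow. One ball of test functions therefore serves all n steps with the same constants. Each step
    of the characteristic function costs O(m^{-3/2}) in expectation, and n = O(m) steps cost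
    O(m^{-1/2}). The closed form of the limit variance has a probabilistic origin: without
    triangles, n uniform subdivisions of m edges give m independent geometric variables of mean s =
    n/m conditioned on their sum. Hence the variance is that of t(X), for X geometric, after its
    linear regression on X has been removed. *)

Section FiniteGraphs.
Import mathcomp.boot.fintype mathcomp.boot.finset.
Local Notation ccomp := Defs.comp.

(* A component with c vertices and e edges is recorded as (c - 2, 2 e). *)
Definition state := seq (nat * nat).

Definition grow (x : nat * nat) : nat * nat := (x.1.+1, x.2.+2).

Definition growth {R : pzSemiRingType} (F : state -> R) (s : state) : R :=
  \sum_(x <- s) x.2%:R * F (grow x :: rem x s).

Definition newtri {R : pzSemiRingType} (F : state -> R) (s : state) : R := F ((1, 6)%N :: s).

(* [growth] sums over the ordered edges to subdivide.  The factor 4 n1 (n1 - 1) counts the ordered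
   choices of the two companions of the new vertex on a triangle, rescaled because the recursion is
   normalised by 2 per vertex of degree 2 and a triangle uses up three of them. *)
Fixpoint hist {R : pzSemiRingType} (m n : nat) (F : state -> R) : R :=
  match n with
  | 0 => F (nseq m (0, 2)%N)
  | n1.+1 => hist m n1 (growth F) +
      match n1 with
      | n3.+2 => (4 * (n1 * n1.-1))%:R * hist m n3 (newtri F)
      | _ => 0
      end
  end.

(** The components of a graph are listed in an arbitrary enumeration order, so only functions of the
    multiset are meaningful. *)
Definition perm_inv {A : Type} (F : state -> A) : Prop :=
  forall s s' : state, perm_eq s s' -> F s = F s'.

Lemma perm_rem_eq (T : eqType) (x : T) (s s' : seq T) :
  perm_eq s s' -> perm_eq (rem x s) (rem x s').
Proof.
move=> ss'; have ms := perm_mem ss' x.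
have [xs|xNs] := boolP (x \in s); last first.
  by rewrite !rem_id ?ss' //; rewrite -ms.
rewrite -(perm_cons x) -(permPl (perm_to_rem xs)).
by rewrite -(permPr (perm_to_rem _)) // -ms.
Qed.

Section Invariance.
Variable R : pzSemiRingType.
Implicit Type F : state -> R.

Lemma growth_inv F : perm_inv F -> perm_inv (growth F).
Proof.
move=> FP s s' ss'; rewrite /growth (perm_big _ ss') /=.
by apply: eq_bigr => x _; congr (_ * _); apply: FP; rewrite perm_cons perm_rem_eq.
Qed.

Lemma newtri_inv F : perm_inv F -> perm_inv (newtri F).
Proof. by move=> FP s s' ss'; apply: FP; rewrite perm_cons. Qed.

End Invariance.

Section Components.
Variable N : nat.
Implicit Types (E : graph N) (D C : {set 'I_N}).

(** Vertices outside [D1] and [D2] have degree 0: a deleted vertex remains as an isolated point, so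
    the vertex type never changes along the recursion. *)
Definition GG (D1 D2 : {set 'I_N}) : {set graph N} :=
  [set E : graph N | simple_graph E && [forall v, deg E v == ((v \in D1) + (v \in D2).*2)%N]].

Definition comps E D : {set {set 'I_N}} := [set ccomp E v | v in D].

Definition edgesof E C : nat := #|[set p in E | p.1 \in C]|.

Definition cstat E C : nat * nat := ((#|C| - 2)%N, edgesof E C).

Definition St E D : state := [seq cstat E C | C <- enum (comps E D)].

Definition adj E : rel 'I_N := fun x y => (x, y) \in E.

Lemma compE E x y : (y \in ccomp E x) = connect (adj E) x y.
Proof. by rewrite inE. Qed.

Lemma simple_sym E : simple_graph E -> symmetric (adj E).
Proof. by case/andP=> _ /forallP h x y; have /forallP/(_ y)/eqP := h x. Qed.

Lemma simple_irr E x : simple_graph E -> (x, x) \notin E.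
Proof. by case/andP=> /forallP h _. Qed.

Lemma comp_sym E x y : simple_graph E -> connect (adj E) x y = connect (adj E) y x.
Proof. by move=> /simple_sym/sym_connect_sym ->. Qed.

Lemma comp_eq E x y : simple_graph E -> (ccomp E x == ccomp E y) = connect (adj E) x y.
Proof.
move=> sE; apply/eqP/idP => [e|xy].
  by rewrite -compE e compE connect0.
apply/setP => z; rewrite !compE.
exact: (same_connect (sym_connect_sym (simple_sym sE))).
Qed.

Lemma connect_map (T T' : finType) (e : rel T) (e' : rel T') (f : T -> T') :
  (forall x y, e x y -> connect e' (f x) (f y)) ->
  forall x y, connect e x y -> connect e' (f x) (f y).
Proof.
move=> h x y /connectP[p]; elim: p x => [|z p ih] x /=.
  by move=> _ ->; exact: connect0.
by case/andP=> xz pp yp; apply: connect_trans (h _ _ xz) (ih _ pp yp).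
Qed.

(* Contracting along [f] relates the components of the larger graph [E] to those of [E']. *)
Lemma connect_contract E E' (f : 'I_N -> 'I_N) : simple_graph E ->
  (forall x y, adj E x y -> connect (adj E') (f x) (f y)) ->
  (forall x y, adj E' x y -> connect (adj E) x y) ->
  (forall x, connect (adj E) x (f x)) ->
  forall x y, connect (adj E) x y = connect (adj E') (f x) (f y).
Proof.
move=> sE h1 h2 h3 x y; apply/idP/idP; first exact: connect_map.
move=> h; apply: connect_trans (h3 x) _; rewrite comp_sym //.
apply: connect_trans (h3 y) _; rewrite comp_sym //.
by move: h; apply: (@connect_map _ _ _ _ id) => a b; apply: h2.
Qed.

Lemma comps_contract E E' (f : 'I_N -> 'I_N) D :
  (forall x y, connect (adj E) x y = connect (adj E') (f x) (f y)) ->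
  comps E D = [set f @^-1: (C : {set 'I_N}) | C : {set 'I_N} in comps E' (f @: D)].
Proof.
move=> h; have ce x : ccomp E x = f @^-1: ccomp E' (f x).
  by apply/setP => y; rewrite !inE; apply: h.
apply/setP => C; apply/imsetP/imsetP => [[x xD ->]|[_ /imsetP[_ /imsetP[x xD ->] ->] ->]].
  by exists (ccomp E' (f x)); rewrite ?ce //; apply/imsetP; exists (f x) => //; apply: imset_f.
by exists x; rewrite ?ce.
Qed.

Lemma perm_map_imset (T T' : finType) (A : eqType) (f : T -> T') (g : T' -> A) (S : {set T}) :
  {in S &, injective f} ->
  perm_eq [seq g y | y <- enum (f @: S)] [seq g (f x) | x <- enum S].
Proof.
move=> fI; rewrite [X in perm_eq _ X](map_comp g f); apply: perm_map; apply: uniq_perm.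
- exact: enum_uniq.
- by rewrite map_inj_in_uniq ?enum_uniq // => x y; rewrite !mem_enum; apply: fI.
move=> y; rewrite mem_enum; apply/imsetP/mapP => -[x xS ->]; exists x => //;
  by move: xS; rewrite mem_enum.
Qed.

Lemma perm_enum_cons (T : finType) (S : {set T}) (x : T) : x \in S ->
  perm_eq (enum S) (x :: enum (S :\ x)).
Proof.
move=> xS; apply: uniq_perm; rewrite /= ?enum_uniq //.
  by rewrite mem_enum !inE eqxx.
by move=> y; rewrite inE !mem_enum !inE; case: eqP => [->|]; rewrite ?xS.
Qed.

Lemma perm_enum_rem (T : finType) (A : eqType) (g : T -> A) (S : {set T}) (x : T) : x \in S ->
  perm_eq (rem (g x) [seq g y | y <- enum S]) [seq g y | y <- enum (S :\ x)].
Proof.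
move=> xS; rewrite -(perm_cons (g x)) -(permPl (perm_to_rem _)); last first.
  by apply: map_f; rewrite mem_enum.
by rewrite -map_cons; apply: perm_map; apply: perm_enum_cons.
Qed.

Definition nb E x : {set 'I_N} := [set w | (x, w) \in E].

Lemma in_nb E x y : (y \in nb E x) = ((x, y) \in E).
Proof. by rewrite in_set. Qed.

(** [deg] counts a classical set through its membership predicate; [nb] is the finite set with the
    same elements, to which the cardinality lemmas apply. *)
Lemma degE E x : deg E x = #|nb E x|.
Proof. by apply: eq_card => w; apply/idP/idP => [/set_mem|]; rewrite inE // => h; apply: mem_set. Qed.

Lemma deg0P E x : reflect (forall y, (x, y) \notin E) (deg E x == 0%N).
Proof.
rewrite degE cards_eq0; apply: (iffP eqP) => [h y|h].
  by have := in_set0 y; rewrite -h inE => ->.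
by apply/setP => y; rewrite !inE; apply/negbTE.
Qed.

Definition ed (x y : 'I_N) : graph N := [set (x, y); (y, x)].

(** [ins] subdivides the edge [ab] by the isolated vertex [v] and [del] undoes this; [tri] puts a
    triangle on three isolated vertices and [untri] undoes that. These two pairs of inverse maps
    give the bijections of the recursion. *)
Definition ins E v a b : graph N := (E :\: ed a b) :|: (ed v a :|: ed v b).
Definition del E v a b : graph N := (E :\: (ed v a :|: ed v b)) :|: ed a b.
Definition tri E v a b : graph N := E :|: (ed v a :|: ed v b :|: ed a b).
Definition untri E v a b : graph N := E :\: (ed v a :|: ed v b :|: ed a b).

Lemma in_ins E v a b p : (p \in ins E v a b) =
  (p \notin ed a b) && (p \in E) || ((p \in ed v a) || (p \in ed v b)).
Proof. by rewrite in_setU in_setD in_setU. Qed.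

Lemma in_del E v a b p : (p \in del E v a b) =
  ~~ ((p \in ed v a) || (p \in ed v b)) && (p \in E) || (p \in ed a b).
Proof. by rewrite in_setU in_setD in_setU. Qed.

Lemma in_tri E v a b p : (p \in tri E v a b) =
  (p \in E) || ((p \in ed v a) || (p \in ed v b) || (p \in ed a b)).
Proof. by rewrite in_setU in_setU in_setU. Qed.

Lemma in_untri E v a b p : (p \in untri E v a b) =
  ~~ ((p \in ed v a) || (p \in ed v b) || (p \in ed a b)) && (p \in E).
Proof. by rewrite in_setD in_setU in_setU. Qed.

Lemma in_ed x y z t : ((z, t) \in ed x y) = (z == x) && (t == y) || (z == y) && (t == x).
Proof. by rewrite !inE !xpair_eqE. Qed.

Lemma ed_sym x y z t : ((z, t) \in ed x y) = ((t, z) \in ed x y).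
Proof. by rewrite !in_ed orbC andbC [X in _ || X]andbC. Qed.

Lemma simpleP E : reflect ((forall x, (x, x) \notin E) /\ symmetric (adj E)) (simple_graph E).
Proof.
apply: (iffP idP) => [h|[h1 h2]].
  by split=> [x|]; [apply: simple_irr | apply: simple_sym].
apply/andP; split; apply/forallP => x //; apply/forallP => y.
by rewrite -[(x, y) \in E]/(adj E x y) h2 eqxx.
Qed.

Lemma ed_irr x y z : x != y -> ((z, z) \in ed x y) = false.
Proof. by rewrite in_ed => /negbTE h; case: (z =P x) => [->|_]; rewrite ?h ?andbF. Qed.

Lemma simple_edge_neq E x y : simple_graph E -> (x, y) \in E -> x != y.
Proof.
by move=> sE xy; apply: contraTneq xy => ->; apply: simple_irr.
Qed.

Lemma simple_ins E v a b : simple_graph E -> v != a -> v != b -> simple_graph (ins E v a b).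
Proof.
move=> /simpleP[h1 h2] va vb; apply/simpleP; split=> [x|x y].
  by rewrite in_ins (negbTE (h1 x)) andbF !ed_irr //.
by rewrite /adj ?(in_ins, in_del, in_tri, in_untri) !(ed_sym _ _ x y) -[(x, y) \in E]/(adj E x y) h2.
Qed.

Lemma simple_del E v a b : simple_graph E -> a != b -> simple_graph (del E v a b).
Proof.
move=> /simpleP[h1 h2] ab; apply/simpleP; split=> [x|x y].
  by rewrite in_del (negbTE (h1 x)) andbF !ed_irr //.
by rewrite /adj ?(in_ins, in_del, in_tri, in_untri) !(ed_sym _ _ x y) -[(x, y) \in E]/(adj E x y) h2.
Qed.

Lemma simple_tri E v a b : simple_graph E -> v != a -> v != b -> a != b ->
  simple_graph (tri E v a b).
Proof.
move=> /simpleP[h1 h2] va vb ab; apply/simpleP; split=> [x|x y].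
  by rewrite in_tri (negbTE (h1 x)) !ed_irr //.
by rewrite /adj ?(in_ins, in_del, in_tri, in_untri) !(ed_sym _ _ x y) -[(x, y) \in E]/(adj E x y) h2.
Qed.

Lemma simple_untri E v a b : simple_graph E -> simple_graph (untri E v a b).
Proof.
move=> /simpleP[h1 h2]; apply/simpleP; split=> [x|x y].
  by rewrite in_untri (negbTE (h1 x)) andbF.
by rewrite /adj ?(in_ins, in_del, in_tri, in_untri) !(ed_sym _ _ x y) -[(x, y) \in E]/(adj E x y) h2.
Qed.

Lemma insK E v a b : simple_graph E -> (a, b) \in E -> deg E v = 0%N ->
  del (ins E v a b) v a b = E.
Proof.
move=> sE ab /eqP/deg0P v0; have/simpleP[_ sy] := sE.
have va y : (y, v) \notin E by rewrite -[_ \in E]/(adj E y v) sy; apply: v0.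
apply/setP => -[x y]; rewrite in_del in_ins.
have [xy|xyN] := boolP ((x, y) \in ed a b).
  rewrite orbT; apply/esym; move: xy; rewrite in_ed.
  by case/orP=> /andP[/eqP-> /eqP->] //; rewrite -[_ \in E]/(adj E b a) sy.
rewrite /= orbF; case: (boolP (_ || _)) => h; rewrite ?orbT ?orbF //=.
by apply/esym/negbTE; move: h; rewrite !in_ed => /orP[] /orP[] /andP[/eqP-> /eqP->].
Qed.

Lemma delK E v a b : simple_graph E -> (v, a) \in E -> (v, b) \in E -> (a, b) \notin E ->
  ins (del E v a b) v a b = E.
Proof.
move=> sE va vb ab; have/simpleP[_ sy] := sE.
have av : (a, v) \in E by rewrite -[_ \in E]/(adj E a v) sy.
have bv : (b, v) \in E by rewrite -[_ \in E]/(adj E b v) sy.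
have ba : (b, a) \notin E by rewrite -[_ \in E]/(adj E b a) sy.
apply/setP => -[x y]; rewrite in_ins in_del.
have [xy|xyN] := boolP (((x, y) \in ed v a) || ((x, y) \in ed v b)).
  rewrite orbT; apply/esym.
  by move: xy; rewrite !in_ed => /orP[] /orP[] /andP[/eqP-> /eqP->].
rewrite /= !orbF; case: (boolP (_ \in ed a b)) => h; rewrite ?orbT ?orbF //=.
by apply/esym/negbTE; move: h; rewrite !in_ed => /orP[] /andP[/eqP-> /eqP->].
Qed.

Lemma triK E v a b : simple_graph E -> deg E v = 0%N -> deg E a = 0%N -> deg E b = 0%N ->
  untri (tri E v a b) v a b = E.
Proof.
move=> /simpleP[_ sy] /eqP/deg0P v0 /eqP/deg0P a0 /eqP/deg0P b0.
have Nv y : (y, v) \notin E by rewrite -[_ \in E]/(adj E y v) sy; apply: v0.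
have Na y : (y, a) \notin E by rewrite -[_ \in E]/(adj E y a) sy; apply: a0.
apply/setP => -[x y]; rewrite in_untri in_tri.
case: (boolP (_ || _)) => h /=; rewrite ?orbF //.
apply/esym/negbTE; move: h; rewrite !in_ed.
by move/orP => [/orP[]|] /orP[] /andP[/eqP-> /eqP->].
Qed.

Lemma untriK E v a b : simple_graph E -> (v, a) \in E -> (v, b) \in E -> (a, b) \in E ->
  tri (untri E v a b) v a b = E.
Proof.
move=> sE va vb ab; have/simpleP[_ sy] := sE.
have av : (a, v) \in E by rewrite -[_ \in E]/(adj E a v) sy.
have bv : (b, v) \in E by rewrite -[_ \in E]/(adj E b v) sy.
have ba : (b, a) \in E by rewrite -[_ \in E]/(adj E b a) sy.
apply/setP => -[x y]; rewrite in_tri in_untri.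
case: (boolP (_ || _ || _)) => h /=; rewrite ?orbF ?orbT //=.
apply/esym; move: h; rewrite !in_ed.
by move/orP => [/orP[]|] /orP[] /andP[/eqP-> /eqP->].
Qed.

Lemma deg_set2 E x a b : a != b -> (x, a) \in E -> (x, b) \in E -> (deg E x <= 2)%N ->
  deg E x = 2%N /\ forall y, ((x, y) \in E) = (y == a) || (y == b).
Proof.
move=> ab xa xb; rewrite degE => d2.
have sub : [set a; b] \subset nb E x.
  by apply/subsetP => y; rewrite !inE => /orP[] /eqP->.
have /eqP e : [set a; b] == nb E x by rewrite eqEcard sub cards2 ab.
by split=> [|y]; [rewrite -e cards2 ab | have /setP/(_ y) := e; rewrite !inE => <-].
Qed.

Lemma deg_ins E v a b x : simple_graph E -> (a, b) \in E -> deg E v = 0%N ->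
  deg (ins E v a b) x = (deg E x + (x == v).*2)%N.
Proof.
move=> sE ab /eqP/deg0P v0; have/simpleP[ir sy] := sE.
have ba : (b, a) \in E by rewrite -[_ \in E]/(adj E b a) sy.
have vna : v != a by apply: contraTneq ab => <-; apply: v0.
have vnb : v != b by apply: contraTneq ba => <-; apply: v0.
have anb : a != b by apply: simple_edge_neq ab.
have Nv y : (y, v) \in E = false.
  by apply/negbTE; rewrite -[_ \in E]/(adj E y v) sy; apply: v0.
(* An end of the subdivided edge trades its other end for [v], so its degree does not change. *)
have swap u w : (u, w) \in E -> u != v -> #|v |: nb E u :\ w| = deg E u.
  move=> uw uv; rewrite cardsU1 !inE Nv andbF add1n degE (cardsD1 w (nb E u)).
  by rewrite inE uw.
have [->|xv] := eqVneq x v.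
  rewrite !degE (_ : nb E v = set0) ?cards0.
    rewrite (_ : nb _ v = [set a; b]) ?cards2 ?anb //.
    apply/setP => y; rewrite ?(in_nb, in_set2, in_setU1, in_setD1) in_ins !in_ed (negbTE (v0 y)) eqxx.
    by rewrite (negbTE vna) (negbTE vnb) /= !orbF.
  by apply/setP => y; rewrite !inE; apply/negbTE.
rewrite addn0; have [->|xa] := eqVneq x a.
  rewrite -(swap a b) // 1?eq_sym // degE; congr #|pred_of_set _|.
  apply/setP => y; rewrite ?(in_nb, in_set2, in_setU1, in_setD1) in_ins !in_ed eqxx (negbTE anb) (eq_sym a v) (negbTE vna) /=.
  by rewrite !orbF orbC.
have [->|xb] := eqVneq x b.
  rewrite -(swap b a) // 1?eq_sym // degE; congr #|pred_of_set _|.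
  apply/setP => y; rewrite ?(in_nb, in_set2, in_setU1, in_setD1) in_ins !in_ed eqxx (eq_sym b a) (negbTE anb).
  by rewrite (eq_sym b v) (negbTE vnb) /= orbC.
rewrite !degE; congr #|pred_of_set _|; apply/setP => y.
by rewrite ?(in_nb, in_set2, in_setU1, in_setD1) in_ins !in_ed (negbTE xv) (negbTE xa) (negbTE xb) /= orbF.
Qed.

Lemma deg_tri E v a b x : simple_graph E -> v != a -> v != b -> a != b ->
  deg E v = 0%N -> deg E a = 0%N -> deg E b = 0%N ->
  deg (tri E v a b) x = (deg E x + [|| x == v, x == a | x == b].*2)%N.
Proof.
move=> sE va vb ab dv da db.
have gen u w z : u != w -> deg E u = 0%N ->
    (forall y, ((u, y) \in tri E v a b) = ((u, y) \in E) || ((y == w) || (y == z))) ->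
    w != z -> deg (tri E v a b) u = (deg E u + 2)%N.
  move=> uw du h wz; rewrite !degE (_ : nb (tri _ _ _ _) u = [set w; z]).
    by rewrite cards2 wz -degE du.
  apply/setP => y; rewrite in_nb in_set2 h; move/eqP/deg0P: du => /(_ y)/negbTE->.
  by rewrite orFb.
have F := (negbTE va, negbTE vb, negbTE ab, eqxx, eq_sym a v, eq_sym b v, eq_sym b a).
have [->|xv] := eqVneq x v.
  by apply: (gen v a b) => // y; rewrite in_tri !in_ed !F /= !orbF.
have [->|xa] := eqVneq x a.
  apply: (gen a v b) => //; first by rewrite eq_sym.
  by move=> y; rewrite in_tri !in_ed !F /= !orbF.
have [->|xb] := eqVneq x b.
  apply: (gen b v a) => //; first by rewrite eq_sym.
  by move=> y; rewrite in_tri !in_ed !F /= ?orbF.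
rewrite addn0 !degE; congr #|pred_of_set _|; apply/setP => y.
by rewrite ?(in_nb, in_set2, in_setU1, in_setD1) in_tri !in_ed (negbTE xv) (negbTE xa) (negbTE xb) /= orbF.
Qed.

Lemma edgesofE E C : edgesof E C = (\sum_(x in C) deg E x)%N.
Proof.
rewrite /edgesof -sum1_card.
rewrite (partition_big (fun p : 'I_N * 'I_N => p.1) (mem C)) /=; last by move=> p; rewrite !inE => /andP[].
apply: eq_bigr => x xC; rewrite degE -sum1_card.
rewrite (reindex_onto (pair x) snd) /=; last by move=> [y z] /andP[_ /eqP <-].
by apply: eq_bigl => y; rewrite !inE /= !eqxx !andbT xC andbT.
Qed.

Lemma isolated_comp E v x : simple_graph E -> deg E v = 0%N -> x != v -> v \notin ccomp E x.
Proof.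
move=> sE /eqP/deg0P v0 xv; rewrite compE comp_sym //; apply/connectP => -[[|y p]] /=.
  by move=> _ e; rewrite e eqxx in xv.
by case/andP => vy; case/negP: (v0 y).
Qed.

Lemma isolated_comp1 E v : simple_graph E -> deg E v = 0%N -> ccomp E v = [set v].
Proof.
move=> sE v0; apply/setP => x; rewrite in_set1; apply/idP/eqP => [|->]; last by rewrite compE.
by apply: contraTeq => xv; rewrite compE comp_sym // -compE isolated_comp.
Qed.

Lemma card_comp_ge2 E x : simple_graph E -> (0 < deg E x)%N -> (2 <= #|ccomp E x|)%N.
Proof.
move=> sE; rewrite degE => /card_gt0P[y]; rewrite in_nb => xy.
have xNy := simple_edge_neq sE xy.
have <- : #|[set x; y]| = 2%N by rewrite cards2 xNy.
apply: subset_leq_card; apply/subsetP => z; rewrite in_set2 compE => /orP[] /eqP ->.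
  exact: connect0.
exact: connect1.
Qed.

(** Sending [v] to [a] contracts the subdivided edge back. *)
Lemma connect_ins E v a b : simple_graph E -> (a, b) \in E -> deg E v = 0%N ->
  let pr x := if x == v then a else x in
  forall x y, connect (adj (ins E v a b)) x y = connect (adj E) (pr x) (pr y).
Proof.
move=> sE ab v0 pr; have/simpleP[ir sy] := sE.
have/eqP/deg0P nv := v0.
have vna : v != a by apply: contraTneq ab => <-; apply: nv.
have vnb : v != b.
  by apply: contraTneq ab => <-; rewrite -[_ \in E]/(adj E a v) sy; apply: nv.
have sI : simple_graph (ins E v a b) by apply: simple_ins.
have pra : pr a = a by rewrite /pr eq_sym (negbTE vna).
have prb : pr b = b by rewrite /pr eq_sym (negbTE vnb).
have prv : pr v = a by rewrite /pr eqxx.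
have va : adj (ins E v a b) v a by rewrite /adj in_ins !in_ed !eqxx /= !orbT.
have vb : adj (ins E v a b) v b by rewrite /adj in_ins !in_ed !eqxx /= !orbT.
have cab : connect (adj E) a b by apply: connect1.
have cba : connect (adj E) b a by rewrite comp_sym.
apply: connect_contract => // [x y|x y xy|x].
- rewrite /adj in_ins => /orP[/andP[_ xy]|].
    have -> : pr x = x by rewrite /pr; case: (x =P v) xy => // ->; rewrite (negbTE (nv _)).
    have -> : pr y = y.
      rewrite /pr; case: (y =P v) xy => // ->.
      by rewrite -[_ \in E]/(adj E x v) sy /adj (negbTE (nv _)).
    exact: connect1.
  by rewrite !in_ed => /orP[] /orP[] /andP[/eqP-> /eqP->]; rewrite ?prv ?pra ?prb.
- have [|xyN] := boolP ((x, y) \in ed a b); last first.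
    by apply: connect1; rewrite /adj in_ins xyN; move: xy; rewrite /adj => ->.
  rewrite in_ed => /orP[] /andP[/eqP-> /eqP->].
    by apply: connect_trans (connect1 vb); rewrite comp_sym //; apply: connect1.
  by apply: connect_trans (connect1 va); rewrite comp_sym //; apply: connect1.
by rewrite /pr; case: eqP => [->|_]; [apply: connect1 | apply: connect0].
Qed.

(** The three vertices are isolated in [E], so one of them, here [v], can stand for the whole
    triangle. *)
Lemma connect_tri E v a b : simple_graph E -> v != a -> v != b -> a != b ->
  deg E v = 0%N -> deg E a = 0%N -> deg E b = 0%N ->
  let pr x := if [|| x == v, x == a | x == b] then v else x in
  forall x y, connect (adj (tri E v a b)) x y = connect (adj E) (pr x) (pr y).
Proof.
move=> sE vna vnb anb v0 a0 b0 pr; have/simpleP[ir sy] := sE.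
have sT : simple_graph (tri E v a b) by apply: simple_tri.
have iso u x y : deg E u = 0%N -> (x, y) \in E -> (x == u) = false /\ (y == u) = false.
  move=> /eqP/deg0P nu xy; split; apply/negbTE.
    by apply: contraTneq xy => ->; apply: nu.
  by apply: contraTneq xy => ->; rewrite -[_ \in E]/(adj E x u) sy; apply: nu.
have va : adj (tri E v a b) v a by rewrite /adj in_tri !in_ed !eqxx /= !orbT.
have vb : adj (tri E v a b) v b by rewrite /adj in_tri !in_ed !eqxx /= !orbT.
apply: connect_contract => // [x y|x y xy|x].
- rewrite /adj in_tri => /orP[xy|].
    have [xv yv] := iso _ _ _ v0 xy; have [xa ya] := iso _ _ _ a0 xy.
    have [xb yb] := iso _ _ _ b0 xy.
    by rewrite /pr xv xa xb yv ya yb /=; apply: connect1.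
  have prv : pr v = v by rewrite /pr eqxx.
  have pra : pr a = v by rewrite /pr eqxx orbT.
  have prb : pr b = v by rewrite /pr eqxx !orbT.
  by rewrite !in_ed => /orP[/orP[]|] /orP[] /andP[/eqP-> /eqP->]; rewrite ?prv ?pra ?prb connect0.
- by apply: connect1; rewrite /adj in_tri; move: xy; rewrite /adj => ->.
rewrite /pr; case: ifP => [|_]; last exact: connect0.
case/or3P => /eqP ->; first exact: connect0.
  by rewrite comp_sym //; apply: connect1.
by rewrite comp_sym //; apply: connect1.
Qed.

(** Only the component of [a] changes: it gains one vertex and one edge, that is, two ordered
    edges. *)
Lemma St_ins E D v a b : simple_graph E -> (a, b) \in E -> deg E v = 0%N -> v \notin D ->
  (forall x, x \in D -> (0 < deg E x)%N) -> a \in D ->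
  perm_eq (St (ins E v a b) (v |: D))
          (grow (cstat E (ccomp E a)) :: rem (cstat E (ccomp E a)) (St E D)).
Proof.
move=> sE ab v0 vD degD aD.
have cI := connect_ins sE ab v0; set pr := (fun x => _) in cI.
have vna : a != v by apply: contraTneq aD => ->.
have prD : pr @: (v |: D) = D.
  apply/setP => x; apply/imsetP/idP => [[y]|xD].
    rewrite in_setU1 /pr => /orP[/eqP->|yD] ->; first by rewrite eqxx.
    by case: ifP.
  exists x; first by rewrite in_setU1 xD orbT.
  by rewrite /pr; case: eqP xD vD => // -> ->.
have vC C : C \in comps E D -> v \notin C.
  by case/imsetP => x xD ->; apply: isolated_comp => //; apply: contraTneq xD => ->.
have phi C : C \in comps E D -> pr @^-1: C = if a \in C then v |: C else C.
  move=> /vC vNC; apply/setP => x; rewrite inE /pr; have [->|xv] := eqVneq x v.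
    by case: ifP => aC; rewrite ?aC ?in_setU1 ?eqxx ?(negbTE vNC).
  by case: (a \in C); rewrite // in_setU1 (negbTE xv).
have phiI : {in comps E D &, injective (fun C : {set 'I_N} => pr @^-1: C)}.
  move=> C C' cC cC' e; apply/setP => x; have [->|xv] := eqVneq x v.
    by rewrite (negbTE (vC _ cC)) (negbTE (vC _ cC')).
  by have /setP/(_ x) := e; rewrite !inE /pr (negbTE xv).
rewrite /St (comps_contract _ cI) prD.
apply: perm_trans (perm_map_imset _ phiI) _.
set C0 := ccomp E a.
have C0c : C0 \in comps E D by apply: imset_f.
apply: perm_trans (perm_map _ (perm_enum_cons C0c)) _; rewrite map_cons.
have aC0 : a \in C0 by rewrite compE connect0.
have -> : cstat (ins E v a b) (pr @^-1: C0) = grow (cstat E C0).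
  rewrite phi // aC0 /cstat /grow /=; congr (_, _).
    by rewrite cardsU1 vC // add1n subSn // card_comp_ge2 // degD.
  rewrite !edgesofE big_setU1 ?vC //= deg_ins // v0 eqxx add0n.
  rewrite (eq_bigr (deg E)) // => x xC; rewrite deg_ins //.
  by case: eqP xC => [->|_ _]; rewrite ?addn0 // (negbTE (vC _ C0c)).
rewrite perm_cons perm_sym (permPl (perm_enum_rem _ C0c)).
rewrite (_ : [seq cstat (ins E v a b) _ | x <- _] = [seq cstat E C | C <- enum (comps E D :\ C0)]) //.
apply/eq_in_map => C; rewrite mem_enum in_setD1 => /andP[CC0 cC].
have aC : a \notin C.
  apply: contra CC0; case/imsetP: (cC) => x xD ->; rewrite compE => xa.
  by rewrite /C0 comp_eq.
rewrite phi // (negbTE aC) /cstat; congr (_, _).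
rewrite !edgesofE; apply: eq_bigr => x xC; rewrite deg_ins //.
by case: eqP xC => [->|_ _]; rewrite ?addn0 // (negbTE (vC _ cC)).
Qed.

(** The new component has three vertices and six ordered edges, hence the entry [(1, 6)]. *)
Lemma St_tri E D v a b : simple_graph E -> v != a -> v != b -> a != b ->
  deg E v = 0%N -> deg E a = 0%N -> deg E b = 0%N -> v \notin D -> a \notin D -> b \notin D ->
  perm_eq (St (tri E v a b) (v |: (a |: (b |: D)))) ((1, 6)%N :: St E D).
Proof.
move=> sE va vb ab v0 a0 b0 vD aD bD.
have cI := connect_tri sE va vb ab v0 a0 b0; set pr := (fun x => _) in cI.
have prv : pr v = v by rewrite /pr eqxx.
have prDid x : x \in D -> pr x = x.
  rewrite /pr; case: ifP => // /or3P[] /eqP ->.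
  - by rewrite (negbTE vD).
  - by rewrite (negbTE aD).
  - by rewrite (negbTE bD).
have prD : pr @: (v |: (a |: (b |: D))) = v |: D.
  apply/setP => x; apply/imsetP/idP => [[y]|].
    rewrite !in_setU1 /pr => yD ->; case: ifP => [_|]; first by rewrite eqxx.
    by move: yD; rewrite !orbA => /orP[->//|-> _]; rewrite orbT.
  rewrite in_setU1 => /orP[/eqP->|xD].
    by exists v; rewrite ?prv // in_setU1 eqxx.
  by exists x; rewrite ?prDid // !in_setU1 xD !orbT.
have cvD : comps E (v |: D) = [set v] |: comps E D.
  by rewrite /comps imsetU1 isolated_comp1.
have iC u C : deg E u = 0%N -> u \notin D -> C \in comps E D -> u \notin C.
  by move=> u0 uD /imsetP[x xD ->]; apply: isolated_comp => //; apply: contraTneq xD => ->.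
have phi C : C \in comps E D -> pr @^-1: C = C.
  move=> cC; apply/setP => x; rewrite inE /pr.
  case: ifP => // /or3P[] /eqP ->; rewrite (negbTE (iC v C _ _ _)) //.
    by rewrite (negbTE (iC a C _ _ _)).
  by rewrite (negbTE (iC b C _ _ _)).
have phi0 : pr @^-1: [set v] = [set v; a; b].
  apply/setP => x; rewrite !inE /pr -orbA; case: ifP => // h; first by rewrite eqxx.
  by move: h; case: eqP.
have vN : [set v] \notin comps E D.
  by apply/negP => /(iC v _ v0 vD); rewrite in_set1 eqxx.
have phiI : {in comps E (v |: D) &, injective (fun C : {set 'I_N} => pr @^-1: C)}.
  move=> C C'; rewrite cvD !in_setU1 => /orP[/eqP->|cC] /orP[/eqP->|cC'] //.
  - by rewrite (phi C') // => /setP/(_ v); rewrite !inE prv eqxx (negbTE (iC v _ _ _ cC')).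
  - by rewrite (phi C) // => /setP/(_ v); rewrite !inE prv eqxx (negbTE (iC v _ _ _ cC)).
  - by rewrite !phi.
rewrite /St (comps_contract _ cI) prD.
apply: perm_trans (perm_map_imset _ phiI) _.
have vc : [set v] \in comps E (v |: D) by rewrite cvD in_setU1 eqxx.
apply: perm_trans (perm_map _ (perm_enum_cons vc)) _; rewrite map_cons.
have -> : cstat (tri E v a b) (pr @^-1: [set v]) = (1, 6)%N.
  have c3 : #|[set v; a; b]| = 3%N.
    by rewrite setUC cardsU1 cards2 va !inE negb_or !(eq_sym b) vb ab.
  rewrite phi0 /cstat c3 edgesofE; congr (_, _).
  rewrite (eq_bigr (fun=> 2)%N) ?sum_nat_const ?c3 // => x.
  by rewrite !inE -orbA => h; rewrite deg_tri // h; case/or3P: h => /eqP->; rewrite ?v0 ?a0 ?b0.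
rewrite perm_cons (_ : comps E (v |: D) :\ [set v] = comps E D); last first.
  by rewrite cvD setU1K.
rewrite (_ : [seq cstat _ _ | x <- _] = [seq cstat E C | C <- enum (comps E D)]) //.
apply/eq_in_map => C; rewrite mem_enum => cC; rewrite phi // /cstat; congr (_, _).
rewrite !edgesofE; apply: eq_bigr => x xC; rewrite deg_tri //.
have [xv|_] := eqVneq x v; first by rewrite xv (negbTE (iC v C _ _ _)) in xC.
have [xv|_] := eqVneq x a; first by rewrite xv (negbTE (iC a C _ _ _)) in xC.
have [xv|_] := eqVneq x b; first by rewrite xv (negbTE (iC b C _ _ _)) in xC.
by rewrite addn0.
Qed.

End Components.

(** * Sums over graphs with prescribed degrees *)

Section GraphSums.
Variables (R : comPzRingType) (N : nat).
Implicit Types (E : graph N) (D : {set 'I_N}) (F : state -> R).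

Lemma GGP D1 D2 E : reflect (simple_graph E /\ forall v, deg E v = ((v \in D1) + (v \in D2).*2)%N)
  (E \in GG D1 D2).
Proof.
rewrite in_set; apply: (iffP andP) => -[h1 h2]; split=> //.
  by move=> v; apply/eqP/(forallP h2).
by apply/forallP => v; rewrite h2.
Qed.

Definition gsum D1 D2 F : R := \sum_(E in GG D1 D2) F (St E (D1 :|: D2)).

Lemma sum_neighbor_pairs (E : graph N) v (c : R) : deg E v = 2%N ->
  \sum_(p : 'I_N * 'I_N | [&& (v, p.1) \in E, (v, p.2) \in E & p.1 != p.2]) c = 2%:R * c.
Proof.
rewrite degE => /eqP/cards2P[a [b [ab e]]].
have h y : ((v, y) \in E) = (y == a) || (y == b).
  by have /setP/(_ y) := e; rewrite in_nb in_set2.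
rewrite sumr_const mulr_natl; congr (_ *+ _).
have <- : #|[set (a, b); (b, a)]| = 2%N.
  by rewrite cards2 xpair_eqE (negbTE ab).
apply: eq_card => -[y z]; rewrite in_set2 unfold_in /= !h !xpair_eqE.
have ba : b != a by rewrite eq_sym.
apply/idP/idP.
  by case/and3P=> /orP[]/eqP-> /orP[]/eqP->; rewrite ?eqxx ?orbT.
by case/orP=> /andP[/eqP-> /eqP->]; rewrite !eqxx ?ab ?ba ?orbT.
Qed.

(** Every graph is counted once for each order of the two neighbours of [v]. Fixing the ordered pair
    makes the deletion of [v] reversible. *)
Lemma gsum_double D1 D2 v F : v \in D2 -> [disjoint D1 & D2] ->
  2%:R * gsum D1 D2 F =
  \sum_p \sum_(E in GG D1 D2 | [&& (v, p.1) \in E, (v, p.2) \in E & p.1 != p.2])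
     F (St E (D1 :|: D2)).
Proof.
move=> vD2 dD; rewrite /gsum mulr_sumr.
rewrite (exchange_big_dep (mem (GG D1 D2))) //=; last by move=> p E _ /andP[].
apply: eq_bigr => E EG; have/GGP[_ dE] := EG.
rewrite -(@sum_neighbor_pairs E v); first by apply: eq_bigl => p; rewrite EG.
by rewrite dE vD2 (disjointFl dD vD2).
Qed.

(** As [ab] is not an edge, [del] creates no double edge, and the image remembers by its edge [ab]
    where [v] has to be inserted: deletion is a bijection. *)
Lemma sum_open D1 D2 v a b (G : graph N -> R) : v \in D2 -> [disjoint D1 & D2] ->
  \sum_(E in GG D1 D2 | [&& (v, a) \in E, (v, b) \in E & a != b] && ((a, b) \notin E)) G E =
  \sum_(E in GG D1 (D2 :\ v) | (a, b) \in E) G (ins E v a b).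
Proof.
move=> vD2 dD; have vD1 : v \in D1 = false by apply: disjointFl dD vD2.
have vany E : E \in GG D1 (D2 :\ v) -> deg E v = 0%N.
  by case/GGP => _ ->; rewrite vD1 in_setD1 eqxx.
have PQ E : E \in GG D1 D2 -> (v, a) \in E -> (v, b) \in E -> a != b -> (a, b) \notin E ->
    del E v a b \in GG D1 (D2 :\ v) /\ (a, b) \in del E v a b.
  move=> EG va vb ab abN; have/GGP[sE dE] := EG.
  have sD : simple_graph (del E v a b) by apply: simple_del.
  have dv : deg E v = 2%N by rewrite dE vD1 vD2.
  have [_ nv] := deg_set2 ab va vb (eq_leq dv).
  have abD : (a, b) \in del E v a b by rewrite in_del !in_ed !eqxx !orbT.
  have dv0 : deg (del E v a b) v = 0%N.
    apply/eqP/deg0P => y; rewrite in_del !in_ed eqxx nv.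
    rewrite (negbTE (simple_edge_neq sE va)) (negbTE (simple_edge_neq sE vb)) /= !orbF.
    by case: (y == a) (y == b) => [] [].
  split=> //; apply/GGP; split=> // x.
  have := deg_ins x sD abD dv0; rewrite delK // dE in_setD1.
  have [->|_] := eqVneq x v; last by move=> ->; rewrite addn0.
  by rewrite dv0 vD1.
have QP E : E \in GG D1 (D2 :\ v) -> (a, b) \in E ->
    [/\ ins E v a b \in GG D1 D2, (v, a) \in ins E v a b, (v, b) \in ins E v a b, a != b &
        (a, b) \notin ins E v a b].
  move=> EG ab; have/GGP[sE dE] := EG; have v0 := vany _ EG.
  have/simpleP[_ sy] := sE.
  have /eqP/deg0P nv := v0.
  have vna : v != a by apply: contraTneq ab => <-; apply: nv.
  have vnb : v != b.
    by apply: contraTneq ab => <-; rewrite -[_ \in E]/(adj E a v) sy; apply: nv.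
  split; first apply/GGP; first split.
  - exact: simple_ins.
  - move=> x; rewrite deg_ins // dE in_setD1; have [->|_] := eqVneq x v; last by rewrite addn0.
    by rewrite vD1 vD2.
  - by rewrite in_ins !in_ed !eqxx !orbT.
  - by rewrite in_ins !in_ed !eqxx !orbT.
  - exact: simple_edge_neq ab.
  rewrite in_ins !in_ed !eqxx (eq_sym a v) (eq_sym b v) (negbTE vna) (negbTE vnb).
  by rewrite /= !andbF.
rewrite (reindex_onto (fun E => ins E v a b) (fun E => del E v a b)) /=; last first.
  by move=> E /andP[/GGP[sE _] /andP[/and3P[va vb _] ab]]; apply: delK.
apply: eq_bigl => E; apply/idP/idP.
  case/andP=> /andP[EG /andP[/and3P[va vb ab] abN]] /eqP e.
  by have [] := PQ _ EG va vb ab abN; rewrite e => -> ->.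
case/andP=> EG ab; have [-> -> -> -> ->] := QP _ EG ab => /=.
by have/GGP[sE _] := EG; rewrite insK ?vany.
Qed.

(** If [ab] is an edge, each of [v], [a], [b] has the other two as its only neighbours, so [a] and
    [b] lie in [D2] and the triangle is a whole component, which is removed at once. *)
Lemma sum_closed D1 D2 v a b (G : graph N -> R) : v \in D2 -> [disjoint D1 & D2] ->
  \sum_(E in GG D1 D2 | [&& (v, a) \in E, (v, b) \in E & a != b] && ((a, b) \in E)) G E =
  if [&& a \in D2 :\ v, b \in D2 :\ v & a != b] then
     \sum_(E in GG D1 (D2 :\ v :\ a :\ b)) G (tri E v a b) else 0.
Proof.
move=> vD2 dD; have dj x : x \in D2 -> x \in D1 = false by apply: disjointFl dD.
have facts E : E \in GG D1 D2 -> (v, a) \in E -> (v, b) \in E -> a != b -> (a, b) \in E ->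
    [/\ a \in D2 :\ v, b \in D2 :\ v & untri E v a b \in GG D1 (D2 :\ v :\ a :\ b)].
  move=> EG va vb ab abE; have/GGP[sE dE] := EG; have/simpleP[_ sy] := sE.
  have vna := simple_edge_neq sE va; have vnb := simple_edge_neq sE vb.
  have le2 x : (deg E x <= 2)%N.
    by rewrite dE; case: (boolP (x \in D2)) => [/dj ->|] //; case: (x \in D1).
  have av : (a, v) \in E by rewrite -[_ \in E]/(adj E a v) sy.
  have bv : (b, v) \in E by rewrite -[_ \in E]/(adj E b v) sy.
  have ba : (b, a) \in E by rewrite -[_ \in E]/(adj E b a) sy.
  have [dv nv] := deg_set2 ab va vb (le2 _).
  have [da na] := deg_set2 vnb av abE (le2 _).
  have [db nb] := deg_set2 vna bv ba (le2 _).
  have inD2 x : deg E x = 2%N -> x \in D2.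
    by rewrite dE; case: (x \in D2) => //; case: (x \in D1).
  have aD := inD2 _ da; have bD := inD2 _ db.
  have F := (negbTE vna, negbTE vnb, negbTE ab, eq_sym a v, eq_sym b v, eq_sym b a).
  have d0 x : (forall y, (x, y) \notin untri E v a b) -> deg (untri E v a b) x = 0%N.
    by move=> h; apply/eqP/deg0P.
  have uv : deg (untri E v a b) v = 0%N.
    apply: d0 => y; rewrite in_untri !in_ed nv !eqxx !F /= !orbF.
    by case: (y == a) (y == b) => [] [].
  have ua : deg (untri E v a b) a = 0%N.
    apply: d0 => y; rewrite in_untri !in_ed na !eqxx !F /= !orbF.
    by case: (y == v) (y == b) => [] [].
  have ub : deg (untri E v a b) b = 0%N.
    apply: d0 => y; rewrite in_untri !in_ed nb !eqxx !F /= ?orbF.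
    by case: (y == v) (y == a) => [] [].
  rewrite !in_setD1 !F !aD !bD; split=> //; apply/GGP; split; first exact: simple_untri.
  move=> x; have := deg_tri x (simple_untri v a b sE) vna vnb ab uv ua ub.
  rewrite untriK // dE !in_setD1.
  have [->|_] := eqVneq x v; first by rewrite uv ?F /= (dj v) ?vD2.
  have [->|_] := eqVneq x a; first by rewrite ua ?F /= (dj a) ?aD.
  have [->|_] := eqVneq x b; first by rewrite ub ?F /= (dj b) ?bD.
  by rewrite /= addn0.
case: ifP => [/and3P[aD bD ab]|h]; last first.
  rewrite big_pred0 // => E; apply/negbTE/negP.
  case/andP=> EG /andP[/and3P[va vb ab] abE].
  by have [aD bD _] := facts _ EG va vb ab abE; rewrite aD bD ab in h.
have avn : a != v by move: aD; rewrite in_setD1 => /andP[].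
have bvn : b != v by move: bD; rewrite in_setD1 => /andP[].
have aD2 : a \in D2 by move: aD; rewrite in_setD1 => /andP[].
have bD2 : b \in D2 by move: bD; rewrite in_setD1 => /andP[].
rewrite (reindex_onto (fun E => tri E v a b) (fun E => untri E v a b)) /=; last first.
  by move=> E /andP[/GGP[sE _] /andP[/and3P[va vb _] abE]]; apply: untriK.
have F := (negbTE avn, negbTE bvn, negbTE ab, eq_sym v a, eq_sym v b, eq_sym b a).
apply: eq_bigl => E; apply/idP/idP.
  case/andP=> /andP[EG /andP[/and3P[va vb ab'] abE]] /eqP e.
  by have [_ _] := facts _ EG va vb ab' abE; rewrite e.
move=> EG; have/GGP[sE dE] := EG.
have v0 : deg E v = 0%N by rewrite dE (dj v) // !in_setD1 !eqxx !andbF.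
have a0 : deg E a = 0%N by rewrite dE (dj a) // !in_setD1 !eqxx !andbF.
have b0 : deg E b = 0%N by rewrite dE (dj b) // !in_setD1 !eqxx.
rewrite triK // !in_tri !in_ed !eqxx !F /= !orbT !andbT.
apply/GGP; split; first by apply: simple_tri; rewrite // eq_sym.
move=> x; rewrite deg_tri // 1?eq_sym // dE !in_setD1.
have [->|_] := eqVneq x v; first by rewrite ?F /= (dj v) // vD2.
have [->|_] := eqVneq x a; first by rewrite ?F /= (dj a) // aD2.
have [->|_] := eqVneq x b; first by rewrite ?F /= (dj b) // bD2.
by rewrite /= addn0.
Qed.

(** In the open case the sum runs over the ordered edges of the smaller graph; grouped by component,
    each component is chosen as often as it has ordered edges, which is [growth]. The closed case
    gives the triangles. *)
Lemma gsum_rec D1 D2 v F : v \in D2 -> [disjoint D1 & D2] -> perm_inv F ->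
  2%:R * gsum D1 D2 F = gsum D1 (D2 :\ v) (growth F) +
  \sum_(p : 'I_N * 'I_N | [&& p.1 \in D2 :\ v, p.2 \in D2 :\ v & p.1 != p.2])
     gsum D1 (D2 :\ v :\ p.1 :\ p.2) (newtri F).
Proof.
move=> vD2 dD FP; rewrite (gsum_double _ vD2 dD).
have dj x : x \in D2 -> x \in D1 = false by apply: disjointFl dD.
have vN : v \notin D1 :|: (D2 :\ v) by rewrite in_setU in_setD1 eqxx dj.
have D12 : D1 :|: D2 = v |: (D1 :|: (D2 :\ v)) by rewrite setUCA setD1K.
have splitE (p : 'I_N * 'I_N) :
    \sum_(E in GG D1 D2 | [&& (v, p.1) \in E, (v, p.2) \in E & p.1 != p.2]) F (St E (D1 :|: D2)) =
    \sum_(E in GG D1 (D2 :\ v) | p \in E)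
      F (grow (cstat E (ccomp E p.1)) :: rem (cstat E (ccomp E p.1)) (St E (D1 :|: (D2 :\ v)))) +
    if [&& p.1 \in D2 :\ v, p.2 \in D2 :\ v & p.1 != p.2] then
      gsum D1 (D2 :\ v :\ p.1 :\ p.2) (newtri F) else 0.
  case: p => a b /=; rewrite (bigID (fun E => (a, b) \notin E)) /=; congr (_ + _).
    under eq_bigl do rewrite -andbA.
    rewrite (sum_open a b (fun E => F (St E (D1 :|: D2)))) //.
    apply: eq_bigr => E /andP[/GGP[sE dE] ab]; apply: FP; rewrite D12; apply: St_ins => //.
    - by rewrite dE (dj v) // in_setD1 eqxx.
    - move=> x; rewrite in_setU dE => /orP[-> //|->]; exact: ltn_addl.
    have : deg E a != 0%N by apply/negP => /deg0P/(_ b); rewrite ab.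
    by rewrite in_setU dE; case: (a \in D1) => //; case: (a \in _).
  under eq_bigl do rewrite negbK -andbA.
  rewrite (sum_closed a b (fun E => F (St E (D1 :|: D2)))) //.
  case: ifP => // /and3P[aD bD ab]; apply: eq_bigr => E /GGP[sE dE]; apply: FP.
  move: (aD) (bD); rewrite !in_setD1 => /andP[av aD2] /andP[bv bD2].
  have -> : D1 :|: D2 = v |: (a |: (b |: (D1 :|: (D2 :\ v :\ a :\ b)))).
    apply/setP => x; rewrite !(in_setU1, in_setU, in_setD1).
    have [->|xv] := eqVneq x v; first by rewrite vD2 orbT.
    have [->|xa] := eqVneq x a; first by rewrite aD2 orbT.
    by have [->|xb] := eqVneq x b; first by rewrite bD2 orbT.
  apply: St_tri; rewrite ?dE ?(in_setU, in_setD1) ?dj ?eqxx ?andbF //; by rewrite eq_sym.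
rewrite (eq_bigr _ (fun p _ => splitE p)) big_split /= -big_mkcond /=; congr (_ + _).
rewrite (exchange_big_dep (mem (GG D1 (D2 :\ v)))) //=; last by move=> p E _ /andP[].
apply: eq_bigr => E EG; have/GGP[sE dE] := EG; rewrite /growth /St big_map big_enum /=.
transitivity (\sum_(p in E) F (grow (cstat E (ccomp E p.1)) ::
    rem (cstat E (ccomp E p.1)) (St E (D1 :|: (D2 :\ v))))).
  by apply: eq_bigl => p; rewrite EG.
rewrite (partition_big (fun p : 'I_N * 'I_N => ccomp E p.1)
    (mem (comps E (D1 :|: (D2 :\ v))))) /=; last first.
  move=> [a b] ab /=; apply: imset_f.
  have : deg E a != 0%N by apply/negP => /deg0P/(_ b); rewrite ab.
  by rewrite in_setU dE; case: (a \in D1) => //; case: (a \in _).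
apply: eq_bigr => C /imsetP[x xD ->].
rewrite (eq_bigr (fun=> F (grow (cstat E (ccomp E x)) ::
    rem (cstat E (ccomp E x)) (St E (D1 :|: (D2 :\ v)))))); last by move=> p /andP[_ /eqP->].
rewrite sumr_const mulr_natl; congr (_ *+ _); apply: eq_card => p.
by rewrite in_set unfold_in /= comp_eq // compE comp_sym.
Qed.

Lemma sum_perfect_matchings D1 m F : #|D1| = m.*2 -> perm_inv F ->
  gsum D1 set0 F = #|GG D1 set0|%:R * F (nseq m (0, 2)%N).
Proof.
move=> cD FP; rewrite /gsum setU0 mulr_natl -sumr_const.
apply: eq_bigr => E /GGP[sE dE]; apply: FP.
have d1 x : x \in D1 -> deg E x = 1%N by move=> xD; rewrite dE xD in_set0.
have cc x : x \in D1 -> cstat E (ccomp E x) = (0, 2)%N /\ #|ccomp E x| = 2%N.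
  move=> xD; have/eqP := d1 _ xD; rewrite degE => /cards1P[y nx].
  have/simpleP[_ sy] := sE.
  have hx z : ((x, z) \in E) = (z == y) by have /setP/(_ z) := nx; rewrite in_nb in_set1.
  have xy : (x, y) \in E by rewrite hx.
  have yx : (y, x) \in E by rewrite -[_ \in E]/(adj E y x) sy.
  have yD : y \in D1.
    have : deg E y != 0%N by apply/negP => /deg0P/(_ x); rewrite yx.
    by rewrite dE in_set0 addn0; case: (y \in D1).
  have/eqP := d1 _ yD; rewrite degE => /cards1P[x' ny].
  have hy z : ((y, z) \in E) = (z == x).
    have e w : ((y, w) \in E) = (w == x') by have /setP/(_ w) := ny; rewrite in_nb in_set1.
    by move: yx; rewrite !e => /eqP->.
  have xNy := simple_edge_neq sE xy.
  have ce : ccomp E x = [set x; y].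
    apply/setP => z; rewrite compE in_set2; apply/idP/orP => [|[]/eqP->]; last first.
    - exact: connect1.
    - exact: connect0.
    suff h u w : connect (adj E) u w -> (u == x) || (u == y) -> (w == x) || (w == y).
      by move=> /h; rewrite eqxx => /(_ isT)/orP.
    case/connectP=> p; elim: p u => [|t p ih] u /=; first by move=> _ ->.
    case/andP=> ut pp wl /orP[] /eqP ue; apply: (ih t) => //;
      by move: ut; rewrite /adj ue ?hx ?hy => ->; rewrite ?orbT.
  rewrite /cstat ce cards2 xNy edgesofE; split=> //; congr (_, _).
  by rewrite big_setU1 ?in_set1 //= big_set1 !d1.
have cc' C : C \in comps E D1 -> cstat E C = (0, 2)%N /\ #|C| = 2%N.
  by case/imsetP=> x xD ->; apply: cc.
have sz : #|comps E D1| = m.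
  apply: (double_inj); rewrite -cD -[#|D1|]sum1_card.
  rewrite (partition_big (ccomp E) (mem (comps E D1))) /=; last by move=> x; apply: imset_f.
  rewrite -muln2 -sum_nat_const; apply: eq_bigr => C cC.
  rewrite -[LHS](proj2 (cc' _ cC)) -sum1_card; case/imsetP: cC => x xD ->.
  apply: eq_bigl => y; rewrite comp_eq // comp_sym // -compE.
  apply/idP/andP => [h|[]//]; split=> //.
  move: h; rewrite compE comp_sym // => /connectP[[|z p] /=]; first by move=> _ <-.
  case/andP=> yz _ _.
  have : deg E y != 0%N by apply/negP => /deg0P/(_ z); move: yz; rewrite /adj => ->.
  by rewrite dE in_set0 addn0; case: (y \in D1).
have -> : St E D1 = nseq m (0, 2)%N.
  rewrite -sz cardE -(size_map (cstat E)); apply/all_pred1P/allP => x /mapP[C].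
  by rewrite mem_enum => cC ->; rewrite /= (proj1 (cc' _ cC)).
by [].
Qed.

Theorem gsum_hist D1 D2 m n F : #|D1| = m.*2 -> #|D2| = n -> [disjoint D1 & D2] -> perm_inv F ->
  2%:R ^+ n * gsum D1 D2 F = #|GG D1 set0|%:R * hist m n F.
Proof.
move=> cD1; elim/ltn_ind: n D2 F => n ih D2 F cD2 dD FP.
case: n ih cD2 => [|n] ih cD2.
  by move/eqP: cD2; rewrite cards_eq0 => /eqP->; rewrite expr0 mul1r (@sum_perfect_matchings _ m).
have /card_gt0P[v vD2] : (0 < #|D2|)%N by rewrite cD2.
have cv : #|D2 :\ v| = n by have := cardsD1 v D2; rewrite vD2 cD2 => -[].
have dv : [disjoint D1 & D2 :\ v] by apply: disjointWr dD; apply: subD1set.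
rewrite exprSr -mulrA (gsum_rec vD2 dD FP) mulrDr (ih n) //; last exact: growth_inv.
rewrite [hist m n.+1 F]/= mulrDr; congr (_ + _).
case: n ih cv {cD2} => [|[|n]] ih cv.
- rewrite mulr0 big_pred0 ?mulr0 // => -[a b] /=.
  by rewrite (card0_eq cv).
- rewrite mulr0 big_pred0 ?mulr0 // => -[a b] /=.
  move/eqP/cards1P: cv => [c ->]; rewrite !in_set1.
  by apply/negbTE/negP => /and3P[/eqP-> /eqP->]; rewrite eqxx.
rewrite mulr_sumr (eq_bigr (fun=> 4%:R * (#|GG D1 set0|%:R * hist m n (newtri F)))); last first.
  move=> [a b] /= /and3P[aD bD ab].
  have ca : #|D2 :\ v :\ a| = n.+1 by have := cardsD1 a (D2 :\ v); rewrite aD cv => -[].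
  have cb : #|D2 :\ v :\ a :\ b| = n.
    have bDa : b \in D2 :\ v :\ a by rewrite in_setD1 bD andbT eq_sym.
    by have := cardsD1 b (D2 :\ v :\ a); rewrite bDa ca => -[].
  rewrite -(ih n _ (D2 :\ v :\ a :\ b)) //; [|by apply: leq_trans (leqnSn _)| |exact: newtri_inv].
    by rewrite !exprS !mulrA -natrM.
  by apply: disjointWr dv; apply: subset_trans (subD1set _ _) (subD1set _ _).
rewrite sumr_const -[_ *+ #|_|]mulr_natl.
have -> : #|[pred p : 'I_N * 'I_N | [&& p.1 \in D2 :\ v, p.2 \in D2 :\ v & p.1 != p.2]]| =
    (n.+2 * n.+1)%N.
  have := cardsX (D2 :\ v) (D2 :\ v); rewrite cv -(cardsID [set p | p.1 == p.2]).
  have -> : #|setX (D2 :\ v) (D2 :\ v) :&: [set p | p.1 == p.2]| = n.+2.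
    rewrite -cv -(@card_imset _ _ (fun x : 'I_N => (x, x))); last by move=> x y [].
    apply: eq_card => -[a b]; apply/idP/imsetP; rewrite in_setI in_setX in_set /=.
      by case/andP => /andP[aD _] /eqP <-; exists a.
    by case=> x xD [-> ->]; rewrite xD eqxx.
  rewrite mulnSr [X in _ = X]addnC => /addnI <-; apply: eq_card => -[a b].
  by rewrite in_setD in_setX in_set unfold_in /= [RHS]andbC -andbA.
by rewrite [X in _ = _ * (X * _)]natrM /=; ring.
Qed.

End GraphSums.

(** * From the uniform random graph to the recursion *)

Section UniformGraph.
Variable R : realType.
Implicit Types F : state -> R.

Lemma GclassP n1 n2 (E : graph (n1 + n2)) :
  (E \in Gclass n1 n2) =
  (#|[set v | deg E v == 1%N]%SET| == n1) &&
    (E \in GG [set v | deg E v == 1%N]%SET (~: [set v | deg E v == 1%N]%SET)).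
Proof.
set D1 := [set v | deg E v == 1%N]%SET.
have c1 k : #|[set v | deg E v == k]%classic| = #|[set v | deg E v == k]%SET|.
  by apply: eq_card => v; apply/idP/idP => [/set_mem|]; rewrite inE // => h; apply: mem_set.
apply/idP/andP => [|[/eqP h1 /GGP[sE dE]]].
  rewrite in_set => /and4P[sE /forallP d12 h1 h2]; rewrite -c1 h1; split=> //.
  apply/GGP; split=> // v; rewrite in_setC in_set.
  by case/orP: (d12 v) => /eqP ->.
have cD : #|~: D1| = n2 by have := cardsC D1; rewrite h1 card_ord => /addnI.
rewrite in_set sE !c1 h1 eqxx /=; apply/andP; split.
  by apply/forallP => v; rewrite dE in_setC; case: (v \in D1).
apply/eqP; rewrite -[RHS]cD; apply: eq_card => v; rewrite in_setC in_set dE in_setC.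
by case: (v \in D1).
Qed.

(** Ensures that the factor [#|GG D1 set0|], common to numerator and denominator of an expectation,
    is not zero and cancels. The witness joins 2k to 2k + 1. *)
Lemma exists_perfect_matching N m : (m.*2 <= N)%N ->
  exists2 D1 : {set 'I_N}, #|D1| = m.*2 & GG D1 set0 != set0.
Proof.
move=> mN; pose D1 := [set i : 'I_N | (i < m.*2)%N]%SET.
have cD : #|D1| = m.*2.
  have wI : injective (widen_ord mN) by move=> x y /(congr1 val) h; apply: val_inj.
  rewrite -[RHS](card_ord m.*2) -(card_imset _ wI); apply: eq_card => i.
  rewrite in_set; apply/idP/imsetP => [im|[j _ ->]]; last by rewrite /= (ltn_ord j).
  by exists (Ordinal im) => //; apply: val_inj.
exists D1 => //.
pose E : graph N := [set p : 'I_N * 'I_N | [&& (p.1 < m.*2)%N, (p.2 < m.*2)%N, p.1 != p.2 & p.1./2 == p.2./2]]%SET.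
have inE' x y : ((x, y) \in E) = [&& (x < m.*2)%N, (y < m.*2)%N, x != y & x./2 == y./2].
  by rewrite in_set.
apply/set0Pn; exists E; apply/GGP; split.
  apply/simpleP; split=> [x|x y]; first by rewrite inE' eqxx !andbF.
  by rewrite /adj !inE' andbCA (eq_sym x) (eq_sym x./2).
move=> x; rewrite in_set0 addn0 degE in_set.
case: (ltnP x m.*2) => xm; last first.
  by apply/eqP; rewrite cards_eq0; apply/eqP/setP => y; rewrite in_nb inE' ltnNge xm in_set0.
have ym : ((if odd x then x.-1 else x.+1) < m.*2)%N.
  by have := odd_double_half x; case: (odd x) => /=; lia.
pose y : 'I_N := Ordinal (leq_trans ym mN).
rewrite (_ : nb E x = [set y]%SET) ?cards1 //.
apply/setP => z; rewrite in_nb inE' in_set1 xm -!val_eqE /=.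
have := odd_double_half x; have := odd_double_half z; clear -xm ym.
move: (nat_of_ord x) (nat_of_ord z) xm ym => a b am.
by case: (odd a); case: (odd b) => /= am' eb ea; apply/idP/eqP; lia.
Qed.

(** Partition by the set of leaves: [hist m n F] depends only on their number, so it factors out. *)
Lemma sum_Gclass m n F : perm_inv F ->
  2%:R ^+ n * (\sum_(E in Gclass m.*2 n) F (St E [set: 'I_(m.*2 + n)])%SET) =
  (\sum_(D1 : {set 'I_(m.*2 + n)} | #|D1| == m.*2) #|GG D1 set0|)%:R * hist m n F.
Proof.
move=> FP; rewrite (partition_big (fun E => [set v | deg E v == 1%N]%SET) (fun D1 => #|D1| == m.*2)) /=; last first.
  by move=> E; rewrite GclassP => /andP[].
rewrite mulr_sumr natr_sum mulr_suml; apply: eq_bigr => D1 /eqP cD.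
have cC : #|~: D1| = n by have := cardsC D1; rewrite cD card_ord => /addnI.
have dC : [disjoint D1 & ~: D1] by rewrite disjoints_subset setCK.
rewrite -(gsum_hist (D2 := ~: D1)) //; congr (_ * _).
rewrite /gsum setUCr; apply: eq_bigl => E; apply/idP/idP.
  by rewrite GclassP => /andP[/andP[_ h] /eqP e]; rewrite e in h.
move=> h; have e : [set v | deg E v == 1%N]%SET = D1.
  apply/setP => v; rewrite in_set; case/GGP: h => _ ->.
  by rewrite in_setC; case: (v \in D1).
by rewrite GclassP e cD !eqxx h.
Qed.

Lemma Gclass_mass m n :
  (0 < \sum_(D1 : {set 'I_(m.*2 + n)} | #|D1| == m.*2) #|GG D1 set0|)%N.
Proof.
have [D1 cD h] := exists_perfect_matching (leq_addr n m.*2).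
by rewrite (bigD1 D1) /= ?cD // ltn_addr // card_gt0.
Qed.

Lemma Eunif_hist m n F : perm_inv F ->
  Eunif (Gclass m.*2 n) (fun E => F (St E [set: 'I_(m.*2 + n)]%SET)) =
  hist m n F / hist m n (fun=> 1).
Proof.
move=> FP; rewrite /Eunif.
have h1 : perm_inv (fun=> 1 : R) by [].
have := sum_Gclass m n FP; have := sum_Gclass m n h1.
rewrite sumr_const; have := Gclass_mass m n.
move: (\sum_(D1 | _) _)%N => M M0 e1 eF.
have p2 : 2%:R ^+ n != 0 :> R by rewrite expf_neq0 // pnatr_eq0.
have M1 : M%:R != 0 :> R by rewrite pnatr_eq0 -lt0n.
move: e1 eF; set c := #|_|%:R; set S := \sum_(E in _) _ => e1 eF.
have -> : hist m n F = 2 ^+ n * S / M%:R by rewrite eF mulrAC divff // mul1r.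
have -> : hist m n (fun=> 1) = 2 ^+ n * c / M%:R :> R by rewrite /c e1 mulrAC divff // mul1r.
(* For an empty class both sides are 0, because division by 0 gives 0. *)
have [->|c0] := eqVneq c 0; first by rewrite mulr0 mul0r !invr0 !mulr0.
by field; rewrite c0 p2 M1.
Qed.

Lemma Eunif_ext N (S : {set graph N}) (X Y : graph N -> R) :
  (forall E, E \in S -> X E = Y E) -> Eunif S X = Eunif S Y.
Proof. by move=> h; rewrite /Eunif; congr (_ / _); apply: eq_bigr. Qed.

Definition comp_sum (t : nat -> R) (s : state) : R := \sum_(x <- s) t x.1.

Lemma comp_sum_inv t : perm_inv (comp_sum t).
Proof. by move=> s s' ss'; apply: perm_big. Qed.

(** Every vertex has a neighbour, so components have at least two vertices and the truncated
    subtraction in [cstat] loses nothing. *)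
Lemma Ucount_comp_sum n1 n2 (E : graph (n1 + n2)) j : E \in Gclass n1 n2 ->
  (Ucount (j + 2) E)%:R = comp_sum (fun x => (x == j)%:R) (St E [set: 'I_(n1 + n2)]%SET).
Proof.
move=> EG; have ge2 C : C \in comps E [set: 'I_(n1 + n2)]%SET -> (2 <= #|C|)%N.
  case/imsetP => x _ ->; move: EG; rewrite in_set => /and4P[sE /forallP/(_ x) d12 _ _].
  by apply: card_comp_ge2 => //; case/orP: d12 => /eqP ->.
rewrite /comp_sum /St big_map big_enum /= -natr_sum; congr (_%:R).
have bE (b : bool) : nat_of_bool b = (if b then 1 else 0)%N by case: b.
rewrite (eq_bigr _ (fun C _ => bE _)) -big_mkcondr /= sum1_card; apply: eq_card => C.
apply/imsetP/andP => [[x]|[cC /eqP h]].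
  rewrite in_set => /andP[_ /eqP cx] ->; split; first exact: imset_f.
  by rewrite cx addnK.
case/imsetP: (cC) => x _ e; exists x => //.
by rewrite in_set /= -e -h subnK // ge2.
Qed.

End UniformGraph.

End FiniteGraphs.

(** * The chain of component sizes *)

(** What the chain keeps of graph theory: a connected component has at least as many edges as
    vertices minus one, the degree sum is 2m + 2n, and the number of vertices is 2m + n. *)
Definition reachable (m n : nat) (s : state) : bool :=
  [&& all (fun x => (x.1.+1).*2 <= x.2)%N s, (\sum_(x <- s) x.2 == (m + n).*2)%N
    & (\sum_(x <- s) x.1.+2 == m.*2 + n)%N].

Lemma reachable0 m : reachable m 0 (nseq m (0, 2)%N).
Proof.
rewrite /reachable !big_nseq !iter_addn_0 all_nseq /= orbT /=.
by rewrite -!muln2; apply/andP; split; apply/eqP; lia.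
Qed.

Lemma reachable_grow m n s x : reachable m n s -> x \in s ->
  reachable m n.+1 (grow x :: rem x s).
Proof.
case/and3P=> /allP h1 /eqP h2 /eqP h3 xs; apply/and3P; split.
- by apply/allP => y; rewrite inE => /predU1P[->|/mem_rem/h1//]; have := h1 _ xs; rewrite /grow /=; lia.
- by move: h2; rewrite big_cons (big_rem _ xs) /= => h4; apply/eqP; lia.
- by move: h3; rewrite big_cons (big_rem _ xs) /= => h4; apply/eqP; lia.
Qed.

Lemma reachable_newtri m n s : reachable m n s -> reachable m n.+3 ((1, 6)%N :: s).
Proof.
case/and3P=> h1 /eqP h2 /eqP h3; apply/and3P; split; rewrite ?big_cons //=.
- by rewrite h2; apply/eqP; lia.
- by rewrite h3; apply/eqP; lia.
Qed.

Section Chain.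
Variable R : realType.
Implicit Types F G : state -> R.

Lemma le_growth m n F G s : reachable m n s ->
  (forall s', reachable m n.+1 s' -> F s' <= G s') -> growth F s <= growth G s.
Proof.
move=> rs h; rewrite /growth big_seq [leRHS]big_seq; apply: ler_sum => x xs.
by rewrite ler_wpM2l //; apply: h; apply: reachable_grow.
Qed.

Lemma le_hist m n F G : (forall s, reachable m n s -> F s <= G s) -> hist m n F <= hist m n G.
Proof.
elim/ltn_ind: n F G => -[|n] ih F G h; first by apply: h; apply: reachable0.
rewrite [hist m n.+1 F]/= [hist m n.+1 G]/=; apply: lerD.
  by apply: ih => // s rs; apply: le_growth rs h.
case: n ih h => [|[|n]] ih h //; rewrite ler_wpM2l //; apply: ih => [|s rs].
  by lia.
by apply: h; apply: reachable_newtri.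
Qed.

Lemma eq_hist m n F G : (forall s, reachable m n s -> F s = G s) -> hist m n F = hist m n G.
Proof. by move=> h; apply/le_anti/andP; split; apply: le_hist => s /h ->. Qed.

Lemma hist_lin m n a F G : hist m n (fun s => a * F s + G s) = a * hist m n F + hist m n G.
Proof.
elim/ltn_ind: n F G => -[|n] ih F G //.
rewrite [LHS]/= [hist m n.+1 F]/= [hist m n.+1 G]/= mulrDr addrACA -ih //; congr (_ + _).
  apply: eq_hist => s _; rewrite /growth mulr_sumr -big_split /=.
  by apply: eq_bigr => x _; rewrite mulrDr mulrCA.
case: n ih => [|[|n]] ih; rewrite ?mulr0 ?addr0 //.
by rewrite [a * _]mulrCA -mulrDr -ih //; lia.
Qed.

Lemma hist_0 m n : hist m n (fun=> 0) = 0 :> R.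
Proof.
rewrite (eq_hist (G := fun=> (- 1) * 0 + 0)); first by rewrite hist_lin mulN1r addNr.
by move=> s _; rewrite mulr0 addr0.
Qed.

Variable m : nat.
Hypothesis m_gt0 : (0 < m)%N.

Definition hmass n : R := hist m n (fun=> 1).
Definition Ex n F : R := hist m n F / hmass n.
Definition avg n F (s : state) : R := growth F s / (m + n).*2%:R.
(** The share of the triangle term in [hmass n.+1]. For [n < 2] the truncated [n - 2] is harmless,
    as the factor [n * n.-1] is 0. *)
Definition eps n : R := (4 * (n * n.-1))%:R * hmass (n - 2) / hmass n.+1.

Lemma growth1 n s : reachable m n s -> growth (fun=> 1 : R) s = (m + n).*2%:R.
Proof.
case/and3P=> _ /eqP <- _; rewrite /growth natr_sum.
by apply: eq_bigr => x _; rewrite mulr1.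
Qed.

Lemma hmassS n : hmass n.+1 = (m + n).*2%:R * hmass n + (4 * (n * n.-1))%:R * hmass (n - 2).
Proof.
rewrite {1}/hmass [LHS]/=; congr (_ + _).
  rewrite (eq_hist (G := fun s => (m + n).*2%:R * 1 + 0)); last first.
    by move=> s rs; rewrite (growth1 rs) mulr1 addr0.
  by rewrite hist_lin hist_0 addr0.
case: n => [|[|n]]; [by rewrite mul0n muln0 mul0r | by rewrite muln0 mul0r |].
by rewrite !subSS subn0.
Qed.

Lemma hmass_gt0 n : 0 < hmass n.
Proof.
elim/ltn_ind: n => -[|n] ih; first exact: ltr01.
rewrite hmassS ltr_pwDl //; first by rewrite mulr_gt0 ?ih // ltr0n double_gt0 addn_gt0 m_gt0.
by rewrite mulr_ge0 // ltW // ih //; lia.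
Qed.

Lemma Ex_le n F G : (forall s, reachable m n s -> F s <= G s) -> Ex n F <= Ex n G.
Proof. by move=> h; rewrite ler_pM2r ?invr_gt0 ?hmass_gt0 //; apply: le_hist. Qed.

Lemma Ex_eq n F G : (forall s, reachable m n s -> F s = G s) -> Ex n F = Ex n G.
Proof. by move=> h; rewrite /Ex (eq_hist h). Qed.

Lemma Ex_lin n a F G : Ex n (fun s => a * F s + G s) = a * Ex n F + Ex n G.
Proof. by rewrite /Ex hist_lin mulrDl mulrA. Qed.

Lemma Ex_cst n c : Ex n (fun=> c) = c.
Proof.
have e1 : Ex n (fun=> 1) = 1 by rewrite /Ex divff // gt_eqF // hmass_gt0.
have e0 : Ex n (fun=> 0) = 0.
  by rewrite (Ex_eq (G := fun=> (- 1) * 1 + 1)) ?Ex_lin ?e1 ?mulN1r ?addNr // => s _; rewrite mulN1r addNr.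
by rewrite (Ex_eq (G := fun=> c * 1 + 0)) ?Ex_lin ?e1 ?e0 ?mulr1 ?addr0 // => s _; rewrite mulr1 addr0.
Qed.

Lemma ExZ n a F : Ex n (fun s => a * F s) = a * Ex n F.
Proof.
by rewrite (Ex_eq (G := fun s => a * F s + 0)) ?Ex_lin ?Ex_cst ?addr0 // => s _; rewrite addr0.
Qed.

Lemma ExD n F G : Ex n (fun s => F s + G s) = Ex n F + Ex n G.
Proof.
by rewrite (Ex_eq (G := fun s => 1 * F s + G s)) ?Ex_lin ?mul1r // => s _; rewrite mul1r.
Qed.

Lemma ExB n F G : Ex n (fun s => F s - G s) = Ex n F - Ex n G.
Proof.
rewrite (Ex_eq (G := fun s => (- 1) * G s + F s)) ?Ex_lin ?mulN1r 1?addrC // => s _.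
by rewrite mulN1r addrC.
Qed.

Lemma Ex_norm n F : `|Ex n F| <= Ex n (fun s => `|F s|).
Proof.
rewrite ler_norml -mulN1r -ExZ; apply/andP; split; apply: Ex_le => s _; last exact: ler_norm.
by rewrite mulN1r lerNl -normrN ler_norm.
Qed.

Lemma Ex_dist n F G : `|Ex n F - Ex n G| <= Ex n (fun s => `|F s - G s|).
Proof. by rewrite -ExB; apply: Ex_norm. Qed.

Lemma Ex_dist_le n F G c : (forall s, reachable m n s -> `|F s - G s| <= c) -> `|Ex n F - Ex n G| <= c.
Proof. by move=> h; apply: le_trans (Ex_dist _ _ _) _; rewrite -(Ex_cst n c); apply: Ex_le. Qed.

(** The recursion of [hist] read as a mixture. The triangle branch starts from time [n - 2], since a
    triangle uses three vertices of degree 2. *)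
Lemma ExS n F : Ex n.+1 F = (1 - eps n) * Ex n (avg n F) + eps n * Ex (n - 2) (newtri F).
Proof.
have c0 : (m + n).*2%:R != 0 :> R by rewrite pnatr_eq0 -lt0n double_gt0 addn_gt0 m_gt0.
have z1 := gt_eqF (hmass_gt0 n.+1); have z0 := gt_eqF (hmass_gt0 n).
have z2 := gt_eqF (hmass_gt0 (n - 2)).
have -> : Ex n.+1 F = (hist m n (growth F) + (4 * (n * n.-1))%:R * hist m (n - 2) (newtri F)) / hmass n.+1.
  rewrite /Ex [hist m n.+1 F]/=; congr ((_ + _) / _).
  case: n {c0 z0 z1 z2} => [|[|n]]; [by rewrite mul0n muln0 mul0r | by rewrite muln0 mul0r |].
  by rewrite !subSS subn0.
have -> : Ex n (avg n F) = hist m n (growth F) / (m + n).*2%:R / hmass n.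
  rewrite /Ex; congr (_ / _).
  rewrite (eq_hist (G := fun s => (m + n).*2%:R^-1 * growth F s + 0)); last first.
    by move=> s _; rewrite addr0 mulrC.
  by rewrite hist_lin hist_0 addr0 mulrC.
have -> : 1 - eps n = (m + n).*2%:R * hmass n / hmass n.+1.
  rewrite /eps; apply: (mulIf (negbT z1)); rewrite mulrBl !mulfVK ?z1 // mul1r {1}hmassS; ring.
rewrite /eps /Ex; field.
by rewrite c0 z0 z1 z2.
Qed.

Lemma eps_ge0 n : 0 <= eps n.
Proof. by rewrite /eps divr_ge0 ?mulr_ge0 // ltW // hmass_gt0. Qed.

(** Three subdivisions from time n - 2 already contribute 8 (m+n)(m+n-1)(m+n-2) [hmass (n - 2)] to
    [hmass n.+1], against 4n(n-1) [hmass (n - 2)] for the triangle. *)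
Lemma eps_le n : eps n <= m%:R^-1.
Proof.
have mp : 0 < m%:R :> R by rewrite ltr0n.
rewrite /eps ler_pdivrMr ?hmass_gt0 // [leRHS]mulrC ler_pdivlMr //.
case: n => [|[|n]]; [by rewrite mul0n muln0 !mul0r ltW ?hmass_gt0 | by rewrite muln0 !mul0r ltW ?hmass_gt0 |].
rewrite !subSS subn0.
have zS k : (m + k).*2%:R * hmass k <= hmass k.+1.
  by rewrite hmassS lerDl mulr_ge0 // ltW // hmass_gt0.
apply: le_trans (zS _).
apply: (@le_trans _ _ ((m + n.+2).*2%:R * ((m + n.+1).*2%:R * ((m + n).*2%:R * hmass n)))); last first.
  rewrite ler_wpM2l //; apply: le_trans (zS _); rewrite ler_wpM2l //.
rewrite mulrAC !mulrA -!natrM; apply: ler_wpM2r; first by rewrite ltW ?hmass_gt0.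
rewrite ler_nat -!muln2 /=.
have h : (n.+2 * n.+1 <= (m + n.+1) * (m + n.+2))%N by apply: leq_mul; lia.
have h2 : (m <= (m + n))%N by lia.
have := leq_mul h h2; lia.
Qed.

Lemma eps_le1 n : eps n <= 1.
Proof.
by apply: le_trans (eps_le n) _; rewrite invf_le1 ?ler1n // ltr0n.
Qed.

Lemma eps_small n : (n < 2)%N -> eps n = 0.
Proof. by case: n => [|[|]] // _; rewrite /eps ?muln0 !mul0r. Qed.

(* A graph with 2 m leaves has m path components, so [cyc] counts the cycles. *)
Definition cyc (s : state) : R := (size s)%:R - m%:R.

Lemma avgE n F s : avg n F s = \sum_(x <- s) (x.2%:R / (m + n).*2%:R) * F (grow x :: rem x s).
Proof. by rewrite /avg /growth mulr_suml; apply: eq_bigr => x _; rewrite mulrAC. Qed.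

Lemma sum_weights n s : reachable m n s -> \sum_(x <- s) (x.2%:R / (m + n).*2%:R) = 1 :> R.
Proof.
case/and3P=> _ /eqP e _; rewrite -mulr_suml -natr_sum e divff //.
by rewrite pnatr_eq0 -lt0n double_gt0 addn_gt0 m_gt0.
Qed.

Lemma avg_cyc n s : reachable m n s -> avg n cyc s = cyc s.
Proof.
move=> rs; rewrite avgE big_seq (eq_bigr (fun x => x.2%:R / (m + n).*2%:R * cyc s)); last first.
  by move=> x xs; rewrite /cyc /= size_rem // prednK //; case: s xs {rs}.
by rewrite -big_seq -mulr_suml sum_weights // mul1r.
Qed.

(** A path on k vertices has 2k - 2 ordered edges and a cycle has 2k, so each cycle has excess 2.
    The identity itself needs only the total numbers of edges and vertices. *)
Lemma cyc_sum n s : reachable m n s ->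
  cyc s *+ 2 = \sum_(x <- s) (x.2%:R - (x.1.+1).*2%:R) :> R.
Proof.
case/and3P=> _ /eqP e2 /eqP e3; rewrite sumrB -!natr_sum e2.
have e1 : (\sum_(x <- s) (x.1.+1).*2 + (size s).*2 = (m.*2 + n).*2)%N.
  rewrite -e3 -!muln2 big_distrl /= -sum1_size big_distrl /= -big_split /=.
  by apply: eq_bigr => x _; lia.
have := congr1 (fun k => k%:R : R) e1.
rewrite natrD /cyc => e4; have -> : (\sum_(x <- s) (x.1.+1).*2)%:R = (m.*2 + n).*2%:R - (size s).*2%:R :> R by rewrite -e4 addrK.
rewrite -!muln2 !natrM !natrD !natrM; ring.
Qed.

Lemma cyc_ge0 n s : reachable m n s -> 0 <= cyc s.
Proof.
move=> rs; have h : 0 <= cyc s *+ 2.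
  rewrite (cyc_sum rs) big_seq; apply: sumr_ge0 => x xs; rewrite subr_ge0 ler_nat.
  by case/and3P: rs => /allP/(_ x xs).
by rewrite pmulrn_lge0 in h.
Qed.

Lemma size_le n s : reachable m n s -> (size s <= m.*2 + n)%N.
Proof.
by case/and3P=> _ _ /eqP <-; rewrite -sum1_size; apply: leq_sum.
Qed.

(** Subdivision preserves the number of cycles, and a triangle, of probability at most 1/m, adds
    one. For n = O(m) the expected number of cycles is thus bounded. *)
Lemma Ex_cyc n : Ex n cyc <= n%:R / m%:R.
Proof.
elim/ltn_ind: n => -[|n] ih.
  by rewrite /Ex /= /cyc size_nseq subrr !mul0r.
rewrite ExS (Ex_eq (G := cyc)); last by move=> s; apply: avg_cyc.
rewrite (Ex_eq (n := n - 2) (G := fun s => 1 + cyc s)); last first.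
  by move=> s _; rewrite /newtri /cyc /=; rewrite -natr1; ring.
rewrite (ExD _ (fun=> 1) cyc) (Ex_cst _ 1).
have mp : 0 < m%:R^-1 :> R by rewrite invr_gt0 ltr0n.
have i0 : Ex n cyc <= n%:R / m%:R by apply: ih.
have i2 : Ex (n - 2) cyc <= n%:R / m%:R.
  by apply: le_trans (ih _ _) _; [lia | rewrite ler_pM2r // ler_nat; lia].
have e0 := eps_ge0 n; have e1 := eps_le n; have e2 := eps_le1 n.
rewrite -[n.+1%:R]natr1 [leRHS]mulrDl mul1r.
have : (1 - eps n) * Ex n cyc + eps n * Ex (n - 2) cyc <= n%:R / m%:R.
  have -> : n%:R / m%:R = (1 - eps n) * (n%:R / m%:R) + eps n * (n%:R / m%:R) :> R by ring.
  by apply: lerD; rewrite ler_wpM2l // subr_ge0.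
by move=> h; rewrite [eps n * (1 + _)]mulrDr mulr1 addrCA [leRHS]addrC; apply: lerD.
Qed.

(* Up to the excess edges carried by cycles, a component with [x + 2] vertices has [x + 1] edges. *)
Lemma weights_paths n s (g : nat -> R) (M : R) : reachable m n s ->
  (forall k : nat, `|g k| <= M) ->
  `|\sum_(x <- s) (x.2%:R / (m + n).*2%:R) * g x.1 -
    comp_sum (fun k : nat => k.+1%:R * g k) s / (m + n)%:R| <= M * cyc s / m%:R.
Proof.
move=> rs gM; have M0 : 0 <= M by apply: le_trans (gM 0%N).
have c0 : (m + n)%:R != 0 :> R by rewrite pnatr_eq0 -lt0n addn_gt0 m_gt0.
have -> : \sum_(x <- s) (x.2%:R / (m + n).*2%:R) * g x.1 -
    comp_sum (fun k : nat => k.+1%:R * g k) s / (m + n)%:R =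
    \sum_(x <- s) (x.2%:R - (x.1.+1).*2%:R) * g x.1 / (m + n).*2%:R.
  rewrite /comp_sum mulr_suml -sumrB; apply: eq_bigr => x _.
  by rewrite -!muln2 !natrM; move: (m + n)%:R c0 => c c0; field.
apply: le_trans (ler_norm_sum _ _ _) _.
apply: (@le_trans _ _ (\sum_(x <- s) M * (x.2%:R - (x.1.+1).*2%:R) / (m + n).*2%:R)).
  rewrite big_seq [leRHS]big_seq; apply: ler_sum => x xs.
  have h : 0 <= x.2%:R - (x.1.+1).*2%:R :> R.
    by rewrite subr_ge0 ler_nat; case/and3P: rs => /allP/(_ x xs).
  rewrite normrM [X in _ * X <= _]ger0_norm ?invr_ge0 // normrM (ger0_norm h).
  by apply: ler_wpM2r; rewrite ?invr_ge0 // mulrC; apply: ler_wpM2r.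
rewrite -mulr_suml -mulr_sumr -(cyc_sum rs) -(mulr_natr (cyc s)).
have -> : M * (cyc s * 2) / (m + n).*2%:R = M * cyc s / (m + n)%:R.
  by rewrite -muln2 natrM; move: (m + n)%:R c0 => c c0; field.
rewrite ler_wpM2l ?mulr_ge0 ?(cyc_ge0 rs) // lef_pV2 ?posrE ?ltr0n ?addn_gt0 ?m_gt0 //.
by rewrite ler_nat leq_addr.
Qed.

Lemma comp_sum_grow (t : nat -> R) s x : x \in s ->
  comp_sum t (grow x :: rem x s) = comp_sum t s + (t x.1.+1 - t x.1).
Proof. by move=> xs; rewrite /comp_sum big_cons [in RHS](big_rem _ xs) /=; ring. Qed.

Lemma comp_sum_newtri (t : nat -> R) s : comp_sum t ((1, 6)%N :: s) = comp_sum t s + t 1%N.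
Proof. by rewrite /comp_sum big_cons addrC. Qed.

Lemma comp_sum_bound (t : nat -> R) (M : R) n s : reachable m n s ->
  (forall k : nat, `|t k| <= M) ->
  `|comp_sum t s| <= M * (m.*2 + n)%:R.
Proof.
move=> rs tM; have M0 : 0 <= M by apply: le_trans (tM 0%N).
apply: le_trans (ler_norm_sum _ _ _) _; apply: (@le_trans _ _ (\sum_(x <- s) M)).
  by apply: ler_sum.
by rewrite big_const_seq iter_addr_0 count_predT -(mulr_natr M) ler_wpM2l // ler_nat (size_le rs).
Qed.

End Chain.

(** * The limit profile and its variance *)

Lemma normM_le (R : realDomainType) (a b A B : R) : `|a| <= A -> `|b| <= B -> `|a * b| <= A * B.
Proof. by move=> aA bB; rewrite normrM ler_pM. Qed.

Lemma normD_le (R : realDomainType) (a b A B : R) : `|a| <= A -> `|b| <= B -> `|a + b| <= A + B.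
Proof. by move=> aA bB; apply: le_trans (ler_normD _ _) (lerD aA bB). Qed.

Lemma normB_le (R : realDomainType) (a b A B : R) : `|a| <= A -> `|b| <= B -> `|a - b| <= A + B.
Proof. by move=> aA bB; apply: le_trans (ler_normB _ _) (lerD aA bB). Qed.

(** * First-order expansions uniform in a parameter *)

Section UniformTaylor.
Variables (R : realType) (K : R).

(* [f'] is the derivative of [f] on [0, K], with a quadratic remainder uniform in the parameter. *)
Definition C11 (I : Type) (P : I -> Prop) (f f' : I -> R -> R) : Prop :=
  exists2 C : R, 0 <= C & forall i, P i -> forall s, 0 <= s <= K ->
    [/\ `|f i s| <= C, `|f' i s| <= C &
        forall h, 0 <= h <= 1 -> s + h <= K -> `|f i (s + h) - f i s - h * f' i s| <= C * h ^+ 2].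

Lemma C11_ext (I : Type) (P : I -> Prop) (f f' g g' : I -> R -> R) : C11 P f f' ->
  (forall i s, P i -> 0 <= s -> g i s = f i s) -> (forall i s, P i -> 0 <= s -> g' i s = f' i s) ->
  C11 P g g'.
Proof.
case=> C C0 h e e'; exists C => // i Pi s sK; have s0 : 0 <= s by case/andP: sK.
have [h1 h2 h3] := h i Pi s sK; rewrite e // e' //; split=> // k k01 skK.
by rewrite e ?h3 // addr_ge0 //; case/andP: k01.
Qed.

Lemma C11_comp (I J : Type) (P : I -> Prop) (P' : J -> Prop) (phi : J -> I) (f f' : I -> R -> R) :
  C11 P f f' -> (forall j, P' j -> P (phi j)) ->
  C11 P' (fun j => f (phi j)) (fun j => f' (phi j)).
Proof. by case=> C C0 h e; exists C => // j /e Pj; apply: h. Qed.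

Section Fixed.
Variables (I : Type) (P : I -> Prop).

Lemma C11D f f' g g' : C11 P f f' -> C11 P g g' ->
  C11 P (fun i s => f i s + g i s) (fun i s => f' i s + g' i s).
Proof.
case=> C C0 hf [D D0 hg]; exists (C + D); first exact: addr_ge0.
move=> i Pi s sK; have [f1 f2 f3] := hf i Pi s sK; have [g1 g2 g3] := hg i Pi s sK.
split; [exact: normD_le|exact: normD_le|] => h h01 shK.
rewrite mulrDl; have -> : f i (s + h) + g i (s + h) - (f i s + g i s) - h * (f' i s + g' i s) =
  (f i (s + h) - f i s - h * f' i s) + (g i (s + h) - g i s - h * g' i s) by ring.
by apply: normD_le; [apply: f3|apply: g3].
Qed.

Lemma C11M f f' g g' : C11 P f f' -> C11 P g g' ->
  C11 P (fun i s => f i s * g i s) (fun i s => f' i s * g i s + f i s * g' i s).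
Proof.
case=> C C0 hf [D D0 hg]; exists (6 * (C * D)); first by rewrite !mulr_ge0.
have CD : 0 <= C * D by apply: mulr_ge0.
move=> i Pi s sK; have [f1 f2 f3] := hf i Pi s sK; have [g1 g2 g3] := hg i Pi s sK.
split.
- by apply: le_trans (normM_le f1 g1) _; lra.
- by apply: le_trans (normD_le (normM_le f2 g1) (normM_le f1 g2)) _; lra.
move=> h h01 shK; have [h0 h1] := andP h01.
have := f3 h h01 shK; have := g3 h h01 shK.
set r := f i (s + h) - _ - _; set q := g i (s + h) - _ - _ => hq hr.
have -> : f i (s + h) * g i (s + h) - f i s * g i s - h * (f' i s * g i s + f i s * g' i s) =
  h ^+ 2 * (f' i s * g' i s) + r * (g i s + h * g' i s) + q * (f i s + h * f' i s) + r * q.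
  by rewrite /r /q; ring.
have nh : `|h| <= 1 by rewrite ger0_norm.
have nh2 : `|h ^+ 2| <= h ^+ 2 by rewrite ger0_norm // sqr_ge0.
have h21 : h ^+ 2 <= 1 by rewrite expr_le1.
have q2 : `|q| <= D by apply: le_trans hq _; rewrite ler_piMr.
have b1 := normM_le nh2 (normM_le f2 g2).
have b2 := normM_le hr (normD_le g1 (normM_le nh g2)).
have b3 := normM_le hq (normD_le f1 (normM_le nh f2)).
have b4 := normM_le hr q2.
apply: le_trans (normD_le (normD_le (normD_le b1 b2) b3) b4) _.
rewrite le_eqVlt; apply/orP; left; apply/eqP; ring.
Qed.

Lemma C11_cst (c : I -> R) (M : R) : (forall i, P i -> `|c i| <= M) ->
  C11 P (fun i _ => c i) (fun _ _ => 0).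
Proof.
move=> cM; exists `|M| => // i Pi s _; rewrite normr0; split=> //.
  by apply: le_trans (cM i Pi) (ler_norm _).
by move=> h _ _; rewrite subrr mulr0 subr0 normr0 mulr_ge0 // sqr_ge0.
Qed.

Lemma C11_id : C11 P (fun _ s => s) (fun _ _ => 1).
Proof.
exists (`|K| + 1); first by rewrite addr_ge0.
move=> i _ s /andP[s0 sK]; rewrite ger0_norm // normr1; split.
- by apply: le_trans sK _; apply: le_trans (ler_norm _) _; rewrite lerDl.
- by rewrite lerDr.
move=> h _ _; rewrite mulr1 (_ : s + h - s - h = 0); last by ring.
by rewrite normr0 mulr_ge0 ?sqr_ge0 // addr_ge0.
Qed.

Lemma C11_inv : C11 P (fun _ s => (1 + s)^-1) (fun _ s => - ((1 + s)^-1 * (1 + s)^-1)).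
Proof.
have inv1 (s : R) : 0 <= s -> 0 <= (1 + s)^-1 <= 1.
  by move=> s0; rewrite invr_ge0 invf_le1 ?lerDl ?s0 ?ltr_pwDl // addr_ge0.
exists 1 => // i _ s /andP[s0 sK]; have/andP[i0 i1] := inv1 _ s0; split.
- by rewrite ger0_norm.
- by rewrite normrN ger0_norm ?mulr_ge0 // mulr_ile1.
move=> h /andP[h0 h1] _; have/andP[j0 j1] := inv1 _ (addr_ge0 s0 h0).
have -> : (1 + (s + h))^-1 - (1 + s)^-1 - h * - ((1 + s)^-1 * (1 + s)^-1) =
   ((1 + s)^-1 * (1 + s)^-1 * (1 + (s + h))^-1) * h ^+ 2.
  by field; rewrite !gt_eqF // ?ltr_pwDl ?addr_ge0.
rewrite ger0_norm ?mulr_ge0 ?sqr_ge0 // ler_wpM2r ?sqr_ge0 //.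
by rewrite !mulr_ile1 ?mulr_ge0.
Qed.

Lemma C11X f f' n : C11 P f f' ->
  C11 P (fun i s => f i s ^+ n) (fun i s => n%:R * f i s ^+ n.-1 * f' i s).
Proof.
move=> hf; elim: n => [|n ih].
  apply: (C11_ext (C11_cst (c := fun=> 1) (M := 1) _)) => [i _|i s _ _|i s _ _].
  - by rewrite normr1.
  - by rewrite expr0.
  - by rewrite !mul0r.
apply: (C11_ext (C11M hf ih)) => i s _ _; first by rewrite exprS.
case: n {ih} => [|n]; first by rewrite /= !expr0; ring.
by rewrite /= -[n.+2%:R]natr1 exprS; ring.
Qed.

Lemma C11_sum (J : eqType) (r : seq J) (f f' : J -> I -> R -> R) :
  (forall j, C11 P (f j) (f' j)) ->
  C11 P (fun i s => \sum_(j <- r) f j i s) (fun i s => \sum_(j <- r) f' j i s).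
Proof.
move=> h; elim: r => [|j r ih].
  apply: (C11_ext (C11_cst (c := fun=> 0) (M := 0) _)) => [i _|i s _ _|i s _ _].
  - by rewrite normr0.
  - by rewrite big_nil.
  - by rewrite big_nil.
by apply: (C11_ext (C11D (h j) ih)) => i s _ _; rewrite big_cons.
Qed.

Lemma C11_Lip f f' : C11 P f f' -> exists2 C : R, 0 <= C & forall i, P i -> forall s h,
  0 <= s -> 0 <= h <= 1 -> s + h <= K -> `|f i (s + h) - f i s| <= C * h.
Proof.
case=> C C0 hf; exists (2 * C); first by rewrite mulr_ge0.
move=> i Pi s h s0 h01 sK; have [h0 h1] := andP h01.
have sK' : 0 <= s <= K by rewrite s0 (le_trans _ sK) // lerDl.
have [_ f2 f3] := hf i Pi s sK'; have := f3 h h01 sK; set r := _ - _ - _ => hr.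
rewrite (_ : f i (s + h) - f i s = r + h * f' i s); last by rewrite /r; ring.
have nh : `|h| <= h by rewrite ger0_norm.
apply: le_trans (normD_le hr (normM_le nh f2)) _.
have : C * h ^+ 2 <= C * h by rewrite ler_wpM2l // expr2 ler_piMr.
by move=> ?; rewrite (mulrC h); lra.
Qed.

End Fixed.
End UniformTaylor.

(** * The geometric profile and its quadratic form *)

Section Fluid.
Variable R : realType.
Implicit Types (t : nat -> R) (s : R).

(** The geometric law of mean [s] and variance s(1 + s). *)
Definition geo (x : nat) s : R := s ^+ x / (1 + s) ^+ x.+1.
Definition mu (d : nat) t s : R := \sum_(x < d) t x * geo x s.
(* Along the profile [geo], a path with x + 2 vertices grows at rate (x + 1) / (1 + s). *)
Definition drift0 t (x : nat) : R := x.+1%:R * (t x.+1 - t x).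
Definition drift t s (x : nat) : R := drift0 t x / (1 + s).
Definition spread t s (x : nat) : R := x.+1%:R * (t x.+1 - t x) ^+ 2 / (1 + s).
(** The variance of the change of the statistic in one subdivision under the profile: [spread] gives
    the second moment and [drift] the mean. *)
Definition Qv d t s : R := mu d (spread t s) s - mu d (drift t s) s ^+ 2.
(** For X geometric of mean s, the mean drift is Cov(t(X), X) / Var(X). So this is Var(t(X)) -
    Cov(t(X), X)^2 / Var(X), the residual variance of t(X) after linear regression on X. *)
Definition Hv d t s : R :=
  mu d (fun x => t x ^+ 2) s - mu d t s ^+ 2 - s * (1 + s) * mu d (drift t s) s ^+ 2.

Definition supp_ball (d : nat) (rho : R) t : Prop :=
  (forall x : nat, `|t x| <= rho) /\ (forall x, (d <= x)%N -> t x = 0).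

Lemma mu_lin d a b t t' s :
  mu d (fun x => a * t x + b * t' x) s = a * mu d t s + b * mu d t' s.
Proof.
rewrite /mu !mulr_sumr -big_split /=; apply: eq_bigr => x _; ring.
Qed.

Lemma eq_mu d t t' s : (forall x, (x < d)%N -> t x = t' x) -> mu d t s = mu d t' s.
Proof. by move=> h; apply: eq_bigr => x _; rewrite h. Qed.

Lemma mu_drift d t s : mu d (drift t s) s = (1 + s)^-1 * mu d (drift0 t) s.
Proof. by rewrite /mu mulr_sumr; apply: eq_bigr => x _; rewrite /drift; ring. Qed.

Lemma geo_ge0 x s : 0 <= s -> 0 <= geo x s.
Proof. by move=> s0; rewrite divr_ge0 ?exprn_ge0 // addr_ge0. Qed.

Lemma geo_le1 x s : 0 <= s -> geo x s <= 1.
Proof.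
move=> s0; have s1 : 0 < 1 + s by rewrite ltr_pwDl.
rewrite ler_pdivrMr ?exprn_gt0 // mul1r exprS -[leLHS]mul1r.
by apply: ler_pM; rewrite ?exprn_ge0 ?lerDl // lerXn2r ?nnegrE ?lerDr // ltW.
Qed.

Lemma mu_bound d t s (M : R) : 0 <= s -> (forall x : nat, `|t x| <= M) -> `|mu d t s| <= d%:R * M.
Proof.
move=> s0 tM; apply: le_trans (ler_norm_sum _ _ _) _.
apply: (@le_trans _ _ (\sum_(x < d) M)); last by rewrite sumr_const card_ord mulr_natl.
apply: ler_sum => x _; rewrite -[leRHS]mulr1; apply: normM_le => //.
by rewrite ger0_norm ?geo_ge0 ?geo_le1.
Qed.

Lemma drift0_ball d rho t : supp_ball d rho t -> supp_ball d (d%:R * (2 * rho)) (drift0 t).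
Proof.
case=> tr td; split=> x; last by move=> dx; rewrite /drift0 !td ?subrr ?mulr0 //; lia.
have r0 : 0 <= rho by apply: le_trans (tr 0%N).
case: (leqP d x) => dx.
  by rewrite /drift0 !td ?subrr ?mulr0 ?normr0 ?mulr_ge0 //; lia.
apply: normM_le; first by rewrite ger0_norm // ler_nat.
by rewrite mulr2n mulrDl !mul1r; apply: normB_le.
Qed.

Lemma sqr_ball d rho t : supp_ball d rho t -> supp_ball d (rho ^+ 2) (fun x => t x ^+ 2).
Proof.
case=> tr td; split=> x; last by move=> dx; rewrite td // expr0n.
by rewrite !expr2; apply: normM_le.
Qed.

Lemma inv1s_le1 s : 0 <= s -> 0 <= (1 + s)^-1 <= 1.
Proof. by move=> s0; rewrite invr_ge0 invf_le1 ?lerDl ?s0 ?ltr_pwDl // addr_ge0. Qed.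

Lemma scale_ball d rho t (c : R) : `|c| <= 1 -> supp_ball d rho t -> supp_ball d rho (fun x => t x * c).
Proof.
move=> c1 [tr td]; split=> x; last by move=> dx; rewrite td // mul0r.
by rewrite -[rho]mulr1; apply: normM_le.
Qed.

Lemma drift_ball d rho t s : 0 <= s -> supp_ball d rho t -> supp_ball d (d%:R * (2 * rho)) (drift t s).
Proof.
move=> s0 /drift0_ball; apply: scale_ball; have/andP[i0 i1] := inv1s_le1 s0.
by rewrite ger0_norm.
Qed.

Lemma spread_ball d rho t s : 0 <= s -> supp_ball d rho t -> supp_ball d (d%:R * (2 * rho) ^+ 2) (spread t s).
Proof.
move=> s0 [tr td]; have/andP[i0 i1] := inv1s_le1 s0.
have r0 : 0 <= rho by apply: le_trans (tr 0%N).
apply: (@scale_ball _ _ (fun x => x.+1%:R * (t x.+1 - t x) ^+ 2)); first by rewrite ger0_norm.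
split=> x; last by move=> dx; rewrite !td ?subrr ?expr0n ?mulr0 //; lia.
case: (leqP d x) => dx.
  by rewrite !td ?subrr ?expr0n ?mulr0 ?normr0 ?mulr_ge0 ?sqr_ge0 //; lia.
apply: normM_le; first by rewrite ger0_norm // ler_nat.
rewrite !expr2; apply: normM_le; rewrite mulr2n mulrDl !mul1r; exact: normB_le.
Qed.

(* Summation by parts. *)
Lemma mu_drift_geo d t s : 0 <= s -> (forall x, (d <= x)%N -> t x = 0) ->
  mu d (drift t s) s =
  \sum_(x < d) t x * ((x%:R * geo x.-1 s - x.+1%:R * geo x s) * (1 + s)^-1).
Proof.
move=> s0 td; have s1 : 1 + s != 0 by rewrite gt_eqF // ltr_pwDl.
rewrite mu_drift /mu mulr_sumr.
have -> : \sum_(i < d) (1 + s)^-1 * (drift0 t i * geo i s) =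
    (1 + s)^-1 * (\sum_(i < d) (i.+1%:R * t i.+1 * geo i s) - \sum_(i < d) (i.+1%:R * t i * geo i s)).
  by rewrite mulrBr !mulr_sumr -sumrB; apply: eq_bigr => i _; rewrite /drift0; ring.
have -> : \sum_(i < d) (i.+1%:R * t i.+1 * geo i s) = \sum_(i < d) (i%:R * t i * geo i.-1 s).
  have := big_ord_recr d (fun i : 'I_d.+1 => i%:R * t i * geo i.-1 s) (op := +%R) (idx := 0).
  by rewrite /= (td d) // mulr0 mul0r addr0 => <-; rewrite big_ord_recl /= !mul0r add0r.
rewrite -sumrB mulr_sumr; apply: eq_bigr => i _; ring.
Qed.

Variable K : R.

Lemma C11_geo (I : Type) (P : I -> Prop) x : C11 K P (fun _ => geo x)
  (fun _ s => (x%:R * geo x.-1 s - x.+1%:R * geo x s) * (1 + s)^-1).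
Proof.
apply: (C11_ext (C11M (C11X x (C11_id K P)) (C11X x.+1 (C11_inv K P)))) => i s _ s0.
  by rewrite /geo exprVn.
have s1 : 1 + s != 0 by rewrite gt_eqF // ltr_pwDl.
by rewrite /geo !exprVn /= mulr1; case: x => [|x] /=; rewrite !exprS; field; rewrite ?expf_neq0 ?s1.
Qed.

(** The geometric law solves the growth equation geo x' = (x geo (x-1) - (x+1) geo x) / (1 + s);
    summation by parts moves the derivative onto [t]. *)
Lemma C11_mu d rho : C11 K (supp_ball d rho) (mu d) (fun t s => mu d (drift t s) s).
Proof.
have h x : C11 K (supp_ball d rho) (fun t s => t x * geo x s)
    (fun t s => t x * ((x%:R * geo x.-1 s - x.+1%:R * geo x s) * (1 + s)^-1)).
  apply: (C11_ext (C11M (C11_cst K (c := fun t : nat -> R => t x) (M := rho) _) (C11_geo _ x))).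
  - by move=> t [].
  - by [].
  - by move=> t s _ _; rewrite mul0r add0r.
apply: (C11_ext (C11_sum (index_enum 'I_d) (fun x : 'I_d => h x))) => // t s [_ td] s0.
exact: mu_drift_geo.
Qed.

(** A Lyapunov equation: the derivative of the quadratic form is twice its polarisation at [t] and
    [drift t], plus the variance [Qv] injected per unit of time. *)
Lemma C11_Hv d rho : C11 K (supp_ball d rho) (Hv d) (fun t s =>
  2 * (mu d (fun x => t x * drift t s x) s - mu d t s * mu d (drift t s) s
    - s * (1 + s) * mu d (drift t s) s * mu d (drift (drift t s) s) s) + Qv d t s).
Proof.
have hs := C11_comp (C11_mu d (rho ^+ 2)) (@sqr_ball d rho).
have hm := C11_mu d rho.
have hd := C11_comp (C11_mu d (d%:R * (2 * rho))) (@drift0_ball d rho).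
have hb := C11M (C11_inv K (supp_ball d rho)) hd.
have h1 : C11 K (supp_ball d rho) (fun _ _ => 1) (fun _ _ => 0).
  by apply: (@C11_cst _ _ _ _ (fun=> 1) 1) => i _; rewrite normr1.
have hN : C11 K (supp_ball d rho) (fun _ _ => - 1) (fun _ _ => 0).
  by apply: (@C11_cst _ _ _ _ (fun=> - 1) 1) => i _; rewrite normrN1.
have hi := C11_id K (supp_ball d rho).
apply: (C11_ext (C11D (C11D hs (C11M hN (C11X 2 hm)))
   (C11M hN (C11M (C11M hi (C11D h1 hi)) (C11X 2 hb))))) => t s _ s0.
  by rewrite /Hv mu_drift; ring.
have s1 : 1 + s != 0 by rewrite gt_eqF // ltr_pwDl.
(* The identity behind it is that [spread t] is the drift of t^2 minus 2 t times the drift of t. *)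
have -> : Qv d t s = mu d (drift (fun x => t x ^+ 2) s) s - 2 * mu d (fun x => t x * drift t s x) s
     - mu d (drift t s) s ^+ 2.
  rewrite /Qv; congr (_ - _).
  transitivity (1 * mu d (drift (fun x => t x ^+ 2) s) s +
    (- 2) * mu d (fun x => t x * drift t s x) s); last by ring.
  rewrite -mu_lin; apply: eq_mu => x _; rewrite /spread /drift /drift0; field.
  by rewrite s1.
have -> : mu d (drift (drift t s) s) s = (1 + s)^-1 * mu d (drift (drift0 t) s) s.
  rewrite /mu mulr_sumr; apply: eq_bigr => x _; rewrite /drift /drift0; ring.
rewrite !mu_drift /=.
move: (mu d (drift0 (drift0 t)) s) (mu d (drift0 t) s) (mu d t s) => A B C.
move: (mu _ _ _) (mu _ _ _) => D F.
by field.
Qed.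

(** The Lyapunov equation in discrete form: a time step h is traded for the test function t + h
    drift t. The only new term is h^2 times the form at [drift t], bounded by [M]. *)
Lemma Hv_step d rho : exists2 C : R, 0 <= C & forall t, supp_ball d rho t -> forall s h,
  0 <= s -> 0 <= h <= 1 -> s + h <= K ->
  `|Hv d t (s + h) - Hv d (fun x => t x + h * drift t s x) s - h * Qv d t s| <= C * h ^+ 2.
Proof.
have [C C0 hC] := C11_Hv d rho.
set r1 := d%:R * (2 * rho); set r2 := d%:R * (2 * r1).
(* If the ball is empty the claim is void; otherwise [rho] is nonnegative. *)
have [[t0 [tr0 _]]|nb] := pselect (exists t, supp_ball d rho t); last first.
  by exists 0 => // t bt; case: nb; exists t.
have rho0 : 0 <= rho by apply: le_trans (tr0 0%N).
have r10 : 0 <= r1 by rewrite /r1 !mulr_ge0.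
have r20 : 0 <= r2 by rewrite /r2 !mulr_ge0.
pose M := d%:R * r1 ^+ 2 + (d%:R * r1) * (d%:R * r1)
  + (`|K| * (1 + `|K|)) * ((d%:R * r2) * (d%:R * r2)).
have M0 : 0 <= M by rewrite /M !(addr_ge0, mulr_ge0) // ?exprn_ge0.
exists (C + M); first exact: addr_ge0.
move=> t bt s h s0 h01 sK; have [h0 h1] := andP h01.
have sK' : 0 <= s <= K by rewrite s0 (le_trans _ sK) // lerDl.
have [_ _ hh] := hC t bt s sK'; have := hh h h01 sK; move: (Hv d t (s + h)) => Hp.
pose e := mu d (fun x => drift t s x ^+ 2) s - mu d (drift t s) s ^+ 2
  - s * (1 + s) * mu d (drift (drift t s) s) s ^+ 2.
have -> : Hv d (fun x => t x + h * drift t s x) s = Hv d t s + h *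
   (2 * (mu d (fun x => t x * drift t s x) s - mu d t s * mu d (drift t s) s
    - s * (1 + s) * mu d (drift t s) s * mu d (drift (drift t s) s) s)) + h ^+ 2 * e.
  rewrite /Hv /e.
  have -> : mu d (fun x => (t x + h * drift t s x) ^+ 2) s =
     mu d (fun x => t x ^+ 2) s + 2 * h * mu d (fun x => t x * drift t s x) s
      + h ^+ 2 * mu d (fun x => drift t s x ^+ 2) s.
    by rewrite /mu !mulr_sumr -!big_split /=; apply: eq_bigr => x _; ring.
  have -> : mu d (fun x => t x + h * drift t s x) s = mu d t s + h * mu d (drift t s) s.
    by rewrite /mu !mulr_sumr -!big_split /=; apply: eq_bigr => x _; ring.
  have -> : mu d (drift (fun x => t x + h * drift t s x) s) s =
      mu d (drift t s) s + h * mu d (drift (drift t s) s) s.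
    by rewrite /mu !mulr_sumr -!big_split /=; apply: eq_bigr => x _; rewrite /drift /drift0; ring.
  ring.
move=> hb; have b1 := drift_ball s0 bt; have b2 := drift_ball s0 b1.
have he : `|e| <= M.
  have [h1r _] := sqr_ball b1.
  have [h2r _] := b1; have [h3r _] := b2.
  have e2 := mu_bound d s0 h2r; have e3 := mu_bound d s0 h3r.
  rewrite /e /M !expr2; apply: normB_le; first apply: normB_le.
  - by have := mu_bound d s0 h1r; rewrite expr2.
  - exact: normM_le.
  apply: normM_le; last exact: normM_le.
  have hs : `|s| <= `|K| by rewrite !ger0_norm //; [case/andP: sK' | case/andP: sK' => ? ?; lra].
  by apply: normM_le => //; apply: normD_le; rewrite ?normr1.
have nh2 : `|h ^+ 2| <= h ^+ 2 by rewrite ger0_norm // sqr_ge0.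
rewrite [leRHS]mulrDl [M * _]mulrC; apply: le_trans (normB_le hb (normM_le nh2 he)).
by rewrite le_eqVlt; apply/orP; left; apply/eqP; congr `|_|; ring.
Qed.

(** The full second moment minus the part from [N] on. The latter is explicit because a geometric
    variable conditioned to be at least N is N plus a geometric variable. *)
Lemma geometric_tail N (a b s : R) : 0 <= s ->
  \sum_(x < N) geo x s * (a + b * (x%:R - s)) ^+ 2 =
  a ^+ 2 + b ^+ 2 * (s * (1 + s)) -
    (s ^+ N / (1 + s) ^+ N) * ((a + b * N%:R) ^+ 2 + b ^+ 2 * (s * (1 + s))).
Proof.
move=> s0; have s1 : 1 + s != 0 by rewrite gt_eqF // ltr_pwDl.
elim: N => [|N ih]; first by rewrite big_ord0 !expr0 divr1 mul1r mulr0 addr0 subrr.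
rewrite big_ord_recr /= ih /geo -natr1 !exprS.
move: (s ^+ N) ((1 + s) ^+ N) (expf_neq0 N s1) (N%:R) => p q q0 k.
by field; rewrite s1 q0.
Qed.

(** [Hv] is the mean square of the regression residual t(x) - a - b(x - s): a sum of squares below
    [d] plus, as [t] vanishes from [d] on, the geometric tail [T]. *)
Lemma Hv_ge0 d t s : 0 <= s -> (forall x, (d <= x)%N -> t x = 0) -> 0 <= Hv d t s.
Proof.
rewrite le_eqVlt => /orP[/eqP <- td|sp td].
  case: d td => [|d] td; first by rewrite /Hv /mu !big_ord0 !expr0n /= !subr0 mulr0.
  have e f : mu d.+1 f 0 = f 0%N :> R.
    rewrite /mu big_ord_recl big1 ?addr0 => [|x _].
      by rewrite /geo expr0 addr0 expr1n divr1 mulr1.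
    by rewrite /geo lift0 exprS !mul0r mulr0.
  by rewrite /Hv !e mul0r mul0r subr0 subrr.
have s0 := ltW sp; have s1 : 1 + s != 0 by rewrite gt_eqF // ltr_pwDl.
set a := mu d t s; set b := mu d (drift t s) s.
(* The covariance of t(X) and X is the variance s(1 + s) times the mean drift. *)
have hb : \sum_(x < d) geo x s * (t x * (x%:R - s)) = s * (1 + s) * b.
  rewrite /b mu_drift_geo // mulr_sumr; apply: eq_bigr => -[x xd] _ /=.
  rewrite /geo; case: x xd => [|x] xd /=; rewrite ?exprS; field; rewrite ?expf_neq0 ?s1 ?gt_eqF //.
have := geometric_tail d a b s0.
set T := s ^+ d / (1 + s) ^+ d * _ => h2.
have T0 : 0 <= T.
  apply: mulr_ge0; first by apply: divr_ge0; apply: exprn_ge0; rewrite ?addr_ge0.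
  apply: addr_ge0; first exact: sqr_ge0.
  by apply: mulr_ge0; [exact: sqr_ge0 | apply: mulr_ge0; rewrite ?addr_ge0].
have h1 : 0 <= \sum_(x < d) geo x s * (t x - (a + b * (x%:R - s))) ^+ 2.
  by apply: sumr_ge0 => x _; rewrite mulr_ge0 ?sqr_ge0 ?geo_ge0.
have expand (u v : R) : \sum_(x < d) geo x s * (t x - (u + v * (x%:R - s))) ^+ 2 =
   mu d (fun x => t x ^+ 2) s - 2 * u * mu d t s
   - 2 * v * (\sum_(x < d) geo x s * (t x * (x%:R - s)))
   + \sum_(x < d) geo x s * (u + v * (x%:R - s)) ^+ 2.
  rewrite /mu !mulr_sumr -!sumrB -big_split /=; apply: eq_bigr => x _.
  ring.
rewrite expand h2 hb -/a in h1; rewrite /Hv -/a -/b.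
move: T {h2} T0 h1 => T T0 h1; apply: le_trans (addr_ge0 h1 T0) _.
by rewrite le_eqVlt; apply/orP; left; apply/eqP; ring.
Qed.

End Fluid.

(** * Taylor estimates for cosine, sine and exponential *)

Section Taylor.
Variable R : realType.
Implicit Types x y z : R.

Lemma mvt_bound (f df : R -> R) (a x M : R) :
  (forall y, is_derive y 1 f (df y)) -> (forall y, `|y - a| <= `|x - a| -> `|df y| <= M) ->
  `|f x - f a| <= M * `|x - a|.
Proof.
move=> fd dM; have fc y : {for y, continuous f}.
  by apply: differentiable_continuous; apply/derivable1_diffP; have [] := fd y.
have key u v : u <= v -> (forall y, u <= y <= v -> `|df y| <= M) -> `|f v - f u| <= M * (v - u).
  move=> uv h; have [|c + ->] := MVT_segment uv (fun y _ => fd y).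
    by apply: continuous_subspaceT => y; apply: fc.
  rewrite in_itv /= => cuv; rewrite normrM [X in _ * X]ger0_norm ?subr_ge0 //.
  by rewrite ler_wpM2r ?subr_ge0 // h.
have [ax|xa] := leP a x.
  rewrite [X in _ <= _ * X]ger0_norm ?subr_ge0 //; apply: key => // y /andP[ay yx].
  by apply: dM; rewrite !ger0_norm ?subr_ge0 // lerB.
rewrite distrC [X in _ <= _ * X]distrC [X in _ <= _ * X]ger0_norm ?subr_ge0 ?(ltW xa) //.
apply: key => [|y /andP[xy ya]]; first exact: ltW.
by apply: dM; rewrite distrC [X in _ <= X]distrC !ger0_norm ?subr_ge0 ?(ltW xa) // lerB.
Qed.

Lemma cos_lip x y : `|cos x - cos y| <= `|x - y|.
Proof.
rewrite -[leRHS]mul1r; apply: (@mvt_bound cos (fun x => - sin x)) => z _.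
by rewrite normrN sin_max.
Qed.

Lemma sin_le_norm x : `|sin x| <= `|x|.
Proof.
have := @mvt_bound sin cos 0 x 1 _ _; rewrite sin0 !subr0 mul1r; apply => z _.
exact: cos_max.
Qed.

Lemma cos_sub1 x : `|cos x - 1| <= `|x| ^+ 2.
Proof.
have := @mvt_bound cos (fun x => - sin x) 0 x `|x| _ _; rewrite cos0 !subr0 expr2; apply => z.
by rewrite !subr0 normrN => zx; apply: le_trans (sin_le_norm z) zx.
Qed.

Lemma sin_sub_id x : `|sin x - x| <= `|x| ^+ 3.
Proof.
have d y : is_derive y 1 (fun z => sin z - z) (cos y - 1) by apply: is_deriveB.
have := @mvt_bound (fun z => sin z - z) _ 0 x (`|x| ^+ 2) d _; rewrite sin0 !subr0 -exprSr; apply => z.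
by rewrite !subr0 => zx; apply: le_trans (cos_sub1 z) _; rewrite lerXn2r ?nnegrE.
Qed.

Lemma cos_taylor2 x : `|cos x - 1 + x ^+ 2 / 2| <= `|x| ^+ 3.
Proof.
have d y : is_derive y 1 (fun z => cos z - 1 + z ^+ 2 / 2) (- (sin y - y)).
  by apply: is_derive_eq; rewrite /GRing.scale /= ; field.
have := @mvt_bound (fun z => cos z - 1 + z ^+ 2 / 2) _ 0 x (`|x| ^+ 2) d _.
rewrite cos0 subrr expr0n /= mul0r addr0 !subr0 -exprSr; apply => z.
rewrite !subr0 normrN => zx.
have d1 y : is_derive y 1 (fun z => sin z - z) (cos y - 1) by apply: is_deriveB.
have := @mvt_bound (fun z => sin z - z) _ 0 z `|z| d1 _; rewrite sin0 !subr0 => h.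
apply: le_trans (h _) _ => [w|]; last by rewrite expr2 ler_pM.
rewrite !subr0 => wz; apply: le_trans wz.
by have := cos_lip w 0; rewrite cos0 subr0.
Qed.

Lemma cos_taylor (a d : R) :
  `|cos (a + d) - (cos a - d * sin a - d ^+ 2 / 2 * cos a)| <= 2 * `|d| ^+ 3.
Proof.
rewrite cosD; have -> : cos a * cos d - sin a * sin d - (cos a - d * sin a - d ^+ 2 / 2 * cos a) =
  cos a * (cos d - 1 + d ^+ 2 / 2) - sin a * (sin d - d) by ring.
have h1 := normM_le (cos_max a) (cos_taylor2 d).
have h2 := normM_le (sin_max a) (sin_sub_id d).
by apply: le_trans (normB_le h1 h2) _; rewrite !mul1r; lra.
Qed.

Lemma cos_taylor1 (a d : R) : `|cos (a + d) - (cos a - d * sin a)| <= 2 * `|d| ^+ 2.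
Proof.
rewrite cosD; have -> : cos a * cos d - sin a * sin d - (cos a - d * sin a) =
  cos a * (cos d - 1) - sin a * (sin d - d) by ring.
have h1 := normM_le (cos_max a) (cos_sub1 d).
have h3 : `|sin d - d| <= `|d| ^+ 2.
  have d1 y : is_derive y 1 (fun z => sin z - z : R) (cos y - 1) by apply: is_deriveB.
  have := @mvt_bound (fun z => sin z - z) _ 0 d `|d| d1 _; rewrite sin0 !subr0 expr2; apply => w.
  rewrite !subr0 => wz; apply: le_trans wz.
  by have := cos_lip w 0; rewrite cos0 subr0.
have h2 := normM_le (sin_max a) h3.
by apply: le_trans (normB_le h1 h2) _; rewrite !mul1r; lra.
Qed.

Lemma expR_taylor1 z : `|z| <= 1 / 2 -> `|expR (- z) - (1 - z)| <= 2 * z ^+ 2.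
Proof.
rewrite ler_norml => /andP[z1 z2]; have p : 0 < 1 + z by lra.
have h1 := expR_ge1Dx (- z); rewrite ger0_norm; last by lra.
have h2 : expR (- z) <= (1 + z)^-1 by rewrite expRN lef_pV2 ?posrE ?expR_gt0 // expR_ge1Dx.
have h3 : (1 + z)^-1 - (1 - z) <= 2 * z ^+ 2.
  have -> : (1 + z)^-1 - (1 - z) = z ^+ 2 * (1 + z)^-1 by field; rewrite gt_eqF.
  rewrite mulrC ler_wpM2r ?sqr_ge0 // -[X in _ <= X]invrK lef_pV2 ?posrE ?invr_gt0 //; lra.
lra.
Qed.

End Taylor.

(** * One-step moments, second moment and characteristic function *)

Section Fluctuations.
Variable R : realType.
Implicit Types (t : nat -> R) (s : state).

Definition time (m n : nat) : R := n%:R / m%:R.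

Definition dev (m d : nat) t (n : nat) s : R := comp_sum t s - m%:R * mu d t (time m n).

(** The change of [dev] when a component of index [k] grows; the last term is the motion of the
    centring during the same step. *)
Definition jump (m d : nat) t (n k : nat) : R :=
  t k.+1 - t k - m%:R * (mu d t (time m n.+1) - mu d t (time m n)).

Definition weight (m n : nat) (x : nat * nat) : R := x.2%:R / (m + n).*2%:R.

(** A backward Euler step of length 1/m: up to cycles, the conditional mean of the statistic of [t]
    at time n + 1 is the statistic of [pullback m n t] at time n. *)
Definition pullback (m n : nat) t (k : nat) : R := t k + m%:R^-1 * drift t (time m n) k.

Lemma comp_sum_lin (a b : R) t t' s :
  comp_sum (fun k => a * t k + b * t' k) s = a * comp_sum t s + b * comp_sum t' s.
Proof. by rewrite /comp_sum !mulr_sumr -big_split. Qed.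

Lemma dev_pullback m d t n s :
  dev m d (pullback m n t) n s = dev m d t n s + m%:R^-1 * dev m d (drift t (time m n)) n s.
Proof.
rewrite /dev; have -> : comp_sum (pullback m n t) s =
    1 * comp_sum t s + m%:R^-1 * comp_sum (drift t (time m n)) s.
  by rewrite -comp_sum_lin; apply: eq_bigr => x _; rewrite mul1r.
have -> : mu d (pullback m n t) (time m n) =
    1 * mu d t (time m n) + m%:R^-1 * mu d (drift t (time m n)) (time m n).
  by rewrite -mu_lin; apply: eq_mu => x _; rewrite mul1r.
ring.
Qed.

Lemma dev_grow m d t n s x : x \in s ->
  dev m d t n.+1 (grow x :: rem x s) = dev m d t n s + jump m d t n x.1.
Proof. by move=> xs; rewrite /dev comp_sum_grow // /jump; ring. Qed.

Lemma time_ge0 m n : 0 <= time m n.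
Proof. by rewrite /time divr_ge0. Qed.

Lemma timeD m n k : time m (n + k) = time m n + k%:R * m%:R^-1.
Proof. by rewrite /time natrD mulrDl. Qed.

Lemma time_le m n K : (0 < m)%N -> (n <= K * m)%N -> time m n <= K%:R.
Proof. by move=> m0 nK; rewrite /time ler_pdivrMr ?ltr0n // -natrM ler_nat. Qed.

Lemma avg_dev m d t n (phi : R -> R) s : (0 < m)%N ->
  avg m n (fun s' => phi (dev m d t n.+1 s')) s =
  \sum_(x <- s) weight m n x * phi (dev m d t n s + jump m d t n x.1).
Proof.
move=> m0; rewrite avgE big_seq [RHS]big_seq; apply: eq_bigr => x xs.
by rewrite dev_grow.
Qed.

Lemma inv_nat_le1 m : (0 < m)%N -> 0 <= (m%:R^-1 : R) <= 1.
Proof. by move=> m0; rewrite invr_ge0 ler0n invf_le1 ?ltr0n // ler1n. Qed.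

(** Below [d] the new value averages [t x] and [t x.+1] with weight a = (x+1) / (m(1 + n/m)), which
    is at most 1 because [d <= m]. No constant is lost over the O(m) steps. *)
Lemma pullback_ball m d rho t n : (0 < m)%N -> (d <= m)%N -> supp_ball d rho t ->
  supp_ball d rho (pullback m n t).
Proof.
move=> m0 dm [tr td]; split=> x; last first.
  by move=> dx; rewrite /pullback /drift /drift0 !td ?subrr ?mulr0 ?mul0r ?mulr0 ?addr0 //; lia.
case: (leqP d x) => dx.
  rewrite /pullback /drift /drift0 !td ?subrr ?mulr0 ?mul0r ?mulr0 ?addr0 //; last by lia.
  by rewrite normr0; apply: le_trans (tr 0%N).
have sp : 0 < 1 + time m n by rewrite ltr_pwDl // time_ge0.
have mp : 0 < m%:R :> R by rewrite ltr0n.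
pose a : R := x.+1%:R / (m%:R * (1 + time m n)).
have a0 : 0 <= a by rewrite /a divr_ge0 // mulr_ge0 // ltW.
have a1 : a <= 1.
  rewrite /a ler_pdivrMr ?mulr_gt0 // mul1r; apply: (@le_trans _ _ m%:R).
    by rewrite ler_nat; lia.
  by rewrite ler_peMr // lerDl time_ge0.
have -> : pullback m n t x = (1 - a) * t x + a * t x.+1.
  by rewrite /pullback /drift /drift0 /a; field; rewrite !gt_eqF.
have -> : rho = (1 - a) * rho + a * rho by ring.
apply: normD_le; apply: normM_le => //; rewrite ger0_norm // subr_ge0 //.
Qed.

Lemma dev_bound m d rho t n s K : (0 < m)%N -> (n <= K * m)%N -> supp_ball d rho t -> reachable m n s ->
  `|dev m d t n s| <= (rho * (2 + K + d)%:R) * m%:R.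
Proof.
move=> m0 nK [tr td] rs; have r0 : 0 <= rho by apply: le_trans (tr 0%N).
have h1 := comp_sum_bound rs tr; have h2 := mu_bound d (time_ge0 m n) tr.
have nm : `|m%:R : R| <= m%:R by rewrite ger0_norm.
apply: le_trans (normB_le h1 (normM_le nm h2)) _.
have e : (m.*2 + n)%:R <= ((2 + K) * m)%:R :> R by rewrite ler_nat; lia.
apply: (@le_trans _ _ (rho * ((2 + K) * m)%:R + m%:R * (d%:R * rho))).
  by rewrite lerD2r ler_wpM2l.
by rewrite natrM !natrD; rewrite le_eqVlt; apply/orP; left; apply/eqP; ring.
Qed.

Section Step.
Variables (d K : nat) (rho : R).

(** The second bound, over three steps, serves the triangle branch. As m > 3, these steps last less
    than one unit of time, hence the horizon [K.+1]. *)
Lemma mean_increment : exists2 C : R, 0 <= C & forall m n t, (3 < m)%N -> (n <= K * m)%N -> supp_ball d rho t ->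
  `|m%:R * (mu d t (time m n.+1) - mu d t (time m n)) -
    mu d (drift t (time m n)) (time m n)| <= C * m%:R^-1 /\
  `|m%:R * (mu d t (time m (n + 3)) - mu d t (time m n))| <= C.
Proof.
have [C C0 hC] := C11_mu K.+1%:R d rho.
have [D D0 hD] := C11_Lip (C11_mu K.+1%:R d rho).
exists (C + 3 * D) => [|m n t m3 nK bt]; first by rewrite addr_ge0 // mulr_ge0.
have m0 : (0 < m)%N by lia.
have mp : 0 < m%:R :> R by rewrite ltr0n.
have mV : m%:R * m%:R^-1 = 1 :> R by rewrite divff // gt_eqF.
have /andP[i0 i1] := inv_nat_le1 m0.
have t0 := time_ge0 m n; have tK := time_le m0 nK.
have i3 : 3 * m%:R^-1 <= 1 :> R by rewrite ler_pdivrMr // mul1r ler_nat; lia.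
have tK1 : 0 <= time m n <= K.+1%:R by rewrite t0 -natr1; lra.
have nm : `|m%:R : R| <= m%:R by rewrite ger0_norm.
split.
  have [_ _ h] := hC t bt _ tK1.
  have := h m%:R^-1; rewrite i0 i1 -[n.+1]addn1 timeD mul1r => /(_ isT) h'.
  have -> : m%:R * (mu d t (time m n + m%:R^-1) - mu d t (time m n)) - mu d (drift t (time m n)) (time m n) =
    m%:R * (mu d t (time m n + m%:R^-1) - mu d t (time m n) - m%:R^-1 * mu d (drift t (time m n)) (time m n)).
    by rewrite [RHS]mulrBr mulrA mV mul1r.
  apply: le_trans (normM_le nm (h' _)) _; first by rewrite -natr1; lra.
  have -> : m%:R * (C * m%:R^-1 ^+ 2) = C * m%:R^-1 * (m%:R * m%:R^-1) by ring.
  by rewrite mV mulr1 ler_wpM2r // lerDl mulr_ge0.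
have := hD t bt (time m n) (3 * m%:R^-1) t0; rewrite timeD => h.
apply: le_trans (normM_le nm (h _ _)) _.
- by rewrite i3 mulr_ge0.
- by rewrite -natr1; lra.
have -> : m%:R * (D * (3 * m%:R^-1)) = 3 * D * (m%:R * m%:R^-1) by ring.
by rewrite mV mulr1 lerDr.
Qed.

(** A path of index k is chosen with weight (k+1)/(m+n), so the mean change is a linear statistic
    with coefficients [drift t] divided by m. The moving centre cancels its mean and leaves a
    deviation; the weights deviate from this only through cycles. *)
Lemma step_moments : exists2 C : R, 0 <= C & forall m n t s, (3 < m)%N -> (n <= K * m)%N ->
  supp_ball d rho t -> reachable m n s ->
  [/\ forall k, `|jump m d t n k| <= C,
      `|\sum_(x <- s) weight m n x * jump m d t n x.1 -
        m%:R^-1 * dev m d (drift t (time m n)) n s| <= C * m%:R^-1 * (1 + cyc R m s) &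
      `|\sum_(x <- s) weight m n x * jump m d t n x.1 ^+ 2 - Qv d t (time m n)| <=
        C * m%:R^-1 * (1 + cyc R m s + `|dev m d (spread t (time m n)) n s| +
          `|dev m d (drift t (time m n)) n s|)].
Proof.
have [C1 C10 hC] := mean_increment.
have [[t0 [tr0 _]]|nb] := pselect (exists t, supp_ball d rho t); last first.
  by exists 0 => // m n t s _ _ bt; case: nb; exists t.
have rho0 : 0 <= rho by apply: le_trans (tr0 0%N).
pose b : R := d%:R * (d%:R * (2 * rho)).
have b0 : 0 <= b by rewrite /b !mulr_ge0.
pose c1 := b + C1; have c10 : 0 <= c1 by apply: addr_ge0.
pose e1 := 2 * rho + C1; have e10 : 0 <= e1 by rewrite addr_ge0 // mulr_ge0.
(* [2 * rho + c1] bounds the jumps, [e1] the error in the mean, and the last bracket the error in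
   the second moment. *)
exists (2 * rho + c1 + e1 + ((2 * rho) ^+ 2 + 1 + C1 * (c1 + b) + 2 * c1 * (1 + e1))).
  by rewrite !addr_ge0 // ?mulr_ge0 ?exprn_ge0 ?addr_ge0 // mulr_ge0.
move=> m n t s m3 nK bt rs; have m0 : (0 < m)%N by lia.
have [tr td] := bt; have mp : 0 < m%:R :> R by rewrite ltr0n.
have mV : m%:R * m%:R^-1 = 1 :> R by rewrite divff // gt_eqF.
have /andP[i0 i1] := inv_nat_le1 m0; set h := m%:R^-1 in i0 i1 mV *.
have s0 := time_ge0 m n; set sg := time m n in s0 *.
have cy0 : 0 <= cyc R m s by apply: (cyc_ge0 R m0 rs).
have [hc _] := hC m n t m3 nK bt.
set c := m%:R * _ in hc; set beta := mu d (drift t sg) sg in hc.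
have jE k : jump m d t n k = t k.+1 - t k - c by [].
have betab : `|beta| <= b by apply: mu_bound => //; case: (drift_ball s0 bt).
have cb : `|c| <= c1.
  have -> : c = beta + (c - beta) by ring.
  by apply: normD_le => //; apply: le_trans hc _; rewrite ler_piMr.
have Dt k : `|t k.+1 - t k| <= 2 * rho by rewrite mulr2n mulrDl !mul1r; apply: normB_le.
have Dt2 k : `|(t k.+1 - t k) ^+ 2| <= (2 * rho) ^+ 2 by rewrite !expr2; apply: normM_le.
have mn : (m + n)%:R = m%:R * (1 + sg) :> R.
  by rewrite /sg /time natrD; field; rewrite gt_eqF.
have sp : 1 + sg != 0 by rewrite gt_eqF // ltr_pwDl.
have mnz : m%:R != 0 :> R by rewrite gt_eqF.
have sum1 : \sum_(x <- s) weight m n x = 1 by apply: (sum_weights R m0 rs).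
set A := \sum_(x <- s) weight m n x * (t x.1.+1 - t x.1).
set B := \sum_(x <- s) weight m n x * (t x.1.+1 - t x.1) ^+ 2.
set S1 := \sum_(x <- s) weight m n x * jump m d t n x.1.
set S2 := \sum_(x <- s) weight m n x * jump m d t n x.1 ^+ 2.
have S1E : S1 = A - c.
  transitivity (A - (\sum_(x <- s) weight m n x) * c); last by rewrite sum1 mul1r.
  rewrite /S1 /A mulr_suml -sumrB; apply: eq_bigr => x _.
  by rewrite jE; ring.
have S2E : S2 = B - 2 * c * A + c ^+ 2.
  transitivity (B - 2 * c * A + (\sum_(x <- s) weight m n x) * c ^+ 2); last by rewrite sum1 mul1r.
  rewrite /S2 /A /B mulr_suml mulr_sumr -sumrB -big_split /=.
  by apply: eq_bigr => x _; rewrite jE; ring.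
have hA : `|A - h * comp_sum (drift t sg) s| <= 2 * rho * cyc R m s * h.
  have := weights_paths m0 rs Dt; rewrite -/A mn.
  have -> : comp_sum (fun k : nat => k.+1%:R * (t k.+1 - t k)) s / (m%:R * (1 + sg)) =
    h * comp_sum (drift t sg) s; last by [].
  rewrite /comp_sum mulr_suml mulr_sumr; apply: eq_bigr => x _.
  by rewrite /drift /drift0 /h; field; rewrite sp mnz.
have hB : `|B - h * comp_sum (spread t sg) s| <= (2 * rho) ^+ 2 * cyc R m s * h.
  have := weights_paths m0 rs Dt2; rewrite -/B mn.
  have -> : comp_sum (fun k : nat => k.+1%:R * (t k.+1 - t k) ^+ 2) s / (m%:R * (1 + sg)) =
    h * comp_sum (spread t sg) s; last by [].
  rewrite /comp_sum mulr_suml mulr_sumr; apply: eq_bigr => x _.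
  by rewrite /spread /h; field; rewrite sp mnz.
have dB : h * dev m d (drift t sg) n s = h * comp_sum (drift t sg) s - beta.
  transitivity (h * comp_sum (drift t sg) s - (m%:R * h) * beta); last by rewrite mV mul1r.
  by rewrite /dev -/sg -/beta; ring.
have dW : h * dev m d (spread t sg) n s = h * comp_sum (spread t sg) s - mu d (spread t sg) sg.
  transitivity (h * comp_sum (spread t sg) s - (m%:R * h) * mu d (spread t sg) sg).
    by rewrite /dev -/sg; ring.
  by rewrite mV mul1r.
have hS1 : `|S1 - h * dev m d (drift t sg) n s| <= e1 * h * (1 + cyc R m s).
  rewrite dB S1E.
  have -> : A - c - (h * comp_sum (drift t sg) s - beta) =
     (A - h * comp_sum (drift t sg) s) - (c - beta) by ring.
  apply: le_trans (normB_le hA hc) _; rewrite /e1.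
  have := mulr_ge0 C10 (mulr_ge0 i0 cy0); have := mulr_ge0 rho0 i0.
  rewrite -/h; nra.
split.
- move=> k; rewrite jE; apply: le_trans (normB_le (Dt k) cb) _.
  by rewrite -[leRHS]addrA lerDl !addr_ge0 ?mulr_ge0 ?addr_ge0 ?exprn_ge0 ?mulr_ge0.
- apply: le_trans hS1 _; apply: ler_wpM2r; first exact: addr_ge0.
  apply: ler_wpM2r => //.
  rewrite -subr_ge0; set X := (X in 2 * rho + c1 + e1 + X).
  have X0 : 0 <= X by rewrite /X !addr_ge0 ?mulr_ge0 ?addr_ge0 ?exprn_ge0 ?mulr_ge0.
  by have := mulr_ge0 (ler0n R 2) rho0; lra.
set YW := dev m d (spread t sg) n s in dW *; set YB := dev m d (drift t sg) n s in dB hS1 *.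
have -> : S2 - Qv d t sg = (B - h * comp_sum (spread t sg) s) + h * YW
    - (c - beta) * (c + beta) - 2 * c * S1.
  by rewrite S2E S1E dW /Qv -/beta; ring.
have hS1' : `|S1| <= h * `|YB| + e1 * h * (1 + cyc R m s).
  have -> : S1 = h * YB + (S1 - h * YB) by ring.
  by apply: normD_le => //; rewrite normrM ger0_norm.
have n2c : `|2 * c| <= 2 * c1 by rewrite normrM ger0_norm // ler_wpM2l.
have hYW : `|h * YW| <= h * `|YW| by rewrite normrM ger0_norm.
have := normB_le (normB_le (normD_le hB hYW) (normM_le hc (normD_le cb betab))) (normM_le n2c hS1').
move=> hh; apply: le_trans hh _; rewrite -/h.
have YW0 := normr_ge0 YW; have YB0 := normr_ge0 YB.
move: (`|YW|) (`|YB|) YW0 YB0 => u v u0 v0; move: (cyc R m s) cy0 => y y0.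
set G := (2 * rho) ^+ 2 + 1 + C1 * (c1 + b) + 2 * c1 * (1 + e1).
have G1 : (2 * rho) ^+ 2 <= G.
  by rewrite /G -!addrA lerDl !addr_ge0 // ?mulr_ge0 ?addr_ge0 ?mulr_ge0.
have G0 : 0 <= G by apply: le_trans G1; rewrite exprn_ge0 // mulr_ge0.
have step : (2 * rho) ^+ 2 * y * h + h * u + C1 * h * (c1 + b) + 2 * c1 * (h * v + e1 * h * (1 + y))
   <= G * h * (1 + y + u + v).
  have -> : (2 * rho) ^+ 2 * y * h + h * u + C1 * h * (c1 + b) + 2 * c1 * (h * v + e1 * h * (1 + y)) =
    h * ((2 * rho) ^+ 2 * y + 1 * u + (C1 * (c1 + b)) * 1 + (2 * c1) * v + (2 * c1 * e1) * (1 + y)) by ring.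
  have -> : G * h * (1 + y + u + v) = h * (G * (1 + y + u + v)) by ring.
  rewrite ler_wpM2l // /G.
  have x1 : 0 <= (2 * rho) ^+ 2 by rewrite exprn_ge0 // mulr_ge0.
  have x2 : 0 <= C1 * (c1 + b) by rewrite mulr_ge0 // addr_ge0.
  have x3 : 0 <= 2 * c1 by rewrite mulr_ge0.
  have x4 : 0 <= 2 * c1 * e1 by rewrite mulr_ge0.
  have -> : 2 * c1 * (1 + e1) = 2 * c1 + 2 * c1 * e1 by ring.
  move: ((2 * rho) ^+ 2) (C1 * (c1 + b)) (2 * c1) (2 * c1 * e1) x1 x2 x3 x4 => x1 x2 x3 x4 p1 p2 p3 p4.
  rewrite -subr_ge0.
  have -> : (x1 + 1 + x2 + (x3 + x4)) * (1 + y + u + v) -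
     (x1 * y + 1 * u + x2 * 1 + x3 * v + x4 * (1 + y)) =
     x1 * (1 + u + v) + (1 + y + v) + x2 * (y + u + v) + x3 * (1 + y + u) + x4 * (u + v) by ring.
  by rewrite !addr_ge0 // mulr_ge0 ?addr_ge0.
apply: le_trans step _; rewrite -/G; apply: ler_wpM2r; first by rewrite !addr_ge0.
apply: ler_wpM2r => //.
by rewrite -[leLHS]add0r lerD2r !addr_ge0 // mulr_ge0.
Qed.

End Step.
End Fluctuations.

(** * Second moments of linear statistics *)

Section Moments.
Variable R : realType.

Lemma mu_at0 d (t : nat -> R) : (forall x, (d <= x)%N -> t x = 0) -> mu d t 0 = t 0%N.
Proof.
case: d => [|d] td; first by rewrite /mu big_ord0 td.
rewrite /mu big_ord_recl big1 ?addr0 => [|x _].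
  by rewrite /geo expr0 addr0 expr1n divr1 mulr1.
by rewrite /geo lift0 exprS !mul0r mulr0.
Qed.

Variables (d K : nat) (rho : R).

Lemma ball_ge0 (t : nat -> R) : supp_ball d rho t -> 0 <= rho.
Proof. by case=> tr _; apply: le_trans (tr 0%N). Qed.

(** The triangle branch has weight at most 1/m, so it may lose [m%:R * e] where the other branch may
    lose only [e]. *)
Lemma Ex_step m n F (G : state -> R) (T e : R) : (0 < m)%N ->
  (forall s, reachable m n s -> avg m n F s <= G s) -> Ex m n G <= T + e ->
  ((2 <= n)%N -> Ex m (n - 2) (newtri F) <= T + m%:R * e) -> 0 <= e ->
  Ex m n.+1 F <= T + 2 * e.
Proof.
move=> m0 h1 h2 h3 e0; rewrite ExS //.
have mp : 0 < m%:R :> R by rewrite ltr0n.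
have E1 : Ex m n (avg m n F) <= T + e by apply: le_trans (Ex_le m0 h1) h2.
have p0 := eps_ge0 R m0 n; have p1 := eps_le R m0 n; have p2 := eps_le1 R m0 n.
case: (ltnP n 2) => n2.
  by rewrite (eps_small R m n2) subr0 mul1r mul0r addr0; apply: le_trans E1 _; lra.
apply: le_trans (lerD (ler_wpM2l _ E1) (ler_wpM2l p0 (h3 n2))) _; first by rewrite subr_ge0.
have : eps R m n * m%:R * e <= e.
  by rewrite ler_piMl // -ler_pdivlMr // div1r.
have : 0 <= eps R m n * e by rewrite mulr_ge0.
move=> a1 a2; lra.
Qed.

Lemma dev_newtri m (t : nat -> R) n s : (2 <= n)%N ->
  dev m d t n.+1 ((1, 6)%N :: s) = dev m d t (n - 2) s +
    (t 1%N - m%:R * (mu d t (time R m (n - 2 + 3)) - mu d t (time R m (n - 2)))).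
Proof.
move=> n2; have -> : (n - 2 + 3 = n.+1)%N by lia.
by rewrite /dev comp_sum_newtri; ring.
Qed.

(* The sup-norm contraction [t |-> pullback t] lets the second moment grow by O(1) per step only. *)
Lemma second_moment : exists2 C : R, 0 <= C & forall m n t, (3 < m)%N -> (d <= m)%N ->
  (n <= K * m)%N -> supp_ball d rho t -> Ex m n (fun s => dev m d t n s ^+ 2) <= C * n%:R.
Proof.
have [C1 C10 hM] := step_moments d K rho.
have [C2 C20 hI] := mean_increment d K rho.
have [[t0 bt0]|nb] := pselect (exists t, supp_ball d rho t); last first.
  by exists 0 => // m n t _ _ _ bt; case: nb; exists t.
have rho0 := ball_ge0 bt0.
(* The trivial bound [C3 * m] on the deviation suffices: it is multiplied by the error in the mean
   jump, which is O(1/m) times 1 plus the number of cycles. *)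
pose C3 : R := rho * (2 + K + d)%:R; have C30 : 0 <= C3 by rewrite mulr_ge0.
pose C4 : R := (2 * C3 * C1 + C1 ^+ 2) * (1 + K%:R).
have C40 : 0 <= C4.
  by rewrite /C4 mulr_ge0 // addr_ge0 ?exprn_ge0 // !mulr_ge0.
pose C5 : R := 2 * C3 * (rho + C2) + (rho + C2) ^+ 2.
have rC2 : 0 <= rho + C2 by apply: addr_ge0.
have C50 : 0 <= C5 by apply: addr_ge0; [rewrite !mulr_ge0 | rewrite exprn_ge0].
exists (2 * (C4 + C5)) => [|m n t m3 dm]; first by rewrite mulr_ge0 // addr_ge0.
have m0 : (0 < m)%N by lia.
have mp : 0 < m%:R :> R by rewrite ltr0n.
have mV : m%:R * m%:R^-1 = 1 :> R by rewrite divff // gt_eqF.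
have /andP[i0 i1] := inv_nat_le1 R m0.
elim/ltn_ind: n t => -[|n] ih t nK bt.
  (* At time 0 all components are single edges and the profile is the point mass at 0, so the
     deviation is 0. *)
  rewrite mulr0 (_ : (fun s => _) = fun s => comp_sum t s ^+ 2 - 2 * comp_sum t s * (m%:R * mu d t 0)
      + (m%:R * mu d t 0) ^+ 2); last by apply/funext => s; rewrite /dev /time mul0r; ring.
  rewrite /Ex /hmass /= divr1.
  suff -> : comp_sum t (nseq m (0, 2)%N) = m%:R * mu d t 0.
    by rewrite le_eqVlt; apply/orP; left; apply/eqP; ring.
  rewrite /comp_sum big_nseq iter_addr_0 mulr_natl; congr (_ *+ _) => /=.
  by case: bt => _ /mu_at0 ->.
have nK' : (n <= K * m)%N by apply: leq_trans nK; apply: leqnSn.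
set D := 2 * (C4 + C5).
have D0 : 0 <= D by rewrite /D mulr_ge0 // addr_ge0.
rewrite -[n.+1%:R]natr1 mulrDr mulr1 {2}/D.
apply: (@Ex_step m n _ (fun s => dev m d (pullback m n t) n s ^+ 2
   + (2 * C3 * C1 + C1 ^+ 2) * (1 + cyc R m s))) => //.
- move=> s rs; have [jC S1h _] := hM m n t s m3 nK' bt rs.
  have cy0 := cyc_ge0 R m0 rs.
  rewrite (avg_dev d t n (fun y => y ^+ 2) s m0) dev_pullback.
  have := dev_bound m0 nK' bt rs; rewrite -/C3.
  move: S1h; set h := m%:R^-1 in i0 i1 mV *; set S1 := \sum_(x <- s) _.
  move: (dev m d t n s) (dev m d (drift t _) n s) => Y YB S1h Yb.
  have -> : \sum_(x <- s) weight R m n x * (Y + jump m d t n x.1) ^+ 2 =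
     Y ^+ 2 + 2 * Y * S1 + \sum_(x <- s) weight R m n x * jump m d t n x.1 ^+ 2.
    transitivity ((\sum_(x <- s) weight R m n x) * Y ^+ 2 + 2 * Y * S1 +
      \sum_(x <- s) weight R m n x * jump m d t n x.1 ^+ 2).
      rewrite /S1 mulr_suml mulr_sumr -!big_split /=; apply: eq_bigr => x _; ring.
    by rewrite (sum_weights R m0 rs) mul1r.
  have S2b : \sum_(x <- s) weight R m n x * jump m d t n x.1 ^+ 2 <= C1 ^+ 2.
    rewrite -[leRHS]mul1r -(sum_weights R m0 rs) mulr_suml; apply: ler_sum => x _.
    apply: ler_wpM2l; first by rewrite /weight divr_ge0.
    by rewrite -real_normK ?num_real // lerXn2r ?nnegrE.
  have e1 : 2 * Y * (S1 - h * YB) <= 2 * C3 * C1 * (1 + cyc R m s).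
    apply: le_trans (ler_norm _) _; rewrite -mulrA.
    have n2 : `|2 : R| <= 2 by rewrite ger0_norm.
    apply: le_trans (normM_le n2 (normM_le Yb S1h)) _.
    have -> : 2 * (C3 * m%:R * (C1 * h * (1 + cyc R m s))) = (m%:R * h) * (2 * C3 * C1 * (1 + cyc R m s)) by ring.
    by rewrite mV mul1r.
  have e2 : C1 ^+ 2 <= C1 ^+ 2 * (1 + cyc R m s) by rewrite ler_peMr ?exprn_ge0 // lerDl.
  have e3 : 0 <= (h * YB) ^+ 2 by rewrite sqr_ge0.
  rewrite -subr_ge0; move: (\sum_(x <- s) _) S2b => S2 S2b.
  (* The square of the pulled-back deviation already contains Y^2 + 2hY [YB]; its remaining term (h
     [YB])^2 is nonnegative and is dropped. *)
  have -> : (Y + h * YB) ^+ 2 + (2 * C3 * C1 + C1 ^+ 2) * (1 + cyc R m s) - (Y ^+ 2 + 2 * Y * S1 + S2) =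
     (h * YB) ^+ 2 + (2 * C3 * C1 * (1 + cyc R m s) - 2 * Y * (S1 - h * YB)) +
      (C1 ^+ 2 * (1 + cyc R m s) - C1 ^+ 2) + (C1 ^+ 2 - S2) by ring.
  by apply: addr_ge0; [apply: addr_ge0; [apply: addr_ge0|]|]; rewrite ?subr_ge0.
- rewrite ExD; apply: lerD.
    by apply: ih => //; apply: pullback_ball.
  rewrite (ExZ m0) ExD (Ex_cst m0).
  apply: (@le_trans _ _ C4); last by rewrite lerDl.
  rewrite /C4; apply: ler_wpM2l; first by rewrite addr_ge0 ?exprn_ge0 // !mulr_ge0.
  by rewrite lerD2l; apply: le_trans (Ex_cyc R m0 n) _; rewrite -/(time R m n) (time_le _ m0 nK').
- move=> n2.
  have n2K : (n - 2 <= K * m)%N by apply: leq_trans nK'; apply: leq_subr.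
  have [_ hI2] := hI m (n - 2)%N t m3 n2K bt.
  apply: (@le_trans _ _ (Ex m (n - 2) (fun s => dev m d t (n - 2) s ^+ 2 + m%:R * C5))).
    apply: Ex_le => // s rs; rewrite /newtri dev_newtri //.
    have := dev_bound m0 n2K bt rs; rewrite -/C3.
    set e := t 1%N - _; have eb : `|e| <= rho + C2.
      by apply: normB_le => //; case: bt.
    move: (dev m d t _ s) => Y Yb.
    have e1 : 2 * Y * e <= m%:R * (2 * C3 * (rho + C2)).
      apply: le_trans (ler_norm _) _; rewrite -mulrA.
      have n2' : `|2 : R| <= 2 by rewrite ger0_norm.
      by apply: le_trans (normM_le n2' (normM_le Yb eb)) _; rewrite le_eqVlt; apply/orP; left; apply/eqP; ring.
    have e2 : e ^+ 2 <= m%:R * (rho + C2) ^+ 2.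
      apply: (@le_trans _ _ ((rho + C2) ^+ 2)).
        by rewrite -real_normK ?num_real // lerXn2r ?nnegrE // addr_ge0.
      by rewrite ler_peMl ?ler1n // sqr_ge0.
    rewrite sqrrD -addrA lerD2l /C5 [m%:R * (_ + _ ^+ 2)]mulrDr; apply: lerD => //.
    by rewrite -mulr_natl mulrA.
  rewrite ExD (Ex_cst m0); apply: lerD; last by rewrite ler_wpM2l // lerDr.
  apply: le_trans (ih _ _ _ _ bt) _ => //; first by rewrite ltnS leq_subr.
  by rewrite ler_wpM2l // ler_nat leq_subr.
- exact: addr_ge0.
Qed.

End Moments.

(** * The characteristic function, one step at a time *)

Section Characteristic.
Variable R : realType.
Variables (d K : nat) (rho : R).

(** With an arbitrary shift [b], real cosines carry both the real and the imaginary part of the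
    characteristic function. *)
Definition phase (m : nat) (t : nat -> R) (b : R) n (s : state) : R :=
  Num.sqrt m%:R^-1 * dev m d t n s + b.

Lemma sqrt_inv m : (0 < m)%N -> let r := Num.sqrt (m%:R^-1 : R) in
  [/\ 0 <= r, r <= 1, r ^+ 2 = m%:R^-1 & m%:R^-1 <= r].
Proof.
move=> m0 r; have /andP[i0 i1] := inv_nat_le1 R m0.
have r0 : 0 <= r by apply: sqrtr_ge0.
have r2 : r ^+ 2 = m%:R^-1 by rewrite sqr_sqrtr.
have r1 : r <= 1 by rewrite -(@expr_le1 _ 2) // r2.
by split=> //; rewrite -r2 expr2 ler_piMl.
Qed.

(** Expand the cosine to second order in jump/sqrt m. The first-order term goes back into the
    argument as the pullback, the second-order term becomes the factor 1 - Q/(2m), and the error is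
    m^{-3/2} times a quantity of bounded expectation. *)
Lemma avg_cos : exists2 C : R, 0 <= C & forall m n t b s, (3 < m)%N -> (n <= K * m)%N ->
  supp_ball d rho t -> reachable m n s ->
  `|avg m n (fun s' => cos (phase m t b n.+1 s')) s -
    (1 - m%:R^-1 * Qv d t (time R m n) / 2) * cos (phase m (pullback m n t) b n s)| <=
  C * m%:R^-1 * Num.sqrt m%:R^-1 * (1 + cyc R m s +
     m%:R^-1 * dev m d (drift t (time R m n)) n s ^+ 2 +
     m%:R^-1 * dev m d (spread t (time R m n)) n s ^+ 2).
Proof.
have [C C0 hM] := step_moments d K rho.
have [[t0 bt0]|nb] := pselect (exists t, supp_ball d rho t); last first.
  by exists 0 => // m n t b s _ _ bt; case: nb; exists t.
have rho0 := ball_ge0 bt0.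
pose q : R := d%:R * (d%:R * (2 * rho) ^+ 2) + (d%:R * (d%:R * (2 * rho))) ^+ 2.
have q0 : 0 <= q by rewrite /q addr_ge0 ?mulr_ge0 ?exprn_ge0 ?mulr_ge0.
exists (2 * C ^+ 3 + C + 2 + 3 * C + q).
  by rewrite !addr_ge0 ?mulr_ge0 ?exprn_ge0.
move=> m n t b s m3 nK bt rs; set h := m%:R^-1; set r := Num.sqrt h; have m0 : (0 < m)%N by lia.
have [r0 r1 r2 hr] := sqrt_inv m0; rewrite -/h -/r in r0 r1 r2 hr.
have /andP[h0 h1] := inv_nat_le1 R m0; rewrite -/h in h0 h1.
have [jC S1h S2h] := hM m n t s m3 nK bt rs; rewrite -/h in S1h S2h.
have cy0 := cyc_ge0 R m0 rs.
rewrite /phase -/r (avg_dev d t n (fun y => cos (r * y + b)) s m0) dev_pullback -/h.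
have Qb : `|Qv d t (time R m n)| <= q.
  have t0n := time_ge0 R m n.
  apply: normB_le; first by apply: mu_bound => //; case: (spread_ball t0n bt).
  by rewrite normrX lerXn2r ?nnegrE ?mulr_ge0 //; apply: mu_bound => //; case: (drift_ball t0n bt).
move: S1h S2h Qb; set S1 := \sum_(x <- s) weight R m n x * jump m d t n x.1.
set S2 := \sum_(x <- s) weight R m n x * jump m d t n x.1 ^+ 2.
move: (Qv d t _) (dev m d (drift t _) n s) (dev m d (spread t _) n s) => Q B W S1h S2h Qb.
set th := r * dev m d t n s + b.
have thE y : r * (dev m d t n s + y) + b = th + r * y by rewrite /th; ring.
under eq_bigr do rewrite thE.
rewrite thE; set T := \sum_(x <- s) _.
have e1 : `|T - (cos th - r * S1 * sin th - r ^+ 2 * S2 / 2 * cos th)| <= 2 * C ^+ 3 * h * r.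
  have -> : cos th - r * S1 * sin th - r ^+ 2 * S2 / 2 * cos th =
    \sum_(x <- s) weight R m n x * (cos th - (r * jump m d t n x.1) * sin th
       - (r * jump m d t n x.1) ^+ 2 / 2 * cos th).
    transitivity ((\sum_(x <- s) weight R m n x) * cos th - r * sin th * S1 - r ^+ 2 / 2 * cos th * S2).
      by rewrite (sum_weights R m0 rs); ring.
    rewrite /S1 /S2 mulr_suml !mulr_sumr -!sumrB; apply: eq_bigr => x _; ring.
  rewrite /T -sumrB; apply: le_trans (ler_norm_sum _ _ _) _.
  have -> : 2 * C ^+ 3 * h * r = (\sum_(x <- s) weight R m n x) * (2 * (C ^+ 3 * r ^+ 3)).
    by rewrite (sum_weights R m0 rs) mul1r -r2; ring.
  rewrite mulr_suml; apply: ler_sum => x _; rewrite -mulrBr normrM ger0_norm; last first.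
    by rewrite /weight divr_ge0.
  rewrite ler_wpM2l //; first by rewrite /weight divr_ge0.
  apply: le_trans (cos_taylor _ _) _; rewrite ler_wpM2l // normrM exprMn [leRHS]mulrC ger0_norm //.
  by rewrite ler_wpM2l ?exprn_ge0 // lerXn2r ?nnegrE.
have rB2 : (r * (h * B)) ^+ 2 = h * h * (h * B ^+ 2) by rewrite 2!exprMn r2; ring.
have sB := sin_max th; have cB := cos_max th.
have B2 : 0 <= h * B ^+ 2 by rewrite mulr_ge0 ?sqr_ge0.
have W2 : 0 <= h * W ^+ 2 by rewrite mulr_ge0 ?sqr_ge0.
have e2 : `|r * S1 * sin th - (r * (h * B)) * sin th| <= C * h * r * (1 + cyc R m s).
  have -> : r * S1 * sin th - (r * (h * B)) * sin th = r * ((S1 - h * B) * sin th) by ring.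
  rewrite normrM (ger0_norm r0); apply: le_trans (ler_wpM2l r0 (normM_le S1h sB)) _.
  by rewrite le_eqVlt; apply/orP; left; apply/eqP; ring.
have e3 : `|cos (th + r * (h * B)) - (cos th - (r * (h * B)) * sin th)| <= 2 * h * r * (h * B ^+ 2).
  apply: le_trans (cos_taylor1 _ _) _; rewrite real_normK ?num_real // rB2.
  rewrite [leLHS]mulrA; apply: ler_wpM2r => //; rewrite [leLHS]mulrA; apply: ler_wpM2l => //.
  exact: mulr_ge0.
(* With v = r|u| this is v <= 1 + v^2: a first absolute moment is traded for a second moment and a
   factor r is gained. *)
have lin u : h * `|u| <= r * (1 + h * u ^+ 2).
  rewrite -r2 expr2 -mulrA ler_wpM2l //.
  have : 0 <= (1 - r * `|u|) ^+ 2 by rewrite sqr_ge0.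
  have : 0 <= r * `|u| by rewrite mulr_ge0.
  have -> : r * r * u ^+ 2 = (r * `|u|) ^+ 2 by rewrite exprMn real_normK ?num_real // expr2.
  move: (r * `|u|) => v v0; rewrite sqrrB expr1n mul1r; lra.
have e4 : `|r ^+ 2 * S2 / 2 * cos th - h * Q / 2 * cos th| <= 3 * C * h * r * (1 + cyc R m s + h * B ^+ 2 + h * W ^+ 2).
  rewrite r2; have -> : h * S2 / 2 * cos th - h * Q / 2 * cos th = h * ((S2 - Q) * cos th) / 2 by field.
  have i2 : `|2^-1 : R| <= 1 by rewrite ger0_norm // invf_le1 // ler1n.
  have nh : `|h| <= h by rewrite ger0_norm.
  apply: le_trans (normM_le (normM_le nh (normM_le S2h cB)) i2) _; rewrite !mulr1.
  have -> : 3 * C * h * r * (1 + cyc R m s + h * B ^+ 2 + h * W ^+ 2) =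
    h * (C * (3 * (r * (1 + cyc R m s + h * B ^+ 2 + h * W ^+ 2)))) by ring.
  rewrite ler_wpM2l // -!mulrA ler_wpM2l // mulrDr mulrDr.
  have := lin B; have := lin W.
  have : h * (1 + cyc R m s) <= r * (1 + cyc R m s) by rewrite ler_wpM2r // addr_ge0.
  have := mulr_ge0 r0 cy0; have := mulr_ge0 r0 B2; have := mulr_ge0 r0 W2.
  move: (h * `|W|) (h * `|B|) (h * (1 + _)) => a1 a2 a3.
  rewrite !mulrDr !mulr1.
  by move: (r * (h * W ^+ 2)) (r * (h * B ^+ 2)) (r * cyc R m s) => b1 b2 b3; lra.
have e5 : `|h * Q / 2 * cos th - h * Q / 2 * cos (th + r * (h * B))| <= q * h * r * (1 + h * B ^+ 2).
  rewrite -mulrBr.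
  have i2 : `|2^-1 : R| <= 1 by rewrite ger0_norm // invf_le1 // ler1n.
  have nh : `|h| <= h by rewrite ger0_norm.
  have c1 : `|cos th - cos (th + r * (h * B))| <= r * (1 + h * B ^+ 2).
    apply: le_trans (cos_lip _ _) _.
    rewrite (_ : th - _ = - (r * (h * B))); last by ring.
    rewrite normrN normrM (ger0_norm r0) ler_wpM2l // normrM (ger0_norm h0).
    apply: le_trans (lin B) _; rewrite ler_piMl // addr_ge0 //.
  apply: le_trans (normM_le (normM_le (normM_le nh Qb) i2) c1) _.
  by rewrite le_eqVlt; apply/orP; left; apply/eqP; ring.
have -> : T - (1 - h * Q / 2) * cos (th + r * (h * B)) =
  (T - (cos th - r * S1 * sin th - r ^+ 2 * S2 / 2 * cos th))
  - (r * S1 * sin th - (r * (h * B)) * sin th)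
  - (cos (th + r * (h * B)) - (cos th - (r * (h * B)) * sin th))
  - (r ^+ 2 * S2 / 2 * cos th - h * Q / 2 * cos th)
  - (h * Q / 2 * cos th - h * Q / 2 * cos (th + r * (h * B))) by ring.
apply: le_trans (normB_le (normB_le (normB_le (normB_le e1 e2) e3) e4) e5) _.
have hr0 : 0 <= h * r by rewrite mulr_ge0.
have C30 : 0 <= C ^+ 3 by rewrite exprn_ge0.
move: (h * B ^+ 2) (h * W ^+ 2) B2 W2 (cyc R m s) cy0 (C ^+ 3) C30 => u v u0 v0 y y0 c3 c30.
rewrite -subr_ge0.
have -> : (2 * c3 + C + 2 + 3 * C + q) * h * r * (1 + y + u + v) -
  (2 * c3 * h * r + C * h * r * (1 + y) + 2 * h * r * u + 3 * C * h * r * (1 + y + u + v)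
   + q * h * r * (1 + u)) =
  (h * r) * (2 * c3 * (y + u + v) + C * (u + v) + 2 * (1 + y + v) + q * (y + v)) by ring.
by rewrite mulr_ge0 // !addr_ge0 // ?mulr_ge0 // !addr_ge0.
Qed.

End Characteristic.

Section CharacteristicBound.
Variable R : realType.

Lemma avg_close m n F (e : R) s : (0 < m)%N -> reachable m n s ->
  (forall x, x \in s -> `|F (grow x :: rem x s) - F s| <= e) -> `|avg m n F s - F s| <= e.
Proof.
move=> m0 rs h; rewrite avgE.
have -> : \sum_(x <- s) x.2%:R / (m + n).*2%:R * F (grow x :: rem x s) - F s =
  \sum_(x <- s) x.2%:R / (m + n).*2%:R * (F (grow x :: rem x s) - F s).
  transitivity (\sum_(x <- s) x.2%:R / (m + n).*2%:R * F (grow x :: rem x s) -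
    (\sum_(x <- s) x.2%:R / (m + n).*2%:R) * F s); first by rewrite (sum_weights R m0 rs) mul1r.
  by rewrite mulr_suml -sumrB; apply: eq_bigr => x _; rewrite mulrBr.
apply: le_trans (ler_norm_sum _ _ _) _.
have -> : e = (\sum_(x <- s) x.2%:R / (m + n).*2%:R) * e by rewrite (sum_weights R m0 rs) mul1r.
rewrite mulr_suml big_seq [leRHS]big_seq; apply: ler_sum => x xs.
by rewrite normrM ger0_norm ?divr_ge0 // ler_wpM2l ?divr_ge0 // h.
Qed.

Lemma Ex_le1 m n F : (0 < m)%N -> (forall s, `|F s| <= 1) -> `|Ex m n F| <= 1 :> R.
Proof.
move=> m0 F1; apply: le_trans (Ex_norm m0 _ _) _.
by rewrite -[leRHS](Ex_cst m0 n); apply: Ex_le.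
Qed.

(** Subdivision moves [F] by at most [e]; the triangle branch has weight at most 1/m and there the
    difference is at most 2. *)
Lemma Ex_consec m n F (e : R) : (0 < m)%N -> (forall s, `|F s| <= 1) ->
  (forall k s x, reachable m k s -> x \in s -> `|F (grow x :: rem x s) - F s| <= e) ->
  `|Ex m n.+1 F - Ex m n F| <= e + 2 * m%:R^-1.
Proof.
move=> m0 F1 h; rewrite ExS //.
have p0 := eps_ge0 R m0 n; have p1 := eps_le R m0 n; have p2 := eps_le1 R m0 n.
have -> : (1 - eps R m n) * Ex m n (avg m n F) + eps R m n * Ex m (n - 2) (newtri F) - Ex m n F =
  (1 - eps R m n) * (Ex m n (avg m n F) - Ex m n F) + eps R m n * (Ex m (n - 2) (newtri F) - Ex m n F).
  by ring.
have n1 : `|1 - eps R m n| <= 1 by rewrite ger0_norm ?subr_ge0 // gerBl.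
have n2 : `|eps R m n| <= m%:R^-1 by rewrite ger0_norm.
have h1 : `|Ex m n (avg m n F) - Ex m n F| <= e.
  by apply: Ex_dist_le => // s rs; apply: avg_close => // x xs; apply: h rs xs.
have h2 : `|Ex m (n - 2) (newtri F) - Ex m n F| <= 1 + 1.
  by apply: normB_le; apply: Ex_le1 => // s; apply: F1.
apply: le_trans (normD_le (normM_le n1 h1) (normM_le n2 h2)) _; lra.
Qed.

Variables (d K : nat) (rho : R).

Lemma cos_phase_grow m t b n s x : (0 < m)%N -> supp_ball d rho t -> x \in s ->
  `|cos (phase d m t b n (grow x :: rem x s)) - cos (phase d m t b n s)| <= 2 * rho * Num.sqrt m%:R^-1.
Proof.
move=> m0 [tr _] xs; apply: le_trans (cos_lip _ _) _.
have [r0 _ _ _] := sqrt_inv R m0.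
rewrite /phase /dev comp_sum_grow //; set r := Num.sqrt _ in r0 *.
have -> : r * (comp_sum t s + (t x.1.+1 - t x.1) - m%:R * mu d t (time R m n)) + b
   - (r * (comp_sum t s - m%:R * mu d t (time R m n)) + b) = r * (t x.1.+1 - t x.1) by ring.
rewrite normrM (ger0_norm r0) mulrC ler_wpM2r // mulr2n mulrDl !mul1r.
exact: normB_le.
Qed.

Lemma cos_phase_newtri m t b n s : (0 < m)%N -> supp_ball d rho t ->
  `|cos (phase d m t b n ((1, 6)%N :: s)) - cos (phase d m t b n s)| <= rho * Num.sqrt m%:R^-1.
Proof.
move=> m0 [tr _]; apply: le_trans (cos_lip _ _) _.
have [r0 _ _ _] := sqrt_inv R m0.
rewrite /phase /dev comp_sum_newtri; set r := Num.sqrt _ in r0 *.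
have -> : r * (comp_sum t s + t 1%N - m%:R * mu d t (time R m n)) + b
   - (r * (comp_sum t s - m%:R * mu d t (time R m n)) + b) = r * t 1%N by ring.
by rewrite normrM (ger0_norm r0) mulrC ler_wpM2r.
Qed.

(* The cycles created at rate O(1/m) move the characteristic function by O(m^{-3/2}) only. *)
Lemma triangle_defect m t b n k : (0 < m)%N -> supp_ball d rho t ->
  `|Ex m n.+1 (fun s => cos (phase d m t b k s)) -
    Ex m n (avg m n (fun s => cos (phase d m t b k s)))| <=
  (7 * rho + 4) * m%:R^-1 * Num.sqrt m%:R^-1.
Proof.
move=> m0 bt; set F := fun s => cos _; have rho0 := ball_ge0 bt.
have [r0 r1 r2 hr] := sqrt_inv R m0; set r := Num.sqrt _ in r0 r1 r2 hr *.
have /andP[h0 h1] := inv_nat_le1 R m0; set h := m%:R^-1 in h0 h1 r2 hr *.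
have p0 := eps_ge0 R m0 n; have p1 := eps_le R m0 n.
have F1 s : `|F s| <= 1 by apply: cos_max.
rewrite ExS //.
have -> : (1 - eps R m n) * Ex m n (avg m n F) + eps R m n * Ex m (n - 2) (newtri F) - Ex m n (avg m n F)
  = eps R m n * (Ex m (n - 2) (newtri F) - Ex m n (avg m n F)) by ring.
case: (ltnP n 2) => n2; first by rewrite eps_small // mul0r normr0 !mulr_ge0 // addr_ge0 // mulr_ge0.
have g k' s x : reachable m k' s -> x \in s -> `|F (grow x :: rem x s) - F s| <= 2 * rho * r.
  by move=> _ xs; apply: cos_phase_grow.
have a1 : `|Ex m (n - 2) (newtri F) - Ex m (n - 2) F| <= rho * r.
  by apply: Ex_dist_le => // s _; apply: cos_phase_newtri.
have a2 := Ex_consec (n - 2) m0 F1 g; have a3 := Ex_consec (n - 2).+1 m0 F1 g.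
have e2 : (n - 2).+2 = n by rewrite -addn2 subnK.
rewrite e2 in a3.
have a4 : `|Ex m n (avg m n F) - Ex m n F| <= 2 * rho * r.
  by apply: Ex_dist_le => // s rs; apply: avg_close => // x xs; apply: g rs xs.
(* Passing from n - 2 to n by single steps: the triangle and three growth steps cost (1 + 2 + 2 + 2)
   [rho * r], and the two changes of time cost 2/m each. *)
have -> : Ex m (n - 2) (newtri F) - Ex m n (avg m n F) =
  (Ex m (n - 2) (newtri F) - Ex m (n - 2) F) - (Ex m (n - 2).+1 F - Ex m (n - 2) F)
  - (Ex m n F - Ex m (n - 2).+1 F) - (Ex m n (avg m n F) - Ex m n F) by ring.
have ne : `|eps R m n| <= h by rewrite ger0_norm.
apply: le_trans (normM_le ne (normB_le (normB_le (normB_le a1 a2) a3) a4)) _.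
rewrite -/h; have -> : (7 * rho + 4) * h * r = h * ((7 * rho + 4) * r) by ring.
rewrite ler_wpM2l //; lra.
Qed.

(** The Gaussian value obeys the recursion of [avg_cos] up to O(m^{-2}), by [Hv_step] and the
    expansion of the exponential. *)
Lemma target_step : exists2 C : R, 0 <= C & exists M, forall m n t b, (M <= m)%N -> (n <= K * m)%N ->
  supp_ball d rho t ->
  `|expR (- Hv d t (time R m n.+1) / 2) * cos b -
    (1 - m%:R^-1 * Qv d t (time R m n) / 2) *
    (expR (- Hv d (pullback m n t) (time R m n) / 2) * cos b)| <= C * m%:R^-1 ^+ 2.
Proof.
have [C C0 hC] := Hv_step K.+1%:R d rho.
have [[t0 bt0]|nb] := pselect (exists t, supp_ball d rho t); last first.
  by exists 0 => //; exists 0%N => m n t b _ _ bt; case: nb; exists t.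
have rho0 := ball_ge0 bt0.
pose q : R := d%:R * (d%:R * (2 * rho) ^+ 2) + (d%:R * (d%:R * (2 * rho))) ^+ 2.
have q0 : 0 <= q by rewrite /q addr_ge0 ?mulr_ge0 ?exprn_ge0 ?mulr_ge0.
exists (C + 2 * (q + C) ^+ 2).
  by rewrite addr_ge0 // mulr_ge0 // exprn_ge0 // addr_ge0.
(* [d] keeps the pullback in the ball, so that its form is nonnegative; the last threshold makes the
   exponent [z] at most 1/2. *)
exists (maxn d (maxn 1 (Num.truncn (q + C)).+1)) => m n t b Mm nK bt.
have m0 : (0 < m)%N by lia.
have dm : (d <= m)%N by lia.
have mq : (q + C) <= m%:R.
  have : (Num.truncn (q + C)).+1%:R <= m%:R :> R by rewrite ler_nat; lia.
  have : q + C < (Num.truncn (q + C)).+1%:R by apply: truncnS_gt.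
  by move=> x y; apply: ltW; apply: lt_le_trans x y.
have mp : 0 < m%:R :> R by rewrite ltr0n.
have /andP[h0 h1] := inv_nat_le1 R m0; set h := m%:R^-1 in h0 h1 *.
have hm : h * m%:R = 1 by rewrite /h mulVf // gt_eqF.
have tn := time_ge0 R m n; have tK := time_le R m0 nK.
have hH : `|Hv d t (time R m n.+1) - Hv d (pullback m n t) (time R m n) - h * Qv d t (time R m n)| <= C * h ^+ 2.
  rewrite -[n.+1]addn1 timeD mul1r; apply: hC => //; first by rewrite h0 h1.
  by rewrite -natr1 -/h; lra.
have Hp : 0 <= Hv d (pullback m n t) (time R m n).
  by apply: Hv_ge0 => //; case: (pullback_ball n m0 dm bt).
have Qb : `|Qv d t (time R m n)| <= q.
  apply: normB_le; first by apply: mu_bound => //; case: (spread_ball tn bt).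
  by rewrite normrX lerXn2r ?nnegrE ?mulr_ge0 //; apply: mu_bound => //; case: (drift_ball tn bt).
move: hH Hp Qb; move: (Hv d (pullback m n t) (time R m n)) (Hv d t (time R m n.+1)) (Qv d t (time R m n)) => H0 H1 Q hH Hp Qb.
clearbody q.
pose z := (H1 - H0) / 2.
have -> : - H1 / 2 = - H0 / 2 + (- z) by rewrite /z; ring.
rewrite expRD.
have E0 : `|expR (- H0 / 2)| <= 1.
  by rewrite ger0_norm ?expR_ge0 // expR_le1 mulNr oppr_le0 divr_ge0.
have zQ : `|z - h * Q / 2| <= C * h ^+ 2 / 2.
  have -> : z - h * Q / 2 = (H1 - H0 - h * Q) * 2^-1 by rewrite /z; ring.
  by apply: normM_le => //; rewrite ger0_norm.
have hh : h ^+ 2 <= h by rewrite expr2 ler_piMl.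
have zb : `|z| <= (q + C) * h / 2.
  have -> : z = (z - h * Q / 2) + h * Q * 2^-1 by ring.
  have nh : `|h| <= h by rewrite ger0_norm.
  have n2 : `|2^-1 : R| <= 2^-1 by rewrite ger0_norm.
  apply: le_trans (normD_le zQ (normM_le (normM_le nh Qb) n2)) _.
  have := ler_wpM2l C0 hh; lra.
have z12 : `|z| <= 1 / 2.
  apply: le_trans zb _; apply: ler_wpM2r => //; by rewrite /h ler_pdivrMr // mul1r.
have ez := expR_taylor1 z12.
have z2 : z ^+ 2 <= (q + C) ^+ 2 * h ^+ 2.
  rewrite -real_normK ?num_real // -exprMn; apply: lerXn2r; rewrite ?nnegrE ?mulr_ge0 ?addr_ge0 //.
  apply: le_trans zb _; rewrite ler_pdivrMr // mulr2n mulrDr mulr1 lerDl mulr_ge0 // addr_ge0 //.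
have -> : expR (- H0 / 2) * expR (- z) * cos b - (1 - h * Q / 2) * (expR (- H0 / 2) * cos b) =
  expR (- H0 / 2) * (((expR (- z) - (1 - z)) - (z - h * Q / 2)) * cos b) by ring.
apply: le_trans (normM_le E0 (normM_le (normB_le ez zQ) (cos_max b))) _.
have k1 : 0 <= C * h ^+ 2 by rewrite mulr_ge0 ?sqr_ge0.
rewrite mul1r mulr1.
have -> : (C + 2 * (q + C) ^+ 2) * h ^+ 2 = C * h ^+ 2 + 2 * ((q + C) ^+ 2 * h ^+ 2) by ring.
move: (C * h ^+ 2) ((q + C) ^+ 2 * h ^+ 2) k1 z2 => u w k1 z2; lra.
Qed.

(** Both quantities follow the same recursion, so only errors accumulate: O(m^{-3/2}) per step,
    amplified by at most 1 + C/m. *)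
Lemma char_bound : exists2 C : R, 0 <= C & exists M, forall m n t b, (M <= m)%N -> (n <= K * m)%N ->
  supp_ball d rho t ->
  `|Ex m n (fun s => cos (phase d m t b n s)) - expR (- Hv d t (time R m n) / 2) * cos b| <=
  C * m%:R^-1 * Num.sqrt m%:R^-1 * n%:R * (1 + C * m%:R^-1) ^+ n.
Proof.
have [[t0 bt0]|nb] := pselect (exists t, supp_ball d rho t); last first.
  by exists 0 => //; exists 0%N => m n t b _ _ bt; case: nb; exists t.
have rho0 := ball_ge0 bt0.
have [A A0 hA] := avg_cos d K rho.
pose rd : R := d%:R * (2 * rho); pose rs : R := d%:R * (2 * rho) ^+ 2.
have [V1 V10 hV1] := second_moment d K rd.
have [V2 V20 hV2] := second_moment d K rs.
have [D D0 [M hM]] := target_step.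
pose q : R := d%:R * (d%:R * (2 * rho) ^+ 2) + (d%:R * (d%:R * (2 * rho))) ^+ 2.
have q0 : 0 <= q by rewrite /q addr_ge0 ?mulr_ge0 ?exprn_ge0 ?mulr_ge0.
(* The expected error of [avg_cos], then that of the triangle branch, then that of the Gaussian
   value. *)
pose C0 : R := A * (1 + K%:R + V1 * K%:R + V2 * K%:R) + (7 * rho + 4) + D.
have C00 : 0 <= C0.
  by rewrite /C0 !addr_ge0 ?mulr_ge0 ?addr_ge0 ?mulr_ge0.
exists (C0 + q); first exact: addr_ge0.
exists (maxn M (maxn d 4)) => m n t b Mm.
have m0 : (0 < m)%N by lia.
have m3 : (3 < m)%N by lia.
have dm : (d <= m)%N by lia.
have mp : 0 < m%:R :> R by rewrite ltr0n.
have [r0 r1 r2 hr] := sqrt_inv R m0; set r := Num.sqrt _ in r0 r1 r2 hr *.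
have /andP[h0 h1] := inv_nat_le1 R m0; set h := m%:R^-1 in h0 h1 r r0 r1 r2 hr *.
set C := C0 + q; have Cp : 0 <= C by apply: addr_ge0.
(* [t] stays general, because the induction hypothesis is applied to its pullback. *)
elim: n t b => [|n ih] t b nK bt.
  rewrite mulr0 mul0r /time mul0r.
  have -> : Hv d t 0 = 0.
    case: bt => _ td; have td2 x : (d <= x)%N -> t x ^+ 2 = 0 by move=> dx; rewrite td // expr0n.
    by rewrite /Hv (mu_at0 td2) (mu_at0 td) !mul0r subr0 subrr.
  rewrite oppr0 mul0r expR0 mul1r /Ex /hmass /= divr1 /phase /dev.
  have -> : comp_sum t (nseq m (0, 2)%N) = m%:R * t 0%N.
    by rewrite /comp_sum big_nseq iter_addr_0 mulr_natl.
  case: bt => _ td; rewrite /time mul0r (mu_at0 td) subrr mulr0 add0r subrr normr0 //.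
have nK' : (n <= K * m)%N by apply: leq_trans nK; apply: leqnSn.
have bp := pullback_ball n m0 dm bt.
have {}ih := ih (pullback m n t) b nK' bp.
have tn := time_ge0 R m n.
have hn : h * n%:R <= K%:R by rewrite mulrC; apply: time_le.
have e1 := triangle_defect b n n.+1 m0 bt.
set G := (1 - h * Qv d t (time R m n) / 2) in hM *.
have e2 : `|Ex m n (avg m n (fun s => cos (phase d m t b n.+1 s))) -
   G * Ex m n (fun s => cos (phase d m (pullback m n t) b n s))| <=
   A * (1 + K%:R + V1 * K%:R + V2 * K%:R) * h * r.
  rewrite -(ExZ m0); apply: le_trans (Ex_dist m0 _ _ _) _.
  apply: (@le_trans _ _ (Ex m n (fun s => A * h * r * (1 + cyc R m s +
     h * dev m d (drift t (time R m n)) n s ^+ 2 + h * dev m d (spread t (time R m n)) n s ^+ 2)))).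
    by apply: Ex_le => // s rs'; apply: hA.
  rewrite (ExZ m0) ExD ExD ExD (Ex_cst m0) !(ExZ m0).
  have -> : A * (1 + K%:R + V1 * K%:R + V2 * K%:R) * h * r = A * h * r * (1 + K%:R + V1 * K%:R + V2 * K%:R) by ring.
  rewrite ler_wpM2l ?mulr_ge0 //; apply: lerD; [apply: lerD; first rewrite lerD2l|].
  - by apply: le_trans (Ex_cyc R m0 n) _; rewrite -/(time R m n) (time_le R m0 nK').
  - apply: le_trans (ler_wpM2l h0 (hV1 m n _ m3 dm nK' (drift_ball tn bt))) _.
    by rewrite mulrCA ler_wpM2l.
  - apply: le_trans (ler_wpM2l h0 (hV2 m n _ m3 dm nK' (spread_ball tn bt))) _.
    by rewrite mulrCA ler_wpM2l.
have Mm' : (M <= m)%N by apply: leq_trans Mm; apply: leq_maxl.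
have e3 := hM m n t b Mm' nK' bt; rewrite -/h -/G in e3.
have Gb : `|G| <= 1 + C * h.
  have Qb : `|Qv d t (time R m n)| <= q.
    apply: normB_le; first by apply: mu_bound => //; case: (spread_ball tn bt).
    by rewrite normrX lerXn2r ?nnegrE ?mulr_ge0 //; apply: mu_bound => //; case: (drift_ball tn bt).
  have nh : `|h| <= h by rewrite ger0_norm.
  have n2 : `|2^-1 : R| <= 1 by rewrite ger0_norm // invf_le1 // ler1n.
  rewrite /G; apply: normB_le; first by rewrite normr1.
  apply: le_trans (normM_le (normM_le nh Qb) n2) _.
  by rewrite mulr1 mulrC ler_wpM2r // /C lerDr.
move: e1 e2 e3 ih => /=; rewrite -/h -/r.
set E1 := Ex m n.+1 _; set E2 := Ex m n (avg m n _); set E3 := Ex m n _.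
set T1 := _ * cos b; set T2 := _ * cos b => e1 e2 e3 ih.
have -> : E1 - T1 = (E1 - E2) + (E2 - G * E3) + G * (E3 - T2) - (T1 - G * T2) by ring.
apply: le_trans (normB_le (normD_le (normD_le e1 e2) (normM_le Gb ih)) e3) _.
have hr2 : h ^+ 2 <= h * r by rewrite expr2 ler_wpM2l.
have P1 : 1 <= (1 + C * h) ^+ n.+1 by rewrite exprn_ege1 // lerDl mulr_ge0.
have Dh := ler_wpM2l D0 hr2.
have hr0 : 0 <= h * r by rewrite mulr_ge0.
apply: (@le_trans _ _ (C0 * (h * r) + C * (h * r) * n%:R * (1 + C * h) ^+ n.+1)).
  have -> : (1 + C * h) * (C * h * r * n%:R * (1 + C * h) ^+ n) =
     C * (h * r) * n%:R * (1 + C * h) ^+ n.+1 by rewrite exprS; ring.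
  rewrite [leLHS]addrAC lerD2r.
  have -> : C0 * (h * r) = (7 * rho + 4) * h * r + A * (1 + K%:R + V1 * K%:R + V2 * K%:R) * h * r
     + D * (h * r) by rewrite /C0; ring.
  by rewrite lerD2l.
rewrite -[n.+1%:R]natr1.
have -> : C * h * r * (n%:R + 1) * (1 + C * h) ^+ n.+1 =
  C * (h * r) * (1 + C * h) ^+ n.+1 + C * (h * r) * n%:R * (1 + C * h) ^+ n.+1 by ring.
rewrite lerD2r; apply: (@le_trans _ _ (C * (h * r))).
  by rewrite ler_wpM2r // /C lerDl.
by rewrite ler_peMr // mulr_ge0.
Qed.

End CharacteristicBound.

Local Open Scope classical_set_scope.
Local Open Scope ring_scope.

(** * Gaussian expectations *)

Section Gauss1.
Variable R : realType.
Local Notation leb := (@lebesgue_measure R).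
Local Notation phi := (@std_normal_density R).
Implicit Types (f g : R -> R) (a b c x : R).

Lemma density_pdf x : phi x = normal_pdf 0 1 x.
Proof.
rewrite normal_pdfE ?oner_eq0 // /normal_peak /normal_fun /std_normal_density subr0.
by rewrite !expr1n mul1r mulrC.
Qed.

Lemma density_tilt c x : phi x * expR (c * x) = expR (c ^+ 2 / 2) * normal_pdf c 1 x.
Proof.
rewrite normal_pdfE ?oner_eq0 // /normal_peak /normal_fun /std_normal_density.
rewrite !expr1n mul1r; set S := Num.sqrt _.
transitivity ((expR (- x ^+ 2 / 2) * expR (c * x)) / S); first by ring.
transitivity ((expR (c ^+ 2 / 2) * expR (- (x - c) ^+ 2 / (1 *+ 2))) / S); last by ring.
by rewrite -!expRD; congr (expR _ / _); field.
Qed.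

Lemma density_ge0 x : 0 <= phi x.
Proof. by rewrite density_pdf normal_pdf_ge0. Qed.

Lemma density_continuous : continuous phi.
Proof.
have -> : phi = normal_pdf 0 1 by apply/funext => x; apply: density_pdf.
by apply: continuous_normal_pdf; apply: oner_neq0.
Qed.

Lemma density_integrable : leb.-integrable setT (EFin \o phi).
Proof.
rewrite (_ : EFin \o phi = fun x => (normal_pdf 0 1 x)%:E); last first.
  by apply/funext => x /=; rewrite density_pdf.
exact: integrable_normal_pdf.
Qed.

Lemma density_integral : (\int[leb]_x phi x)%R = 1.
Proof.
rewrite /Rintegral; under eq_integral do rewrite density_pdf.
by rewrite integral_normal_pdf.
Qed.

(** A majorant of the density times exp(c|x|), hence for c = 1 of |x| times the density. By tilting
    it is a multiple of the sum of two shifted normal densities, so it is integrable. *)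
Definition exp_majorant c x : R := phi x * (expR (c * x) + expR (- c * x)).

Lemma exp_majorant_integrable c : leb.-integrable setT (EFin \o exp_majorant c).
Proof.
rewrite (_ : EFin \o _ = fun x => ((expR (c ^+ 2 / 2))%:E * (normal_pdf c 1 x)%:E
    + (expR (c ^+ 2 / 2))%:E * (normal_pdf (- c) 1 x)%:E)%E).
  by apply: integrableD => //; apply: integrableZl => //; apply: integrable_normal_pdf.
apply/funext => x /=; rewrite -!EFinM -EFinD; congr _%:E.
by rewrite /exp_majorant mulrDr !density_tilt sqrrN.
Qed.

Lemma exp_majorant_ge c x : 0 <= c -> phi x * expR (c * `|x|) <= exp_majorant c x.
Proof.
move=> c0; apply: ler_wpM2l; first exact: density_ge0.
have [x0|x0] := leP 0 x; first by rewrite ger0_norm // lerDl expR_ge0.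
by rewrite ltr0_norm // mulrN -mulNr lerDr expR_ge0.
Qed.

Lemma continuous_integrable f g : continuous f -> leb.-integrable setT (EFin \o g) ->
  (forall x, `|f x| <= g x) -> leb.-integrable setT (EFin \o f).
Proof.
move=> cf ig fg; apply: (le_integrable measurableT _ _ ig) => //.
  by apply/measurable_EFinP; apply: continuous_measurable_fun.
move=> x _ /=; rewrite lee_fin; apply: le_trans (fg x) (ler_norm _).
Qed.

Lemma norm_le_expR x : `|x| <= expR `|x|.
Proof. by apply: le_trans (expR_ge1Dx _); rewrite lerDr. Qed.

Definition gmean f : R := (\int[leb]_x (phi x * f x))%R.

Lemma gmean_integrable f M : continuous f -> (forall x, `|f x| <= M) ->
  leb.-integrable setT (EFin \o (fun x => phi x * f x)).
Proof.
move=> cf fM; apply: (@continuous_integrable _ (fun x => M * phi x)).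
- by move=> x; apply: continuousM; [exact: density_continuous | exact: cf].
- by apply: (integrableZl _ _ density_integrable).
by move=> x; rewrite normrM (ger0_norm (density_ge0 x)) mulrC ler_wpM2r // density_ge0.
Qed.

Lemma affine_continuous a b : continuous (fun x : R => a * x + b).
Proof.
move=> x; apply: continuousD; last exact: cst_continuous.
by apply: continuousM; [exact: cst_continuous | exact: cvg_id].
Qed.

Lemma continuous_cos_affine a b : continuous (fun x : R => cos (a * x + b)).
Proof.
move=> x; apply: (@continuous_comp _ _ _ (fun x : R => a * x + b) cos).
  exact: affine_continuous.
exact: continuous_cos.
Qed.

Lemma continuous_sin_affine a b : continuous (fun x : R => sin (a * x + b)).
Proof.
move=> x; apply: (@continuous_comp _ _ _ (fun x : R => a * x + b) sin).
  exact: affine_continuous.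
exact: continuous_sin.
Qed.

Lemma is_derive_density x : is_derive x 1 phi (- x * phi x).
Proof.
rewrite /std_normal_density; apply: is_derive_eq; rewrite /GRing.scale /=.
move: (expR _) (Num.sqrt _)^-1 => A B; by field.
Qed.

(** Makes the boundary terms of the Gaussian integration by parts vanish. *)
Lemma density_decay : exists2 C : R, 0 <= C & forall x, x != 0 -> phi x <= C / `|x|.
Proof.
pose C : R := expR (1 ^+ 2 / 2) * normal_peak 1 + expR ((- 1) ^+ 2 / 2) * normal_peak 1.
exists C => [|x x0]; first by rewrite addr_ge0 // mulr_ge0 ?expR_ge0 ?normal_peak_ge0.
have nx : 0 < `|x| by rewrite normr_gt0.
rewrite ler_pdivlMr //; apply: (@le_trans _ _ (phi x * expR (1 * `|x|))).
  by rewrite mul1r ler_wpM2l ?density_ge0 // norm_le_expR.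
apply: le_trans (exp_majorant_ge x ler01) _.
rewrite /exp_majorant mulrDr !density_tilt /C; apply: lerD.
  by rewrite ler_wpM2l ?expR_ge0 // normal_pdf_ub ?oner_eq0.
by rewrite ler_wpM2l ?expR_ge0 // normal_pdf_ub ?oner_eq0.
Qed.

(** The fundamental theorem of calculus on [-n-1, n+1], then dominated convergence. *)
Lemma integral_derivative_eq0 f (df : R -> R) : (forall x, is_derive x 1 f (df x)) ->
  continuous df -> leb.-integrable setT (EFin \o df) ->
  (fun n : nat => f n.+1%:R - f (- n.+1%:R)) @ \oo --> (0 : R) ->
  (\int[leb]_x df x)%R = 0.
Proof.
move=> fd cdf idf f0.
have cf : continuous f.
  by move=> x; apply: differentiable_continuous; apply/derivable1_diffP; case: (fd x).
pose A (n : nat) : set R := `[- n.+1%:R, n.+1%:R]%classic.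
have ab (n : nat) : - n.+1%:R < n.+1%:R :> R.
  by apply: (@lt_trans _ _ 0); rewrite ?oppr_lt0 ltr0n.
have ftc n : (\int[leb]_x ((EFin \o df) \_ (A n)) x)%E = (f n.+1%:R - f (- n.+1%:R))%:E.
  rewrite -integral_mkcond EFinB; apply: continuous_FTC2 => //.
  - exact: continuous_subspaceT.
  - split.
    + by move=> x _; case: (fd x).
    + exact/cvg_at_right_filter/cf.
    + exact/cvg_at_left_filter/cf.
  - by move=> x _; rewrite derive1E; have [] := fd x.
have lim1 : (fun n => (\int[leb]_x ((EFin \o df) \_ (A n)) x)%E) @ \oo --> (\int[leb]_x (df x)%:E)%E.
  apply: (@dominated_cvg _ _ _ leb _ _ (fun n => (EFin \o df) \_ (A n)) _ (fun x => `|(df x)%:E|%E)) => //.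
  - move=> n; apply/measurable_restrict => //; first exact: measurable_itv.
    apply: measurable_funTS; apply/measurable_EFinP; exact: continuous_measurable_fun.
  - move=> x _; apply: cvg_near_cst.
    exists (Num.truncn `|x|) => // n /= xn; rewrite patchE ifT // inE /A /= in_itv /=.
    rewrite -ler_norml; apply: ltW; apply: lt_le_trans (truncnS_gt _) _.
    by rewrite ler_nat ltnS.
  - exact: integrable_abse.
  - move=> n x _; rewrite patchE; case: ifP => //= _; rewrite ?normr0 ?lee_fin //.
have lim2 : (fun n => (\int[leb]_x ((EFin \o df) \_ (A n)) x)%E) @ \oo --> (0%:E : \bar R).
  rewrite (_ : (fun n => _) = EFin \o (fun n : nat => f n.+1%:R - f (- n.+1%:R))); last first.
    by apply/funext => n; rewrite ftc.
  by apply: cvg_EFin; [exact: nearW | exact: f0].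
by rewrite /Rintegral (cvg_unique _ lim1 lim2).
Qed.

Lemma cos_integral_derive a b :
  is_derive a 1 (fun a' => gmean (fun x => cos (a' * x + b)))
    (gmean (fun x => - x * sin (a * x + b))).
Proof.
have d a' x : is_derive a' 1 (fun a' => phi x * cos (a' * x + b)) (phi x * (- x * sin (a' * x + b))).
  by apply: is_derive_eq; rewrite /GRing.scale /=; ring.
have Ia : `]a - 1, a + 1[%classic a by rewrite /= in_itv /= ltrDl ltrBlDr ltrDl ltr01.
have i1 a' : `]a - 1, a + 1[%classic a' ->
    leb.-integrable setT (EFin \o (fun x => phi x * cos (a' * x + b))).
  move=> _; apply: (@gmean_integrable _ 1); first exact: continuous_cos_affine.
  by move=> x; apply: cos_max.
have d1 a' x : `]a - 1, a + 1[%classic a' -> setT x ->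
    derivable (fun a' => phi x * cos (a' * x + b)) a' 1.
  by move=> _ _; case: (d a' x).
have G0 x : 0 <= exp_majorant 1 x.
  by rewrite mulr_ge0 ?density_ge0 // addr_ge0 ?expR_ge0.
have Gb a' x : `]a - 1, a + 1[%classic a' -> setT x ->
    `|partial1of2 (fun a' x => phi x * cos (a' * x + b)) a' x| <= exp_majorant 1 x.
  move=> _ _; rewrite /partial1of2 derive1E; have [_ ->] := d a' x.
  apply: le_trans (exp_majorant_ge x ler01).
  rewrite normrM (ger0_norm (density_ge0 x)) ler_wpM2l ?density_ge0 // mul1r.
  rewrite normrM normrN -[leRHS]mulr1 ler_pM ?sin_max //; exact: norm_le_expR.
split.
  exact: (derivable_under_integral measurableT Ia i1 d1 G0 (exp_majorant_integrable 1) Gb).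
rewrite -derive1E.
rewrite (differentiation_under_integral measurableT Ia i1 d1 G0 (exp_majorant_integrable 1) Gb).
apply: eq_Rintegral => x _; rewrite /partial1of2 derive1E; by have [_ ->] := d a x.
Qed.

(** Gaussian integration by parts: the density has derivative -x times itself. *)
Lemma gmean_x_sin a b :
  gmean (fun x => - x * sin (a * x + b)) = - a * gmean (fun x => cos (a * x + b)).
Proof.
pose f x := phi x * sin (a * x + b).
have d x : is_derive x 1 f (phi x * (- x * sin (a * x + b)) + a * (phi x * cos (a * x + b))).
  have dphi := is_derive_density x.
  by rewrite /f; apply: is_derive_eq; rewrite /GRing.scale /=; ring.
have c1 : continuous (fun x => phi x * (- x * sin (a * x + b))).
  move=> x; apply: continuousM; first exact: density_continuous.
  apply: continuousM; last exact: continuous_sin_affine.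
  by apply: continuousN; exact: cvg_id.
have i1 : leb.-integrable setT (EFin \o (fun x => phi x * (- x * sin (a * x + b)))).
  apply: (continuous_integrable c1 (exp_majorant_integrable 1)) => x.
  apply: le_trans (exp_majorant_ge x ler01).
  rewrite normrM (ger0_norm (density_ge0 x)) ler_wpM2l ?density_ge0 // mul1r.
  by rewrite normrM normrN -[leRHS]mulr1 ler_pM ?sin_max // norm_le_expR.
have i2 : leb.-integrable setT (EFin \o (fun x => phi x * cos (a * x + b))).
  apply: (@gmean_integrable _ 1); first exact: continuous_cos_affine.
  by move=> x; apply: cos_max.
have i3 : leb.-integrable setT (EFin \o (fun x => a * (phi x * cos (a * x + b)))).
  by apply: (integrableZl _ _ i2).
have c2 : continuous (fun x => phi x * cos (a * x + b)).
  by move=> x; apply: continuousM; [exact: density_continuous | exact: continuous_cos_affine].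
have c3 : continuous (fun x => phi x * (- x * sin (a * x + b)) + a * (phi x * cos (a * x + b))).
  move=> x; apply: cvgD; first exact: c1.
  by apply: cvgM; [exact: cvg_cst | exact: c2].
have h := integral_derivative_eq0 d.
have e : (\int[leb]_x (phi x * (- x * sin (a * x + b)) + a * (phi x * cos (a * x + b))))%R = 0.
  apply: h.
  - exact: c3.
  - exact: (integrableD measurableT i1 i3).
  have [C C0 hC] := density_decay.
  apply/cvgrPdist_le => e e0; exists (Num.truncn (2 * C / e)) => // n /= hn.
  rewrite sub0r normrN.
  have np : 0 < n.+1%:R :> R by rewrite ltr0n.
  have fb x : `|x| = n.+1%:R -> `|f x| <= C / n.+1%:R.
    move=> xe; rewrite /f normrM (ger0_norm (density_ge0 x)) -[leRHS]mulr1.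
    apply: ler_pM; rewrite ?density_ge0 ?sin_max // -xe; apply: hC.
    by rewrite -normr_gt0 xe.
  have b1 : `|f n.+1%:R| <= C / n.+1%:R by apply: fb; rewrite ger0_norm.
  have b2 : `|f (- n.+1%:R)| <= C / n.+1%:R by apply: fb; rewrite normrN ger0_norm.
  apply: le_trans (normB_le b1 b2) _.
  have hn' : 2 * C / e < n.+1%:R by apply: lt_le_trans (truncnS_gt _) _; rewrite ler_nat ltnS.
  have -> : C / n.+1%:R + C / n.+1%:R = 2 * C / n.+1%:R by ring.
  by rewrite ler_pdivrMr // [leRHS]mulrC -ler_pdivrMr //; apply: ltW.
move: e; rewrite RintegralD // RintegralZl // => /eqP; rewrite addr_eq0 => /eqP e.
by rewrite {1}/gmean e mulNr.
Qed.

(** As a function of [a] the mean J satisfies J' = -aJ, so J(a) exp(a^2/2) is constant, with value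
    cos b at 0. *)
Theorem gmean_cos a b : gmean (fun x => cos (a * x + b)) = expR (- a ^+ 2 / 2) * cos b.
Proof.
pose J a := gmean (fun x => cos (a * x + b)).
pose H a := J a * expR (a ^+ 2 / 2).
have dH a' : is_derive a' 1 H 0.
  have dJ : is_derive a' 1 J (- a' * J a').
    by rewrite /J -gmean_x_sin; apply: cos_integral_derive.
  by rewrite /H; apply: is_derive_eq; rewrite /GRing.scale /=; field.
have Hc : H a = H 0.
  apply/eqP; rewrite -subr_eq0 -normr_le0.
  have := @mvt_bound R H (fun=> 0) 0 a 0 dH; rewrite mul0r; apply => y _.
  by rewrite normr0.
have H0 : H 0 = cos b.
  rewrite /H expr0n /= mul0r expR0 mulr1 /J /gmean.
  under eq_Rintegral do rewrite mul0r add0r.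
  by rewrite RintegralZr ?density_integral ?mul1r //; exact: density_integrable.
have -> : gmean (fun x => cos (a * x + b)) = H a * expR (- a ^+ 2 / 2).
  by rewrite /H -mulrA -expRD -mulrDl subrr mul0r expR0 mulr1.
by rewrite Hc H0 mulrC.
Qed.

End Gauss1.

(** * Iterated Gaussian integrals *)

Section GaussN.
Variable R : realType.
Local Notation leb := (@lebesgue_measure R).

Lemma rV_continuous (T : topologicalType) n (g : T -> 'rV[R]_n) :
  (forall j, continuous (fun x => g x ord0 j)) -> continuous g.
Proof.
move=> gc x; apply/cvg_ballP => e e0.
have h : \forall y \near x, forall j, ball (g x ord0 j) e (g y ord0 j).
  by apply: filter_forall => j; have /cvg_ballP/(_ e e0) := gc j x.
by apply: filterS h => y hy; split=> // i j; rewrite ord1; apply: hy.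
Qed.

Definition rV_cons d (x : R) (w : 'rV[R]_d) : 'rV[R]_d.+1 := row_mx (\row_(_ < 1) x) w.

Lemma rV_consEl d (x : R) (w : 'rV[R]_d) (k : 'I_1) : rV_cons x w ord0 (lshift d k) = x.
Proof. by apply: etrans (row_mxEl _ _ _ _) _; rewrite mxE. Qed.

Lemma rV_consEr d (x : R) (w : 'rV[R]_d) (k : 'I_d) : rV_cons x w ord0 (rshift 1 k) = w ord0 k.
Proof. exact: (row_mxEr (\row_(_ < 1) x) w ord0 k). Qed.

Lemma rV_cons_continuousl d (w : 'rV[R]_d) : continuous (fun x => rV_cons x w).
Proof.
apply: rV_continuous => j; case: (@split_ordP 1 d j) => k ->.
  rewrite (_ : (fun x => _) = id); first by move=> x; exact: cvg_id.
  by apply/funext => x; rewrite rV_consEl.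
rewrite (_ : (fun x => _) = cst (w ord0 k)); first exact: cst_continuous.
by apply/funext => x; rewrite rV_consEr.
Qed.

Lemma rV_cons_continuousr d x : continuous (@rV_cons d x).
Proof.
apply: rV_continuous => j; case: (@split_ordP 1 d j) => k ->.
  rewrite (_ : (fun w => _) = cst x); first exact: cst_continuous.
  by apply/funext => w; rewrite rV_consEl.
have -> : (fun w : 'rV[R]_d => rV_cons x w ord0 (rshift 1 k)) = (fun w => w ord0 k).
  by apply/funext => w; rewrite rV_consEr.
exact: coord_continuous.
Qed.

Lemma rV_cons_compl d (w : 'rV[R]_d) (g : 'rV[R]_d.+1 -> R) : continuous g ->
  continuous (fun x => g (rV_cons x w)).
Proof.
move=> cg x; apply: (@continuous_comp _ _ _ (fun x => rV_cons x w) g); last exact: cg.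
exact: rV_cons_continuousl.
Qed.

Lemma gmean_le (f g : R -> R) (M : R) : continuous f -> continuous g ->
  (forall x, `|f x| <= M) -> (forall x, `|g x| <= M) -> (forall x, f x <= g x) ->
  gmean f <= gmean g.
Proof.
move=> cf cg fM gM fg; apply: le_Rintegral => //.
- exact: gmean_integrable fM.
- exact: gmean_integrable gM.
by move=> x _; rewrite ler_wpM2l ?density_ge0.
Qed.

Lemma gmean_cst (c : R) : gmean (fun=> c) = c :> R.
Proof. by rewrite /gmean RintegralZr ?density_integral ?mul1r //; exact: density_integrable. Qed.

Lemma gmean_lin (a : R) (f g : R -> R) (M : R) : continuous f -> continuous g ->
  (forall x, `|f x| <= M) -> (forall x, `|g x| <= M) ->
  gmean (fun x => a * f x + g x) = a * gmean f + gmean g :> R.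
Proof.
move=> cf cg fM gM; rewrite /gmean.
have i1 := gmean_integrable cf fM; have i2 := gmean_integrable cg gM.
have i3 : leb.-integrable setT (EFin \o (fun x => a * (std_normal_density x * f x))).
  by apply: (integrableZl _ _ i1).
rewrite -RintegralZl // -RintegralD //; apply: eq_Rintegral => x _; ring.
Qed.

Lemma gmean_bound (f : R -> R) (M : R) : continuous f -> (forall x, `|f x| <= M) -> `|gmean f| <= M.
Proof.
move=> cf fM; have M0 : 0 <= M by apply: le_trans (fM 0).
have cM (c : R) : continuous (fun _ : R => c) by move=> x; exact: cvg_cst.
rewrite ler_norml -{1}(gmean_cst (- M)) -{2}(gmean_cst M); apply/andP; split;
  apply: (@gmean_le _ _ M) => //; try (by move=> x; rewrite ?normrN ger0_norm);
  by move=> x; have := fM x; rewrite ler_norml => /andP[].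
Qed.

Lemma gmean_cvg (f_ : nat -> R -> R) (f : R -> R) (M : R) : (forall n, continuous (f_ n)) -> continuous f ->
  (forall n x, `|f_ n x| <= M) -> (forall x, f_ ^~ x @ \oo --> f x) ->
  (fun n => gmean (f_ n)) @ \oo --> (gmean f : R).
Proof.
move=> cf_ cf fM ff.
have cd g : continuous g -> continuous (fun x => std_normal_density x * g x : R).
  by move=> cg x; apply: cvgM; [exact: density_continuous | exact: cg].
have fM' x : `|f x| <= M.
  have h : `|f_ n x| @[n --> \oo] --> `|f x| by apply: cvg_norm; exact: ff.
  rewrite -(cvg_lim (@norm_hausdorff _ _) h); apply: limr_le.
    by apply/cvg_ex; exists `|f x|.
  by apply: nearW => n; exact: fM.
have iM : leb.-integrable setT (EFin \o (fun x => M * std_normal_density x)).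
  by apply: (integrableZl _ _ (density_integrable R)).
have h : (fun n => \int[leb]_x (std_normal_density x * f_ n x)%:E)%E @ \oo -->
    (\int[leb]_x (std_normal_density x * f x)%:E)%E.
  apply: (@dominated_cvg _ _ _ leb _ _ (fun n x => (std_normal_density x * f_ n x)%:E) _
    (EFin \o (fun x => M * std_normal_density x))) => //.
  - by move=> n; apply/measurable_EFinP; apply: continuous_measurable_fun; apply: cd.
  - move=> x _; apply: cvg_EFin; first exact: nearW.
    by apply: cvgM; [exact: cvg_cst | exact: ff].
  - move=> n x _ /=; rewrite lee_fin normrM ger0_norm ?density_ge0 // mulrC.
    by rewrite ler_wpM2r ?density_ge0.
have fin : (\int[leb]_x (std_normal_density x * f x)%:E)%E = (gmean f)%:E.
  by rewrite /gmean /Rintegral fineK //; apply: integrable_fin_num => //; exact: gmean_integrable fM'.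
rewrite fin in h; exact: fine_cvg h.
Qed.

Lemma gauss_expectS d (g : 'rV[R]_d.+1 -> R) :
  gauss_expect g = gmean (fun x => gauss_expect (fun w => g (rV_cons x w))).
Proof. by []. Qed.

Definition bounded_continuous d (M : R) (g : 'rV[R]_d -> R) : Prop :=
  continuous g /\ forall x, `|g x| <= M.

Lemma bounded_continuous_cons d M (g : 'rV[R]_d.+1 -> R) x :
  bounded_continuous M g -> bounded_continuous M (fun w => g (rV_cons x w)).
Proof.
case=> cg gM; split=> // w.
apply: (@continuous_comp _ _ _ (@rV_cons d x) g); last exact: cg.
exact: rV_cons_continuousr.
Qed.

(** Bound and dominated convergence go together through the induction: the inner expectation must be
    continuous in the first coordinate to be integrated, and this continuity is sequential
    convergence in dimension [d]. *)
Lemma gauss_expect_cvg d M : 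
  (forall g : 'rV[R]_d -> R, bounded_continuous M g -> `|gauss_expect g| <= M) /\
  (forall (g_ : nat -> 'rV[R]_d -> R) g, (forall n, bounded_continuous M (g_ n)) ->
    bounded_continuous M g -> (forall x, g_ ^~ x @ \oo --> g x) ->
    (fun n => gauss_expect (g_ n)) @ \oo --> (gauss_expect g : R)).
Proof.
elim: d => [|d [ih1 ih2]].
  by split=> [g [_ gM] | g_ g _ _ h]; [exact: gM | exact: h].
have inner (g : 'rV[R]_d.+1 -> R) : bounded_continuous M g ->
    continuous (fun x => gauss_expect (fun w => g (rV_cons x w))) /\
    (forall x, `|gauss_expect (fun w => g (rV_cons x w))| <= M).
  move=> bg; split=> [x|x]; last by apply: ih1; apply: bounded_continuous_cons.
  apply/(@cvg_nbhsP _ R^o) => u ux; apply: ih2.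
  - by move=> n; apply: bounded_continuous_cons.
  - by apply: bounded_continuous_cons.
  move=> w; case: bg => cg _.
  exact: (cvg_comp u _ ux (@rV_cons_compl _ w _ cg x)).
split=> [g bg|g_ g bg_ bg gg].
  by rewrite gauss_expectS; have [c b] := inner g bg; apply: gmean_bound.
rewrite gauss_expectS; have [c b] := inner g bg.
apply: (@gmean_cvg (fun n x => gauss_expect (fun w => g_ n (rV_cons x w))) _ M).
- by move=> n; case: (inner _ (bg_ n)).
- exact: c.
- by move=> n x; case: (inner _ (bg_ n)).
move=> x; apply: ih2.
- by move=> n; apply: bounded_continuous_cons.
- by apply: bounded_continuous_cons.
by move=> w; apply: gg.
Qed.

Lemma gauss_expect_inner d M (g : 'rV[R]_d.+1 -> R) : bounded_continuous M g ->
    continuous (fun x => gauss_expect (fun w => g (rV_cons x w))) /\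
    (forall x, `|gauss_expect (fun w => g (rV_cons x w))| <= M).
Proof.
have [ih1 ih2] := gauss_expect_cvg d M.
move=> bg; split=> [x|x]; last by apply: ih1; apply: bounded_continuous_cons.
apply/(@cvg_nbhsP _ R^o) => u ux; apply: ih2.
- by move=> n; apply: bounded_continuous_cons.
- by apply: bounded_continuous_cons.
move=> w; case: bg => cg _.
exact: (cvg_comp u _ ux (@rV_cons_compl _ w _ cg x)).
Qed.

Lemma gauss_expect_lin d M a (f g : 'rV[R]_d -> R) :
  bounded_continuous M f -> bounded_continuous M g ->
  gauss_expect (fun x => a * f x + g x) = a * gauss_expect f + gauss_expect g.
Proof.
elim: d f g => [//|d ih] f g bf bg; rewrite !gauss_expectS.
have [c1 b1] := gauss_expect_inner bf; have [c2 b2] := gauss_expect_inner bg.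
rewrite -(gmean_lin a c1 c2 b1 b2); congr gmean; apply/funext => x.
by rewrite -ih //; apply: bounded_continuous_cons.
Qed.

Lemma gauss_expect_le d M (f g : 'rV[R]_d -> R) :
  bounded_continuous M f -> bounded_continuous M g -> (forall x, f x <= g x) ->
  gauss_expect f <= gauss_expect g.
Proof.
elim: d f g => [|d ih] f g bf bg fg; first exact: fg.
rewrite !gauss_expectS.
have [c1 b1] := gauss_expect_inner bf; have [c2 b2] := gauss_expect_inner bg.
apply: (gmean_le c1 c2 b1 b2) => x.
by apply: ih; [apply: bounded_continuous_cons | apply: bounded_continuous_cons | move=> w; apply: fg].
Qed.

Lemma rV_cons_dot d (x y : R) (w v : 'rV[R]_d) :
  (rV_cons x w *m (rV_cons y v)^T) ord0 ord0 = x * y + (w *m v^T) ord0 ord0.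
Proof.
have e0 : (ord0 : 'I_d.+1) = lshift d (ord0 : 'I_1) by apply: val_inj.
have e1 (k : 'I_d) : lift ord0 k = rshift 1 k by apply: val_inj.
rewrite mxE big_ord_recl [in RHS]mxE; congr (_ + _).
  by rewrite [X in _ * X]mxE e0 !rV_consEl.
by apply: eq_bigr => k _; rewrite e1 [X in _ * X]mxE [in RHS]mxE !rV_consEr.
Qed.

Lemma rV_consP d (s : 'rV[R]_d.+1) : exists y v, s = rV_cons y v.
Proof.
exists (s ord0 (lshift d (ord0 : 'I_1))), (\row_k s ord0 (rshift 1 k)); apply/rowP => j.
case: (@split_ordP 1 d j) => k ->; first by rewrite rV_consEl ord1.
by rewrite rV_consEr mxE.
Qed.

(** Once the first coordinate is fixed, its contribution joins the shift [b]; the induction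
    hypothesis then leaves a one-dimensional cosine. *)
Lemma gauss_expect_cos d (s : 'rV[R]_d) b :
  gauss_expect (fun w => cos ((w *m s^T) ord0 ord0 + b)) =
  expR (- (s *m s^T) ord0 ord0 / 2) * cos b.
Proof.
elim: d s b => [|d ih] s b.
  by rewrite /= !mxE !big_ord0 add0r oppr0 mul0r expR0 mul1r.
rewrite gauss_expectS; have [y [v ->]] := rV_consP s.
transitivity (gmean (fun x => expR (- (v *m v^T) ord0 ord0 / 2) * cos (y * x + b) + 0)).
  congr gmean; apply/funext => x; rewrite addr0 -ih; congr gauss_expect; apply/funext => w.
  by rewrite rV_cons_dot; congr cos; ring.
rewrite (@gmean_lin _ (fun x => cos (y * x + b)) (fun=> 0) 1).
- rewrite gmean_cst addr0 gmean_cos mulrA -expRD rV_cons_dot; congr (expR _ * _).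
  by field.
- exact: continuous_cos_affine.
- by move=> x; exact: cvg_cst.
- by move=> x; exact: cos_max.
- by move=> x; rewrite normr0 ler01.
Qed.

End GaussN.

(** * Approximation by trigonometric polynomials *)

Section Bernstein.
Variable R : realType.

(** The mean of [f] under the binomial law with parameters N and p, unfolded along one trial: a
    Bernstein polynomial in [p] with coefficients f(0), ..., f(N). *)
Fixpoint bern (N : nat) (p : R) (f : nat -> R) : R :=
  if N is N'.+1 then p * bern N' p (fun k => f k.+1) + (1 - p) * bern N' p f else f 0%N.

Lemma eq_bern N p f g : (forall k, (k <= N)%N -> f k = g k) -> bern N p f = bern N p g.
Proof.
elim: N f g => [|N ih] f g fg /=; first exact: fg.
by rewrite (ih (fun k => f k.+1) (fun k => g k.+1)) ?(ih f g) // => k kN; apply: fg => //; apply: leqW.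
Qed.

Lemma bern_lin N p a f g : bern N p (fun k => a * f k + g k) = a * bern N p f + bern N p g.
Proof. by elim: N f g => [//|N ih] f g /=; rewrite !ih; ring. Qed.

Lemma bern_le N p f g : 0 <= p <= 1 -> (forall k, (k <= N)%N -> f k <= g k) -> bern N p f <= bern N p g.
Proof.
case/andP=> p0 p1; elim: N f g => [|N ih] f g fg /=; first exact: fg.
apply: lerD; apply: ler_wpM2l; rewrite ?subr_ge0 //; apply: ih => k kN; apply: fg => //.
exact: leqW.
Qed.

Lemma bern_cst N p c : bern N p (fun=> c) = c.
Proof. by elim: N => [//|N ih] /=; rewrite ih; ring. Qed.

(** Binomial variance plus squared bias. *)
Lemma bern_sqr N p a : bern N p (fun k => (k%:R - a) ^+ 2) = N%:R * p * (1 - p) + (N%:R * p - a) ^+ 2.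
Proof.
elim: N a => [|N ih] a /=; first by rewrite mulr0n; ring.
rewrite (_ : (fun k : nat => (k.+1%:R - a) ^+ 2) = (fun k => (k%:R - (a - 1)) ^+ 2)); last first.
  by apply/funext => k; rewrite -natr1; ring.
by rewrite !ih -natr1; ring.
Qed.

Lemma bern_dist N p f g e : 0 <= p <= 1 -> (forall k, (k <= N)%N -> `|f k - g k| <= e k) ->
  `|bern N p f - bern N p g| <= bern N p e.
Proof.
move=> p01 h.
have -> : bern N p f - bern N p g = bern N p (fun k => f k - g k).
  rewrite (@eq_bern N p (fun k => f k - g k) (fun k => (- 1) * g k + f k)) ?bern_lin; last by move=> k _; ring.
  by ring.
rewrite ler_norml; apply/andP; split.
  have -> : - bern N p e = bern N p (fun k => - e k).
    rewrite (@eq_bern N p (fun k => - e k) (fun k => (- 1) * e k + 0)); last by move=> k _; ring.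
    by rewrite bern_lin bern_cst; ring.
  by apply: bern_le => // k /h; rewrite ler_norml => /andP[].
by apply: bern_le => // k /h; rewrite ler_norml => /andP[].
Qed.

(* Bernstein polynomials in p = (1 + sin u) / 2 sample at k / N, that is at u = [node N k]. *)
Definition node N (k : nat) : R := asin (2 * k%:R / N%:R - 1).

Lemma node_range N k : (0 < N)%N -> (k <= N)%N -> (@Order.le _ R (-1) (2 * k%:R / N%:R - 1)) && (2 * k%:R / N%:R - 1 <= 1 :> R).
Proof.
move=> N0 kN; have Np : 0 < N%:R :> R by rewrite ltr0n.
have h : (k%:R : R) / N%:R <= 1 by rewrite ler_pdivrMr // mul1r ler_nat.
have h0 : 0 <= (k%:R : R) / N%:R by rewrite divr_ge0.
by rewrite -mulrA; lra.
Qed.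

Lemma sin_node N k : (0 < N)%N -> (k <= N)%N -> sin (node N k) = 2 * k%:R / N%:R - 1.
Proof. by move=> N0 kN; rewrite /node asinK // in_itv /= node_range. Qed.

Lemma node_box N k : (0 < N)%N -> (k <= N)%N -> `|node N k| <= pi / 2.
Proof.
move=> N0 kN; have h := node_range N0 kN.
by rewrite ler_norml asin_geNpi2 // asin_lepi2.
Qed.

(* sin u - sin v = 2 cos((u+v)/2) sin((u-v)/2), and cos((u+v)/2) >= sin((u-v)/2) on the box. *)
Lemma sin_gap (u v : R) : `|u| <= pi / 2 -> `|v| <= pi / 2 -> v <= u ->
  2 * sin ((u - v) / 2) ^+ 2 <= sin u - sin v.
Proof.
rewrite !ler_norml => /andP[u1 u2] /andP[v1 v2] vu.
pose w := (u - v) / 2; pose c := (u + v) / 2.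
have -> : sin u - sin v = 2 * (cos c * sin w).
  have -> : u = c + w by rewrite /c /w; field.
  have -> : v = c - w by rewrite /c /w; field.
  by rewrite sinD sinB; ring.
have w0 : 0 <= w by rewrite /w; lra.
have wp : w <= pi / 2 by rewrite /w; lra.
have pp := pi_gt0 R.
have sw : 0 <= sin w by apply: sin_ge0_pi; lra.
rewrite ler_wpM2l // expr2 ler_wpM2r //.
rewrite -[sin w]cosBpihalf -cosN opprB -(cos_norm c).
have cw : `|c| <= pi / 2 - w by rewrite ler_norml /c /w; lra.
have c0 : 0 <= `|c| by [].
move: cw; rewrite le_eqVlt => /orP[/eqP->//|cw].
apply: ltW; rewrite ltr_cos // in_itv /=; apply/andP; split; lra.
Qed.

(** Injectivity of the sine on [-pi/2, pi/2] made quantitative: Chebyshev's inequality controls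
    distances of sines, while continuity speaks of distances of points. *)
Lemma sin_modulus (e : R) : 0 < e -> exists2 eta : R, 0 < eta &
  forall u v : R, `|u| <= pi / 2 -> `|v| <= pi / 2 -> e <= `|u - v| -> eta <= `|sin u - sin v|.
Proof.
move=> e0; have pp := pi_gt0 R; have pp2 : 0 < pi / 2 :> R by rewrite divr_gt0.
(* The cap keeps [k] where the sine increases even when [e] is large. *)
pose k : R := Num.min (e / 2) (pi / 2).
have k0 : 0 < k by rewrite lt_min pp2 divr_gt0.
have kp : k <= pi / 2 by rewrite ge_min lexx orbT.
have ke : k <= e / 2 by rewrite ge_min lexx.
have sk : 0 < sin k by apply: sin_gt0_pi; lra.
exists (2 * sin k ^+ 2) => [|u v]; first by rewrite mulr_gt0 // exprn_gt0.
wlog vu : u v / v <= u.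
  move=> H ub vb; have [vu|uv] := leP v u; first exact: H.
  by rewrite distrC => h; rewrite distrC; apply: H => //; apply: ltW.
move=> ub vb h.
have g := sin_gap ub vb vu.
apply: le_trans (ler_norm _); apply: le_trans g.
rewrite ger0_norm ?subr_ge0 // in h.
move: ub vb; rewrite !ler_norml => /andP[u1 u2] /andP[v1 v2].
have kw : k <= (u - v) / 2 by lra.
have wp : (u - v) / 2 <= pi / 2 by lra.
have sw : sin k <= sin ((u - v) / 2).
  move: kw; rewrite le_eqVlt => /orP[/eqP->//|kw].
  apply: ltW; rewrite ltr_sin // in_itv /=; apply/andP; split; lra.
by rewrite ler_wpM2l // lerXn2r ?nnegrE ?(ltW sk) // (le_trans (ltW sk)).
Qed.

End Bernstein.

(** * Bernstein smoothing, one coordinate at a time *)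

Section TrigPolynomials.
Variables (R : realType) (d : nat).
Implicit Types (f g q : 'rV[R]_d -> R) (x : 'rV[R]_d).

(** Generated by shifted cosines and linear combinations, so that convergence on cosines extends to
    all of them by induction. *)
Inductive trig_poly : ('rV[R]_d -> R) -> Prop :=
| TrigCos (s : 'rV[R]_d) (b : R) : trig_poly (fun x => cos ((x *m s^T) ord0 ord0 + b))
| TrigLin (a : R) f g : trig_poly f -> trig_poly g -> trig_poly (fun x => a * f x + g x).

Lemma trig_ext f g : trig_poly f -> (forall x, g x = f x) -> trig_poly g.
Proof. by move=> tf gf; rewrite (_ : g = f) //; apply/funext. Qed.

Lemma trig_cst c : trig_poly (fun=> c).
Proof.
apply: trig_ext (TrigLin c (TrigCos 0 0) (TrigCos 0 (pi / 2))) _ => x.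
by rewrite trmx0 mulmx0 !mxE !add0r cos0 cos_pihalf mulr1 addr0.
Qed.

Lemma trigD f g : trig_poly f -> trig_poly g -> trig_poly (fun x => f x + g x).
Proof. by move=> tf tg; apply: trig_ext (TrigLin 1 tf tg) _ => x; rewrite mul1r. Qed.

Lemma trigM f g : trig_poly f -> trig_poly g -> trig_poly (fun x => f x * g x).
Proof.
elim=> [s b|a f1 f2 _ ih1 _ ih2] tg; last first.
  by apply: trig_ext (TrigLin a (ih1 tg) (ih2 tg)) _ => x; ring.
elim: tg => [s' b'|a g1 g2 _ ih1 _ ih2]; last first.
  by apply: trig_ext (TrigLin a ih1 ih2) _ => x; ring.
apply: trig_ext (TrigLin (1 / 2) (TrigCos (s + s') (b + b'))
  (TrigLin (1 / 2) (TrigCos (s - s') (b - b')) (trig_cst 0))) _ => x.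
have e1 : (x *m (s + s')^T) ord0 ord0 = (x *m s^T) ord0 ord0 + (x *m s'^T) ord0 ord0.
  by rewrite linearD mulmxDr mxE.
have e2 : (x *m (s - s')^T) ord0 ord0 = (x *m s^T) ord0 ord0 - (x *m s'^T) ord0 ord0.
  by rewrite linearB mulmxBr mxE [X in _ + X]mxE.
rewrite e1 e2; move: ((x *m s^T) ord0 ord0) ((x *m s'^T) ord0 ord0) => u v.
rewrite (_ : u + v + (b + b') = (u + b) + (v + b')); last by ring.
rewrite (_ : u - v + (b - b') = (u + b) - (v + b')); last by ring.
by move: (u + b) (v + b') => y z; rewrite cosD cosB; field.
Qed.

Lemma trig_sin i (c : R) : trig_poly (fun x => sin (x ord0 i * c)).
Proof.
apply: trig_ext (TrigCos (\row_j (c *+ (j == i))) (- (pi / 2))) _ => x.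
rewrite cosBpihalf; congr sin; rewrite mxE (bigD1 i) //= big1 ?addr0 => [|j ji].
  by rewrite !mxE eqxx.
by rewrite !mxE (negbTE ji) mulr0n mulr0.
Qed.

Lemma trig_bounded_continuous f : trig_poly f -> exists M, bounded_continuous M f.
Proof.
elim=> [s b|a g h _ [M1 [c1 b1]] _ [M2 [c2 b2]]].
  exists 1; split=> [x|x]; last exact: cos_max.
  suff h : continuous (fun x : 'rV[R]_d => (x *m s^T) ord0 ord0 + b).
    exact: (continuous_comp (h x) (@continuous_cos R _)).
  rewrite (_ : (fun y : 'rV[R]_d => _) = (fun y => \sum_j y ord0 j * s ord0 j + b)); last first.
    by apply/funext => y; rewrite mxE; congr (_ + _); apply: eq_bigr => j _; rewrite mxE.
  move=> {}x; apply: (@continuousD _ _ _ (fun y : 'rV[R]_d => \sum_j y ord0 j * s ord0 j) (cst b)).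
    apply: (continuous_big (op := +%R)) => [|j _ {}x]; first exact: add_continuous.
    by apply: (@continuousM _ _ (fun y : 'rV[R]_d => y ord0 j) (cst (s ord0 j))); [exact: coord_continuous|exact: cst_continuous].
  exact: cst_continuous.
exists (`|a| * M1 + M2); split=> x.
  by apply: (@continuousD _ _ _ (fun y => a * g y) h); [apply: (@continuousM _ _ (cst a) g); [exact: cst_continuous | exact: c1] | exact: c2].
by apply: normD_le => //; apply: normM_le.
Qed.

Definition upd x (i : 'I_d) (v : R) : 'rV[R]_d := \row_j (if j == i then v else x ord0 j).

Definition box (T : R) x : Prop := forall i, `|x ord0 i| <= T.

Variables (N : nat) (tau : R).
Hypotheses (N_gt0 : (0 < N)%N) (tau_gt0 : 0 < tau).

Definition prob x (i : 'I_d) : R := (1 + sin (x ord0 i * tau^-1)) / 2.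

Definition smooth (i : 'I_d) f x : R := bern N (prob x i) (fun k => f (upd x i (tau * node R N k))).

Definition smooths (l : seq 'I_d) f : 'rV[R]_d -> R := foldl (fun g i => smooth i g) f l.

Lemma prob01 x i : 0 <= prob x i <= 1.
Proof.
have := sin_geN1 (x ord0 i * tau^-1); have := sin_le1 (x ord0 i * tau^-1).
by rewrite /prob; lra.
Qed.

Lemma upd_box x i k : (k <= N)%N -> box (tau * (pi / 2)) x -> box (tau * (pi / 2)) (upd x i (tau * node R N k)).
Proof.
move=> kN bx j; rewrite mxE; case: eqP => _; last exact: bx.
by rewrite normrM gtr0_norm // ler_wpM2l ?(ltW tau_gt0) // node_box.
Qed.

Lemma smooth_lin i q f g : (forall x v, q (upd x i v) = q x) ->
  smooth i (fun x => q x * f x + g x) = (fun x => q x * smooth i f x + smooth i g x).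
Proof.
move=> qi; apply/funext => x; rewrite /smooth -bern_lin; apply: eq_bern => k _.
by rewrite qi.
Qed.

(** Lets the probability of a coordinate smoothed earlier come out as a coefficient in
    [trig_smooths]. *)
Lemma smooths_lin l q f g : (forall i, i \in l -> forall x v, q (upd x i v) = q x) ->
  smooths l (fun x => q x * f x + g x) = (fun x => q x * smooths l f x + smooths l g x).
Proof.
elim: l f g => [//|i l ih] f g qi; rewrite /smooths /= smooth_lin; last first.
  by apply: qi; rewrite inE eqxx.
by apply: ih => j jl; apply: qi; rewrite inE jl orbT.
Qed.

(** [bern] is a mean, so a bound on a set stable under sampling survives. The set is the whole space
    for the global bound on the approximant, and the box for the error. *)
Lemma smooth_bound (S : 'rV[R]_d -> Prop) i f (e : R) :
  (forall x k, (k <= N)%N -> S x -> S (upd x i (tau * node R N k))) ->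
  (forall x, S x -> `|f x| <= e) -> forall x, S x -> `|smooth i f x| <= e.
Proof.
move=> Su fe x Sx; rewrite /smooth -(bern_cst N (prob x i) e) -[X in `|X|]subr0.
rewrite -[X in _ - X](bern_cst N (prob x i) 0).
apply: bern_dist; first exact: prob01.
by move=> k kN; rewrite subr0; apply/fe/Su.
Qed.

Lemma smooths_bound (S : 'rV[R]_d -> Prop) l f (e : R) :
  (forall i x k, (k <= N)%N -> S x -> S (upd x i (tau * node R N k))) ->
  (forall x, S x -> `|f x| <= e) -> forall x, S x -> `|smooths l f x| <= e.
Proof.
move=> Su; elim: l f => [//|i l ih] f fe; rewrite /smooths /=; apply: ih.
by apply: (@smooth_bound S) => // x k; apply: Su.
Qed.

Definition depends (l : seq 'I_d) f : Prop :=
  forall x y : 'rV[R]_d, (forall j, j \in l -> x ord0 j = y ord0 j) -> f x = f y.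

(** After smoothing, coordinate [i] enters only through [prob x i], an affine function of a sine.
    Unfolding the binomial mean gives products of such factors with smoothings in the other
    coordinates. *)
Lemma trig_smooths l f : uniq l -> depends l f -> trig_poly (smooths l f).
Proof.
elim: l f => [|i l ih] f.
  by move=> _ df; apply: trig_ext (trig_cst (f 0)) _ => x; apply: df.
case/andP=> il ul df; rewrite /smooths /=.
have tp : trig_poly (fun x => prob x i).
  apply: trig_ext (TrigLin (1 / 2) (trig_sin i tau^-1) (trig_cst (1 / 2))) _ => x.
  by rewrite /prob; field.
have dk k : depends l (fun x => f (upd x i (tau * node R N k))).
  move=> x y xy; apply: df => j; rewrite inE !mxE; case: eqP => //= _; exact: xy.
have inv (F : R -> R) j : j \in l -> forall x v, F (prob (upd x j v) i) = F (prob x i).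
  move=> jl x v; rewrite /prob mxE; case: eqP => // ij; by rewrite -ij (negbTE il) in jl.
(* General coefficients [phi k] allow the index shift that each binomial trial makes. *)
suff h M (phi : nat -> 'rV[R]_d -> R) : (forall k, depends l (phi k)) ->
    trig_poly (smooths l (fun x => bern M (prob x i) (fun k => phi k x))).
  by apply: h.
elim: M phi => [|M ihM] phi dphi /=; first exact: ih.
have -> : (fun x => prob x i * bern M (prob x i) (fun k => phi k.+1 x) +
      (1 - prob x i) * bern M (prob x i) (fun k => phi k x)) =
   (fun x => prob x i * bern M (prob x i) (fun k => phi k.+1 x) +
      ((1 - prob x i) * bern M (prob x i) (fun k => phi k x) + 0)).
  by apply/funext => x; rewrite addr0.
rewrite smooths_lin; last by move=> j jl x v; apply: (inv id).
apply: trigD; first by apply: trigM => //; apply: ihM => k; apply: dphi.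
rewrite smooths_lin; last by move=> j jl x v; apply: (inv (fun p => 1 - p)).
apply: trigD; last by apply: ih => // x y _.
apply: trigM; last exact: ihM.
by apply: trig_ext (TrigLin (- 1) tp (trig_cst 1)) _ => x; ring.
Qed.

(** Bernstein's argument: nodes closer than [dl] contribute at most [e]. At the others the sines
    differ by 2|k - Np|/N >= eta, so the trivial bound 2M is at most 8M (k - Np)^2 / (eta N)^2,
    whose mean is governed by the binomial variance. *)
Lemma smooth_error i f (M e eta dl : R) x :
  (forall y, `|f y| <= M) -> 0 <= e -> 0 < eta -> 
  (forall u v : R, `|u| <= pi / 2 -> `|v| <= pi / 2 -> dl / tau <= `|u - v| -> eta <= `|sin u - sin v|) ->
  box (tau * (pi / 2)) x ->
  (forall v, `|v - x ord0 i| < dl -> `|f (upd x i v) - f x| <= e) ->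
  `|smooth i f x - f x| <= e + 8 * M / eta ^+ 2 / N%:R.
Proof.
move=> fM e0 eta0 hs bx fe.
have M0 : 0 <= M by apply: le_trans (fM x).
have Np : 0 < N%:R :> R by rewrite ltr0n.
have Nz : N%:R != 0 :> R by rewrite gt_eqF.
have ez : eta != 0 by rewrite gt_eqF.
have ti : 0 < tau^-1 by rewrite invr_gt0.
have p01 := prob01 x i; have [p0 p1] := andP p01.
pose c := 8 * M / eta ^+ 2 / N%:R ^+ 2.
have c0 : 0 <= c by rewrite /c !divr_ge0 ?mulr_ge0 ?exprn_ge0 // ltW.
rewrite /smooth -[f x](bern_cst N (prob x i)).
apply: le_trans (bern_dist (e := fun k => c * (k%:R - N%:R * prob x i) ^+ 2 + e) p01 _) _; last first.
  rewrite bern_lin bern_sqr bern_cst subrr expr0n addr0 addrC lerD2l.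
  have -> : c * (N%:R * prob x i * (1 - prob x i)) = 8 * M / eta ^+ 2 / N%:R * (prob x i * (1 - prob x i)).
    by rewrite /c; field; rewrite Nz ez.
  rewrite ler_piMr ?divr_ge0 ?mulr_ge0 ?exprn_ge0 ?(ltW eta0) //.
  by rewrite mulr_ile1 ?subr_ge0 // gerBl.
move=> k kN.
have [h|h] := ltP `|tau * node R N k - x ord0 i| dl.
  by apply: le_trans (fe _ h) _; rewrite lerDr mulr_ge0 ?sqr_ge0.
have xb : `|x ord0 i * tau^-1| <= pi / 2.
  by rewrite normrM (gtr0_norm ti) ler_pdivrMr // mulrC; apply: bx.
have := hs _ _ (node_box R N_gt0 kN) xb _.
have -> : node R N k - x ord0 i * tau^-1 = (tau * node R N k - x ord0 i) * tau^-1.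
  by field; rewrite gt_eqF.
rewrite normrM (gtr0_norm ti) => /(_ (ler_wpM2r (ltW ti) h)) h2.
rewrite sin_node // in h2.
have e2 : 2 * k%:R / N%:R - 1 - sin (x ord0 i * tau^-1) = 2 * (k%:R - N%:R * prob x i) / N%:R.
  by rewrite /prob; field.
rewrite e2 in h2.
have h3 : eta ^+ 2 <= (2 * (k%:R - N%:R * prob x i) / N%:R) ^+ 2.
  by rewrite -[leRHS]real_normK ?num_real // lerXn2r ?nnegrE ?(ltW eta0).
apply: (@le_trans _ _ (2 * M)).
  by rewrite mulr2n mulrDl mul1r; apply: normB_le.
rewrite -[leLHS]addr0; apply: lerD => //.
have -> : c * (k%:R - N%:R * prob x i) ^+ 2 = (2 * M / eta ^+ 2) * (2 * (k%:R - N%:R * prob x i) / N%:R) ^+ 2.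
  by rewrite /c; field; rewrite Nz ez.
apply: (@le_trans _ _ (2 * M / eta ^+ 2 * eta ^+ 2)); first by rewrite mulfVK // expf_neq0.
by rewrite ler_wpM2l // divr_ge0 ?mulr_ge0 ?exprn_ge0 ?(ltW eta0).
Qed.

(** Telescoping over the coordinates: later averages do not enlarge the error of the first one. *)
Lemma smooths_error l f (e : R) : (forall i x, box (tau * (pi / 2)) x -> `|smooth i f x - f x| <= e) ->
  forall x, box (tau * (pi / 2)) x -> `|smooths l f x - f x| <= (size l)%:R * e.
Proof.
move=> he; elim: l => [|i l ih] x bx; first by rewrite /smooths /= subrr normr0 mul0r.
have -> : smooths (i :: l) f x = 1 * smooths l (fun y => smooth i f y - f y) x + smooths l f x.
  rewrite /smooths /= -/(smooths l (smooth i f)) -/(smooths l f).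
  rewrite -[RHS]/((fun x => (fun=> 1) x * smooths l (fun y => smooth i f y - f y) x + smooths l f x) x).
  rewrite -(@smooths_lin l (fun=> 1)) //; congr smooths; apply/funext => y; ring.
rewrite mul1r -addrA -[size _]/(size l).+1 -natr1 mulrDl mul1r addrC; apply: normD_le; last first.
  apply: (@smooths_bound (box (tau * (pi / 2)))) => // [j y k kN|y]; [exact: upd_box | exact: he].
exact: ih.
Qed.

End TrigPolynomials.

(** * Approximation on a box and control of the tail *)

Section Approximation.
Variables (R : realType) (d : nat).
Implicit Types (f g p : 'rV[R]_d -> R) (x : 'rV[R]_d).

Lemma box_compact (T : R) : compact [set x : 'rV[R]_d | box T x].
Proof.
have := @rV_compact R^o d (fun=> [set` `[- T, T]]) (fun=> @segment_compact R (- T) T).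
by congr compact; apply/seteqP; split=> x /= h i; have := h i; rewrite in_itv /= ler_norml.
Qed.

Lemma box_modulus f (T e : R) : continuous f -> 0 < e -> exists2 dl : R, 0 < dl &
  forall x, box T x -> forall i v, `|v - x ord0 i| < dl -> `|f (upd x i v) - f x| <= e.
Proof.
move=> cf e0.
have cov := (compact_near_coveringP _).1 (@box_compact T).
pose Q (dl : R) x := forall i v, `|v - x ord0 i| < dl -> `|f (upd x i v) - f x| <= e.
have : \forall dl \near (0 : R)^'+, [set x | box T x] `<=` Q dl.
  apply: cov => x _.
  have /cvgrPdist_lt/(_ (e / 2)) := cf x; rewrite divr_gt0 // => /(_ isT) /nbhs_ballP[r /= r0 hr].
  have r2 : 0 < r / 2 by rewrite divr_gt0.
  exists (ball x (r / 2), [set dl : R | dl < r / 2]) => /=.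
    split; first exact: nbhsx_ballx.
    exact: nbhs_right_lt.
  case=> y dl [/= [_ hy] hd] i v hv.
  have b1 : ball x r y.
    by split=> // a b; apply: le_ball (hy a b); lra.
  have b2 : ball x r (upd y i v).
    split=> // a b; rewrite ord1 mxE; case: eqP => [->|_]; last by have := b1.2 ord0 b.
    have := hy ord0 i; rewrite /ball /= => h.
    have -> : x ord0 i - v = (x ord0 i - y ord0 i) - (v - y ord0 i) by ring.
    apply: le_lt_trans (ler_normB _ _) _.
    have {}hv : `|v - y ord0 i| < r / 2 by apply: lt_trans hv hd.
    by rewrite [r]splitr ltrD.
  have h1 := hr _ b1; have h2 := hr _ b2.
  have -> : f (upd y i v) - f y = (f x - f y) - (f x - f (upd y i v)) by ring.
  apply: le_trans (ler_normB _ _) _.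
  by rewrite [e]splitr; apply/ltW/ltrD.
move=> H; have [dl [d0 hd]] : exists dl : R, 0 < dl /\ [set x | box T x] `<=` Q dl.
  near (0 : R)^'+ => dl; exists dl; split; first by near: dl; apply: nbhs_right_gt.
  by near: dl.
by exists dl => // x bx; apply: hd.
Unshelve. all: by end_near. Qed.

(** The approximant averages values of [f], so the bound [M] holds on the whole space; outside the
    box nothing more is needed. *)
Lemma trig_approx f (M T e : R) : continuous f -> (forall x, `|f x| <= M) -> 0 < T -> 0 < e ->
  exists p, [/\ trig_poly p, forall x, `|p x| <= M & forall x, box T x -> `|p x - f x| <= e].
Proof.
move=> cf fM T0 e0; have pp := pi_gt0 R.
have p2 : 0 < pi / 2 :> R by rewrite divr_gt0.
have M0 : 0 <= M by apply: le_trans (fM 0).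
(* With this scale the box reached by the nodes is exactly that of half-width [T]. *)
pose tau := T / (pi / 2); have tau0 : 0 < tau by rewrite divr_gt0.
have tauT : tau * (pi / 2) = T by rewrite /tau mulfVK // gt_eqF.
(* Each of the [d] coordinates costs at most 2 [e1]; the successor avoids dividing by 0 when [d] is
   0. *)
pose e1 := e / (2 * d.+1%:R); have e10 : 0 < e1 by rewrite divr_gt0 // mulr_gt0.
have [dl dl0 hdl] := box_modulus T cf e10.
have [eta eta0 heta] := sin_modulus (divr_gt0 dl0 tau0).
pose B := 8 * M / eta ^+ 2.
have B0 : 0 <= B by rewrite /B; apply: divr_ge0; [apply: mulr_ge0 | apply: sqr_ge0].
pose N := (Num.truncn (B / e1)).+1.
have BN : B / N%:R <= e1.
  rewrite ler_pdivrMr ?ltr0n // mulrC -ler_pdivrMr //.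
  by apply/ltW; apply: truncnS_gt.
exists (smooths N tau (enum 'I_d) f); split.
- apply: trig_smooths; first exact: enum_uniq.
  move=> x y xy; congr f; apply/rowP => j; apply: xy; exact: mem_enum.
- move=> x; apply: (@smooths_bound _ _ N tau (fun=> True)) => // y _; exact: fM.
move=> x; rewrite -tauT => bx.
apply: le_trans (@smooths_error _ _ N tau _ tau0 (enum 'I_d) f (e1 + e1) _ x bx) _ => //.
  move=> i y by_; apply: le_trans (@smooth_error _ _ N tau _ tau0 i f M e1 eta dl y fM (ltW e10) eta0 heta by_ _) _ => //.
    by apply: hdl; rewrite -tauT.
  by rewrite lerD2l.
rewrite size_enum_ord.
have -> : e = d.+1%:R * (e1 + e1).
  have : d.+1%:R != 0 :> R by rewrite pnatr_eq0.
  by rewrite /e1; move: (d.+1%:R : R) => D Dz; field.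
by apply: ler_wpM2r; [rewrite addr_ge0 // ltW | rewrite ler_nat].
Qed.

(** A bounded continuous substitute for the indicator of leaving the box: at least 1 outside the box
    of half-width k + 1, controlled by second moments under the approximating laws, and tending to 0
    pointwise, which suffices under the Gaussian law. *)
Definition tail (k : nat) x : R := \sum_i 2 * x ord0 i ^+ 2 / (k.+1%:R ^+ 2 + x ord0 i ^+ 2).

Lemma tail_den (k : nat) (y : R) : 0 < k.+1%:R ^+ 2 + y ^+ 2.
Proof. by rewrite ltr_pwDl ?sqr_ge0 // exprn_gt0. Qed.

Lemma tail_term_ge0 (k : nat) (y : R) : 0 <= 2 * y ^+ 2 / (k.+1%:R ^+ 2 + y ^+ 2).
Proof. by apply: divr_ge0; [apply: mulr_ge0 => //; apply: sqr_ge0 | apply/ltW/tail_den]. Qed.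

Lemma tail_term_le (k : nat) (y : R) : 2 * y ^+ 2 / (k.+1%:R ^+ 2 + y ^+ 2) <= 2 * y ^+ 2 / k.+1%:R.
Proof.
apply: ler_wpM2l; first by apply: mulr_ge0 => //; apply: sqr_ge0.
rewrite lef_pV2 ?posrE ?tail_den //.
apply: (@le_trans _ _ (k.+1%:R ^+ 2)); last by rewrite lerDl sqr_ge0.
by rewrite expr2 ler_peMr // ler1n.
Qed.

Lemma tail_ge1 k x : ~ box k.+1%:R x -> 1 <= tail k x.
Proof.
move=> nb; have [i hi] : exists i, k.+1%:R < `|x ord0 i|.
  apply: contrapT => nh; apply: nb => i; rewrite leNgt; apply/negP => h; by apply: nh; exists i.
rewrite /tail (bigD1 i) //=.
apply: (@le_trans _ _ (2 * x ord0 i ^+ 2 / (k.+1%:R ^+ 2 + x ord0 i ^+ 2))).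
  rewrite ler_pdivlMr ?tail_den // mul1r.
  have : k.+1%:R ^+ 2 <= x ord0 i ^+ 2.
    by rewrite -[leRHS]real_normK ?num_real // lerXn2r ?nnegrE // ltW.
  by lra.
by rewrite lerDl sumr_ge0 // => j _; apply: tail_term_ge0.
Qed.

Lemma tail_bounded k x : `|tail k x| <= 2 * d%:R.
Proof.
rewrite ger0_norm ?sumr_ge0 // => [|j _]; last exact: tail_term_ge0.
apply: (@le_trans _ _ (\sum_(i < d) (2 : R))).
  apply: ler_sum => i _; rewrite ler_pdivrMr ?tail_den //.
  by rewrite ler_wpM2l // lerDr sqr_ge0.
by rewrite sumr_const card_ord mulr_natr.
Qed.

Lemma tail_le k x : tail k x <= (\sum_i 2 * x ord0 i ^+ 2) / k.+1%:R.
Proof. by rewrite mulr_suml; apply: ler_sum => i _; apply: tail_term_le. Qed.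

Lemma tail_cvg x : tail ^~ x @ \oo --> (0 : R).
Proof.
apply: (@squeeze_cvgr _ _ _ _ (fun=> 0) (fun k => (\sum_i 2 * x ord0 i ^+ 2) * harmonic k)).
- apply: nearW => k; rewrite tail_le andbT.
  by rewrite sumr_ge0 // => j _; apply: tail_term_ge0.
- exact: cvg_cst.
- rewrite -[X in _ --> X](mulr0 (\sum_i 2 * x ord0 i ^+ 2)).
  by apply: cvgMr; exact: cvg_harmonic.
Qed.

Lemma tail_continuous k : continuous (tail k).
Proof.
apply: (continuous_big (op := +%R)) => [|i _ x]; first exact: add_continuous.
have cs : continuous (fun y : 'rV[R]_d => y ord0 i ^+ 2).
  move=> y; apply: (@continuousM _ _ (fun y : 'rV[R]_d => y ord0 i) (fun y : 'rV[R]_d => y ord0 i)); exact: coord_continuous.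
apply: (@continuousM _ _ (fun y : 'rV[R]_d => 2 * y ord0 i ^+ 2) (fun y => (k.+1%:R ^+ 2 + y ord0 i ^+ 2)^-1)).
  by apply: (@continuousM _ _ (cst 2) (fun y : 'rV[R]_d => y ord0 i ^+ 2)); [exact: cst_continuous | exact: cs].
apply: (@continuousV _ _ (fun y : 'rV[R]_d => k.+1%:R ^+ 2 + y ord0 i ^+ 2)); first by rewrite gt_eqF // tail_den.
by apply: (@continuousD _ _ _ (fun _ : 'rV[R]_d => k.+1%:R ^+ 2 : R) (fun y : 'rV[R]_d => y ord0 i ^+ 2)); [exact: cst_continuous | exact: cs].
Qed.

Lemma approx_tail f p (M e : R) k : (forall x, `|f x| <= M) -> (forall x, `|p x| <= M) -> 0 <= e ->
  (forall x, box k.+1%:R x -> `|p x - f x| <= e) -> forall x, `|p x - f x| <= 2 * M * tail k x + e.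
Proof.
move=> fM pM e0 he x; have M0 : 0 <= M by apply: le_trans (fM x).
have [bx|nb] := pselect (box k.+1%:R x).
  apply: le_trans (he x bx) _; rewrite lerDr !mulr_ge0 // sumr_ge0 // => j _; exact: tail_term_ge0.
apply: (@le_trans _ _ (2 * M * 1)).
  by rewrite mulr1 mulr2n mulrDl mul1r; apply: normB_le.
rewrite -[leLHS]addr0; apply: lerD => //.
by apply: ler_wpM2l; [rewrite mulr_ge0 | exact: tail_ge1].
Qed.

End Approximation.

(** * Convergence in distribution *)

Section LimitTheorem.
Variables (R : realType) (d : nat) (A : 'M[R]_d).
Implicit Types (f g p : 'rV[R]_d -> R) (x : 'rV[R]_d).
Variables (L : nat -> ('rV[R]_d -> R) -> R) (m0 : nat) (C : R).
Hypothesis L_lin : forall m a f g, (m0 <= m)%N -> L m (fun x => a * f x + g x) = a * L m f + L m g.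
Hypothesis L_le : forall m f g, (m0 <= m)%N -> (forall x, f x <= g x) -> L m f <= L m g.
Hypothesis L_cst : forall m c, (m0 <= m)%N -> L m (fun=> c) = c.
Hypothesis L_tight : forall m i, (m0 <= m)%N -> L m (fun x => x ord0 i ^+ 2) <= C.
Hypothesis L_cos : forall (s : 'rV[R]_d) b, (fun m => L m (fun x => cos ((x *m s^T) ord0 ord0 + b))) @ \oo -->
  (expR (- (s *m (A *m A^T) *m s^T) ord0 ord0 / 2) * cos b : R).

Local Notation G := (fun f => gauss_expect (fun w => f (w *m A^T))).

Lemma linear_map_continuous : continuous (fun w : 'rV[R]_d => w *m A^T).
Proof.
apply: rV_continuous => j.
rewrite (_ : (fun w : 'rV[R]_d => _) = (fun w => \sum_k w ord0 k * A^T k j)); last first.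
  by apply/funext => w; rewrite mxE.
apply: (continuous_big (op := +%R)) => [|k _ x]; first exact: add_continuous.
by apply: (@continuousM _ _ (fun y : 'rV[R]_d => y ord0 k) (cst (A^T k j))); [exact: coord_continuous|exact: cst_continuous].
Qed.

Lemma bounded_continuous_lin M f : bounded_continuous M f -> bounded_continuous M (fun w => f (w *m A^T)).
Proof.
case=> cf fM; split=> // x.
by apply: (@continuous_comp _ _ _ (fun w : 'rV[R]_d => w *m A^T) f); [exact: linear_map_continuous | exact: cf].
Qed.

Lemma bounded_continuousW M M' f : M <= M' -> @bounded_continuous R d M f -> bounded_continuous M' f.
Proof. by move=> h [cf fM]; split=> // x; apply: le_trans (fM x) h. Qed.

Lemma bounded_continuousD M1 M2 a f g : bounded_continuous M1 f -> bounded_continuous M2 g ->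
  @bounded_continuous R d (`|a| * M1 + M2) (fun x => a * f x + g x).
Proof.
case=> [c1 b1] [c2 b2]; split=> x; last by apply: normD_le => //; apply: normM_le.
apply: (@continuousD _ _ _ (fun y => a * f y) g); last exact: c2.
by apply: (@continuousM _ _ (cst a) f); [exact: cst_continuous | exact: c1].
Qed.

(** A frequency [s] read through [A] becomes the frequency [s *m A], whose squared norm depends on
    [A] only through [A *m A^T]: any square root of the covariance serves. *)
Lemma trig_poly_limit p : trig_poly p -> (fun m => L m p) @ \oo --> (G p : R).
Proof.
elim=> [s b|a f g tf cf tg cg].
  have -> : G (fun x => cos ((x *m s^T) ord0 ord0 + b)) = expR (- (s *m (A *m A^T) *m s^T) ord0 ord0 / 2) * cos b.
    rewrite (_ : s *m (A *m A^T) *m s^T = (s *m A) *m (s *m A)^T); last by rewrite trmx_mul !mulmxA.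
    rewrite -gauss_expect_cos; congr gauss_expect; apply/funext => w.
    by rewrite trmx_mul !mulmxA.
  exact: L_cos.
have [M1 b1] := trig_bounded_continuous tf; have [M2 b2] := trig_bounded_continuous tg.
pose M := Num.max M1 M2.
have {}b1 : bounded_continuous M f by apply: bounded_continuousW b1; rewrite le_max lexx.
have {}b2 : bounded_continuous M g by apply: bounded_continuousW b2; rewrite le_max lexx orbT.
rewrite (gauss_expect_lin a (bounded_continuous_lin b1) (bounded_continuous_lin b2)).
have h : (fun m => a * L m f + L m g) @ \oo --> (a * G f + G g : R).
  by apply: cvgD => //; apply: cvgMr.
apply: cvg_trans h; apply: near_eq_cvg.
by exists m0 => // m /= hm; rewrite L_lin.
Qed.

Lemma L_dist m f p h : (m0 <= m)%N -> (forall x, `|p x - f x| <= h x) -> `|L m f - L m p| <= L m h.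
Proof.
move=> hm hd.
have -> : L m f - L m p = - 1 * L m p + L m f by ring.
rewrite -L_lin // ler_norml; apply/andP; split.
  have -> : - L m h = -1 * L m h + L m (fun=> 0) by rewrite L_cst //; ring.
  by rewrite -L_lin //; apply: L_le => // x /=; have := hd x; rewrite ler_norml => /andP[]; lra.
by apply: L_le => // x /=; have := hd x; rewrite ler_norml => /andP[]; lra.
Qed.

Lemma L_sum m (F : 'I_d -> 'rV[R]_d -> R) (r : seq 'I_d) : (m0 <= m)%N ->
  L m (fun x => \sum_(i <- r) F i x) = \sum_(i <- r) L m (F i).
Proof.
move=> hm; elim: r => [|i r ih].
  rewrite big_nil (_ : (fun x : 'rV[R]_d => _) = fun=> 0) ?L_cst //.
  by apply/funext => x; rewrite big_nil.
rewrite big_cons -ih -[L m (F i)]mul1r -L_lin //; congr L.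
by apply/funext => x; rewrite big_cons mul1r.
Qed.

Lemma L_tail m k : (m0 <= m)%N -> L m (@tail R d k) <= 2 * C * d%:R / k.+1%:R.
Proof.
move=> hm; apply: le_trans (L_le hm (@tail_le R d k)) _.
have -> : (fun x : 'rV[R]_d => (\sum_i 2 * x ord0 i ^+ 2) / k.+1%:R) =
          (fun x : 'rV[R]_d => 2 / k.+1%:R * (\sum_i x ord0 i ^+ 2) + 0).
  by apply/funext => x; rewrite -mulr_sumr; ring.
rewrite L_lin // L_cst // addr0 L_sum //.
have -> : 2 * C * d%:R / k.+1%:R = 2 / k.+1%:R * (C * d%:R) by ring.
apply: ler_wpM2l; first by rewrite divr_ge0.
apply: (@le_trans _ _ (\sum_(i < d) C)); first by apply: ler_sum => i _; apply: L_tight.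
by rewrite sumr_const card_ord mulr_natr.
Qed.

(** The error is split in fifths: two for replacing [f] by a trigonometric polynomial under [L m],
    one for the limit on that polynomial, and two for the replacement under the Gaussian law. *)
Lemma limit_theorem : conv_distr_gauss (fun f m => L m f) A.
Proof.
move=> f cf [M fM]; have M0 : 0 <= M by apply: le_trans (fM 0).
apply/cvgrPdist_le => e e0.
pose e5 := e / 5; have e50 : 0 < e5 by rewrite divr_gt0.
have C0 : 0 <= `|C| by [].
have [k [k1 k2]] : exists k : nat, 2 * M * gauss_expect (fun w => @tail R d k (w *m A^T)) <= e5 /\
    2 * M * (2 * C * d%:R / k.+1%:R) <= e5.
  have bt k : bounded_continuous (2 * d%:R) (fun w => @tail R d k (w *m A^T)).
    by apply: bounded_continuous_lin; split; [exact: tail_continuous | exact: tail_bounded].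
  have b0 : @bounded_continuous R d (2 * d%:R) (fun=> 0).
    by split=> [|x]; [exact: cst_continuous | rewrite normr0 mulr_ge0].
  have t0 := (gauss_expect_cvg d (2 * d%:R)).2 _ _ bt b0 (fun x => @tail_cvg R d _).
  have g0 : gauss_expect (fun _ : 'rV[R]_d => 0) = 0 :> R.
    apply/eqP; rewrite -normr_le0; apply: (gauss_expect_cvg d 0).1.
    by split=> [|x]; [exact: cst_continuous | rewrite normr0].
  rewrite g0 in t0.
  have t1 : (fun k => 2 * M * gauss_expect (fun w => @tail R d k (w *m A^T))) @ \oo --> (0 : R).
    by rewrite -(mulr0 (2 * M)); apply: cvgMr.
  have t2 : (fun k => 2 * M * (2 * C * d%:R) * harmonic k) @ \oo --> (0 : R).
    by rewrite -(mulr0 (2 * M * (2 * C * d%:R))); apply: cvgMr; exact: cvg_harmonic.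
  move/cvgrPdist_le/(_ _ e50) : t1 => [k1 _ h1]; move/cvgrPdist_le/(_ _ e50) : t2 => [k2 _ h2].
  exists (maxn k1 k2); have := h1 (maxn k1 k2) (leq_maxl _ _); have := h2 (maxn k1 k2) (leq_maxr _ _).
  rewrite /= !sub0r !normrN /harmonic => l2 l1; split; first by apply: le_trans (ler_norm _) l1.
  by apply: le_trans (ler_norm _) _; rewrite mulrA.
have k0 : 0 < k.+1%:R :> R by [].
have [p [tp pM hp]] := trig_approx cf fM k0 e50.
have hpf := approx_tail fM pM (ltW e50) hp.
have /cvgrPdist_le/(_ _ e50)[m1 _ h1] := trig_poly_limit tp.
exists (maxn m0 m1) => // m /= hm.
have hm0 : (m0 <= m)%N by apply: leq_trans hm; apply: leq_maxl.
have hm1 : (m1 <= m)%N by apply: leq_trans hm; apply: leq_maxr.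
have d1 : `|L m f - L m p| <= e5 + e5.
  apply: le_trans (L_dist hm0 hpf) _.
  rewrite L_lin // L_cst // lerD2r; apply: le_trans k2.
  by apply: ler_wpM2l; [rewrite mulr_ge0 | exact: L_tail].
have d2 : `|G f - G p| <= e5 + e5.
  have [Mp bp] := trig_bounded_continuous tp.
  have M2 : 0 <= 2 * M by rewrite mulr_ge0.
  have D0 : 0 <= 2 * d%:R :> R by rewrite mulr_ge0.
  have MD0 : 0 <= 2 * M * (2 * d%:R) by rewrite mulr_ge0.
  pose h x := 2 * M * @tail R d k x + e5.
  have bt : bounded_continuous (2 * d%:R) (@tail R d k) by split; [exact: tail_continuous | exact: tail_bounded].
  have be : @bounded_continuous R d e5 (fun=> e5).
    by split=> [|x]; [exact: cst_continuous | rewrite gtr0_norm].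
  have bf : bounded_continuous M f by [].
  have bp1 : bounded_continuous M p by split; [exact: bp.1 | exact: pM].
  have bh := bounded_continuousD (2 * M) bt be; rewrite (ger0_norm M2) -/h in bh.
  pose B := 2 * M * (2 * d%:R) + e5 + M + 2 * d%:R.
  have bB g N : N <= B -> bounded_continuous N g -> bounded_continuous B (fun w => g (w *m A^T)).
    by move=> NB bg; apply: bounded_continuous_lin; apply: bounded_continuousW NB bg.
  have Gh : G h <= e5 + e5.
    rewrite /h (@gauss_expect_lin R d B); [|apply: (bB _ _ _ bt) | apply: (bB _ _ _ be)]; rewrite ?/B; try lra.
    apply: lerD k1 _; apply: le_trans (ler_norm _) _.
    by apply: (gauss_expect_cvg d e5).1; exact: be.
  have step (f1 f2 : 'rV[R]_d -> R) : bounded_continuous M f1 -> bounded_continuous M f2 ->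
      (forall x, f1 x - f2 x <= h x) -> G f1 - G f2 <= e5 + e5.
    move=> b1 b2 h12; apply: le_trans Gh; rewrite lerBlDr -[G h]mul1r.
    have bs := bounded_continuousD 1 bh b2; rewrite normr1 mul1r in bs.
    have c1 : bounded_continuous B (fun w => f1 (w *m A^T)) by apply: (bB _ _ _ b1); rewrite /B; lra.
    have c2 : bounded_continuous B (fun w => f2 (w *m A^T)) by apply: (bB _ _ _ b2); rewrite /B; lra.
    have ch : bounded_continuous B (fun w => h (w *m A^T)) by apply: (bB _ _ _ bh); rewrite /B; lra.
    have cs : bounded_continuous B (fun w => 1 * h (w *m A^T) + f2 (w *m A^T)).
      by apply: (bB _ _ _ bs); rewrite /B; lra.
    rewrite -(gauss_expect_lin 1 ch c2); apply: gauss_expect_le c1 cs _ => w.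
    by have := h12 (w *m A^T); lra.
  rewrite ler_norml; apply/andP; split.
    have : G p - G f <= e5 + e5 by apply: step => // x; apply: le_trans (ler_norm _) (hpf x).
    by lra.
  by apply: step => // x; apply: le_trans (ler_norm _) _; rewrite distrC; exact: hpf.
have d3 := h1 m hm1.
have -> : G f - L m f = (G f - G p) + (G p - L m p) - (L m f - L m p) by ring.
apply: le_trans (ler_normB _ _) _.
apply: le_trans (lerD (ler_normD _ _) (lexx _)) _.
have -> : e = (e5 + e5) + e5 + (e5 + e5) by rewrite /e5; field.
by apply: lerD => //; apply: lerD.
Qed.

End LimitTheorem.

(** * From the times n/m to their limit alpha *)

Section Limit.
Variables (R : realType) (alpha : R).
Hypothesis alpha_gt0 : 0 < alpha.
Implicit Types (t : nat -> R).

Local Notation n2 m := (n2_of alpha m).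
Local Notation K := (Num.truncn alpha).+1.

Lemma alpha_ge0 : 0 <= alpha. Proof. exact: ltW. Qed.

Lemma alphaK : alpha <= K%:R.
Proof. by apply/ltW; apply: truncnS_gt. Qed.

Lemma n2_le m : (n2 m)%:R <= alpha * m%:R.
Proof. by rewrite /n2_of truncn_le // mulr_ge0 // alpha_ge0. Qed.

Lemma n2_bound m : (n2 m <= K * m)%N.
Proof.
rewrite -(ler_nat R) natrM; apply: le_trans (n2_le m) _.
by apply: ler_wpM2r => //; apply: alphaK.
Qed.

Lemma time_alpha m : (0 < m)%N -> 0 <= alpha - time R m (n2 m) <= m%:R^-1.
Proof.
move=> m0; have mp : 0 < m%:R :> R by rewrite ltr0n.
have h : alpha * m%:R < (n2 m)%:R + 1 by rewrite natr1; apply: truncnS_gt.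
rewrite /time subr_ge0 ler_pdivrMr // n2_le /= lerBlDr addrC -[X in _ + X]mul1r -mulrDl.
by rewrite ler_pdivlMr // ltW.
Qed.

(** The final time is within 1/m of [alpha], and [f] is Lipschitz in time uniformly in the
    parameter. *)
Lemma to_alpha (I : Type) (P : I -> Prop) f f' : C11 K%:R P f f' -> exists2 C : R, 0 <= C &
  forall i, P i -> forall m, (0 < m)%N -> `|f i alpha - f i (time R m (n2 m))| <= C * m%:R^-1.
Proof.
move=> /C11_Lip[C C0 hC]; exists C => // i Pi m m0.
have /andP[h0 h1] := time_alpha m0; have /andP[i0 i1] := inv_nat_le1 R m0.
have := hC i Pi (time R m (n2 m)) (alpha - time R m (n2 m)) (time_ge0 R m _).
rewrite h0 (le_trans h1 i1) addrC subrK => /(_ isT alphaK) /le_trans; apply.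
exact: ler_wpM2l.
Qed.

(** Centred at the profile of time [alpha] instead of n/m; the two centrings differ by O(1), which
    is invisible at scale sqrt m. *)
Definition centred d t m (s : state) : R := comp_sum t s - m%:R * mu d t alpha.

Lemma centred_dev d rho : exists2 C : R, 0 <= C & forall t, supp_ball d rho t ->
  forall m s, (0 < m)%N -> `|centred d t m s - dev m d t (n2 m) s| <= C.
Proof.
have [C C0 hC] := to_alpha (C11_mu K%:R d rho); exists C => // t bt m s m0.
have mp : 0 < m%:R :> R by rewrite ltr0n.
have -> : centred d t m s - dev m d t (n2 m) s = - (m%:R * (mu d t alpha - mu d t (time R m (n2 m)))).
  by rewrite /centred /dev; ring.
rewrite normrN normrM gtr0_norm //; have := ler_wpM2l (ltW mp) (hC t bt m m0).
by rewrite mulrCA mulfV ?gt_eqF // mulr1.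
Qed.

Lemma centred_moment d rho : exists C : R, exists M0, (0 < M0)%N /\ forall m t, (M0 <= m)%N ->
  supp_ball d rho t -> Ex m (n2 m) (fun s => centred d t m s ^+ 2) <= C * m%:R.
Proof.
have [C C0 hC] := centred_dev d rho; have [D D0 hD] := @second_moment R d K rho.
exists (2 * D * K%:R + 2 * C ^+ 2), (maxn 4 d); split=> [|m t]; first by rewrite leq_max.
rewrite geq_max => /andP[m4 dm] bt; have m0 : (0 < m)%N by apply: leq_trans m4.
have m1 : 1 <= m%:R :> R by rewrite ler1n.
apply: (@le_trans _ _ (Ex m (n2 m) (fun s => 2 * dev m d t (n2 m) s ^+ 2 + 2 * C ^+ 2))).
  apply: Ex_le => // s _; have := hC t bt m s m0.
  set a := centred d t m s; set b := dev m d t (n2 m) s; rewrite ler_norml => /andP[h1 h2].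
  have : (a - b) ^+ 2 <= C ^+ 2 by rewrite -[leLHS]real_normK ?num_real // lerXn2r ?nnegrE // ler_norml h1.
  have : 0 <= (a - 2 * b) ^+ 2 by apply: sqr_ge0.
  by rewrite !expr2; nra.
rewrite Ex_lin Ex_cst // [leRHS]mulrDl; apply: lerD; last by apply: ler_peMr => //; apply: mulr_ge0 => //; apply: sqr_ge0.
rewrite -!mulrA; apply: ler_wpM2l => //.
apply: le_trans (hD m (n2 m) t m4 dm (n2_bound m) bt) _.
by apply: ler_wpM2l => //; rewrite -natrM ler_nat n2_bound.
Qed.

Lemma sqrt_inv_cvg : (fun m => Num.sqrt (m%:R^-1 : R)) @ \oo --> (0 : R).
Proof.
have h : (fun m => m%:R^-1 : R) @ \oo --> (0 : R).
  by rewrite -cvg_shiftS; exact: cvg_harmonic.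
have := continuous_cvg _ (@sqrt_continuous R 0) h; rewrite sqrtr0; exact.
Qed.

Lemma Eunif_Ex m (F : state -> R) : perm_inv F ->
  Eunif (Gm alpha m) (fun E => F (St E [set: 'I_(m.*2 + n2 m)]%SET)) = Ex m (n2 m) F.
Proof. exact: Eunif_hist. Qed.

Definition ind (j x : nat) : R := (x == j)%:R.

Lemma ind_ball d (j : nat) : (j < d)%N -> supp_ball d 1 (ind j).
Proof.
move=> jd; split=> x; rewrite /ind; first by case: eqP; rewrite ?normr1 ?normr0.
by move=> dx; rewrite gtn_eqF // (leq_trans jd).
Qed.

Lemma mu_ind d (j : nat) : (j < d)%N -> mu d (ind j) alpha = Ucoef alpha (j + 2).
Proof.
move=> jd; rewrite /mu (bigD1 (Ordinal jd)) //= big1 => [|x xj].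
  by rewrite /ind eqxx mul1r addr0 /Ucoef /geo addnK (_ : (j + 2 - 1)%N = j.+1) // addn2 subn1.
rewrite /ind (_ : (x : nat) == j = false) ?mul0r //.
by apply: contraNF xj => /eqP xj; apply/eqP/val_inj.
Qed.

Lemma Eunif_Ucount m j (phi : R -> R) :
  Eunif (Gm alpha m) (fun E => phi (Ucount (j + 2) E)%:R) = Ex m (n2 m) (fun s => phi (comp_sum (ind j) s)).
Proof.
rewrite -(Eunif_Ex m (F := fun s => phi (comp_sum (ind j) s))); last first.
  by move=> s s' ss'; rewrite (@comp_sum_inv _ _ _ _ ss').
by apply: Eunif_ext => E EG; rewrite (Ucount_comp_sum R j EG).
Qed.

Definition ext d (v : 'rV[R]_d) (x : nat) : R := if insub x is Some i then v ord0 i else 0.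

Lemma extE d (v : 'rV[R]_d) (i : 'I_d) : ext v i = v ord0 i.
Proof. by rewrite /ext valK. Qed.

Lemma ext_ball d (v : 'rV[R]_d) : supp_ball d (\sum_i `|v ord0 i|) (ext v).
Proof.
split=> x; rewrite /ext; last by move=> dx; rewrite insubF // ltnNge dx.
case: insubP => [i _ _|_]; last by rewrite normr0 sumr_ge0.
by rewrite (bigD1 i) //= lerDl sumr_ge0.
Qed.

Lemma ext_ind d (v : 'rV[R]_d) x : ext v x = \sum_i v ord0 i * ind i x.
Proof.
rewrite /ext; case: insubP => [i _ ix|xd].
  rewrite (bigD1 i) //= big1 => [|k ki]; first by rewrite /ind ix eqxx mulr1 addr0.
  rewrite /ind -ix (_ : (val i == k) = false) ?mulr0 //.
  by apply: contraNF ki => /eqP ik; apply/eqP/val_inj.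
rewrite big1 // => i _; rewrite /ind (_ : (x == i) = false) ?mulr0 //.
by apply: contraNF xd => /eqP ->.
Qed.

Lemma centred_ext d (v : 'rV[R]_d) m s :
  centred d (ext v) m s = \sum_i v ord0 i * (comp_sum (ind i) s - Ucoef alpha (i + 2) * m%:R).
Proof.
rewrite /centred /comp_sum; under eq_bigr do rewrite ext_ind.
rewrite exchange_big /mu mulr_sumr -sumrB; apply: eq_bigr => i _.
rewrite -mulr_sumr extE mulrBr; congr (_ - _).
rewrite -(mu_ind (ltn_ord i)) /mu (bigD1 i) //= big1 => [|x xi]; last first.
  rewrite /ind (_ : (x : nat) == i = false) ?mul0r //.
  by apply: contraNF xi => /eqP xi; apply/eqP/val_inj.
by rewrite /ind eqxx mul1r; ring.
Qed.

Lemma centred_ind d (j : nat) m s : (j < d)%N ->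
  centred d (ind j) m s = comp_sum (ind j) s - Ucoef alpha (j + 2) * m%:R.
Proof. by move=> jd; rewrite /centred mu_ind // mulrC. Qed.

(** Three errors of order m^{-1/2}: the recentring, [char_bound] with (1 + C/m)^n <= exp(CK), and
    the evaluation of [Hv] at [alpha]. *)
Lemma char_centred d rho : exists C : R, exists M0, (0 < M0)%N /\ forall m t b, (M0 <= m)%N -> supp_ball d rho t ->
  `|Ex m (n2 m) (fun s => cos (Num.sqrt m%:R^-1 * centred d t m s + b)) -
    expR (- Hv d t alpha / 2) * cos b| <= C * Num.sqrt m%:R^-1.
Proof.
have [C C0 [M hC]] := @char_bound R d K rho.
have [D D0 hD] := centred_dev d rho; have [H H0 hH] := to_alpha (C11_Hv K%:R d rho).
exists (D + C * K%:R * expR (C * K%:R) + H), (maxn 1 M); split=> [|m t b]; first by rewrite leq_max.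
rewrite geq_max => /andP[m0 Mm] bt.
have mp : 0 < m%:R :> R by rewrite ltr0n.
have [r0 r1 r2 r3] := sqrt_inv R m0.
have nK := n2_bound m; have /andP[i0 i1] := inv_nat_le1 R m0.
set r := Num.sqrt _ in r0 r1 r2 r3 *.
have d1 : `|Ex m (n2 m) (fun s => cos (r * centred d t m s + b)) - Ex m (n2 m) (fun s => cos (phase d m t b (n2 m) s))| <= D * r.
  apply: Ex_dist_le => // s _; apply: le_trans (cos_lip _ _) _.
  rewrite /phase -/r (_ : _ - _ = r * (centred d t m s - dev m d t (n2 m) s)); last by ring.
  by rewrite normrM (ger0_norm r0) mulrC; apply: ler_wpM2r => //; apply: hD.
have d2 := hC m (n2 m) t b Mm nK bt.
have {}d2 : `|Ex m (n2 m) (fun s => cos (phase d m t b (n2 m) s)) - expR (- Hv d t (time R m (n2 m)) / 2) * cos b|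
    <= C * K%:R * expR (C * K%:R) * r.
  apply: le_trans d2 _; rewrite -/r.
  have -> : C * m%:R^-1 * r * (n2 m)%:R * (1 + C / m%:R) ^+ n2 m =
    C * (time R m (n2 m)) * (1 + C / m%:R) ^+ n2 m * r by rewrite /time; ring.
  apply: ler_wpM2r => //.
  have tK := time_le R m0 nK; have t0 := time_ge0 R m (n2 m).
  have p0 : 0 <= 1 + C / m%:R by rewrite addr_ge0 // mulr_ge0.
  apply: ler_pM; [by rewrite mulr_ge0 | by rewrite exprn_ge0 | by apply: ler_wpM2l |].
  apply: (@le_trans _ _ (expR (C / m%:R) ^+ n2 m)).
    by apply: lerXn2r; rewrite ?nnegrE ?expR_ge0 //; apply: expR_ge1Dx.
  rewrite -expRM_natl ler_expR (_ : _ * _ = C * time R m (n2 m)); last by rewrite /time; ring.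
  exact: ler_wpM2l.
have d3 : `|expR (- Hv d t (time R m (n2 m)) / 2) * cos b - expR (- Hv d t alpha / 2) * cos b| <= H * r.
  rewrite -mulrBl -[H * r]mulr1; apply: normM_le (cos_max b).
  apply: (@le_trans _ _ (H * m%:R^-1)); last by apply: ler_wpM2l.
  apply: le_trans (hH t bt m m0).
  have e1 (x y : R) : 0 <= x -> 0 <= y -> x <= y -> `|expR (- x / 2) - expR (- y / 2)| <= `|y - x|.
    move=> x0 y0 xy; have h := expR_ge1Dx (- (y - x) / 2).
    have hx : expR (- x / 2) <= 1 by rewrite -[leRHS]expR0 ler_expR; lra.
    have hx0 := expR_ge0 (- x / 2).
    have -> : expR (- y / 2) = expR (- x / 2) * expR (- (y - x) / 2) by rewrite -expRD; congr expR; ring.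
    have h1 : expR (- (y - x) / 2) <= 1 by rewrite -[leRHS]expR0 ler_expR; lra.
    rewrite !ger0_norm ?subr_ge0 //; last by apply: ler_piMr.
    have -> : expR (- x / 2) - expR (- x / 2) * expR (- (y - x) / 2) = expR (- x / 2) * (1 - expR (- (y - x) / 2)) by ring.
    apply: (@le_trans _ _ (1 * (y - x))); last by rewrite mul1r.
    by apply: ler_pM => //; lra.
  have hv0 s : 0 <= s -> 0 <= Hv d t s by move=> s0; apply: Hv_ge0 => //; exact: bt.2.
  have [h|h] := leP (Hv d t (time R m (n2 m))) (Hv d t alpha).
    by apply: e1 => //; apply: hv0; [exact: time_ge0 | exact: alpha_ge0].
  rewrite distrC [leRHS]distrC; apply: e1 (ltW h); apply: hv0; [exact: alpha_ge0 | exact: time_ge0].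
rewrite !mulrDl; apply: le_trans (lerD (lerD d1 d2) d3).
set A := Ex _ _ _; set B := Ex _ _ _; set E := _ * cos b; set E' := _ * cos b.
have -> : A - E = (A - B) + (B - E') + (E' - E) by ring.
by apply: normD_le => //; apply: normD_le.
Qed.

End Limit.

(** * The matrix H(alpha), the moments and the Gaussian limit *)

Section Conclusion.
Variables (R : realType) (alpha : R).
Hypothesis alpha_gt0 : 0 < alpha.

Local Notation n2 m := (n2_of alpha m).

(** Identifies H with the matrix of the form [Hv]. The derivative of [geo x] at alpha is [geo x]
    times (x - alpha) / (alpha(1 + alpha)), which yields the factors i - 2 - alpha for sizes i = x +
    2. *)
Lemma Hent_geo (i k : nat) : Hent alpha (i + 2) (k + 2) =
  (i == k)%:R * geo i alpha - geo i alpha * geo k alpha -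
  alpha * (1 + alpha) * ((i%:R * geo i.-1 alpha - i.+1%:R * geo i alpha) * (1 + alpha)^-1) *
    ((k%:R * geo k.-1 alpha - k.+1%:R * geo k alpha) * (1 + alpha)^-1).
Proof.
have a1 : 1 + alpha != 0 by rewrite gt_eqF // addr_gt0.
have a0 : alpha != 0 by rewrite gt_eqF.
have dgeo x : (x%:R * geo x.-1 alpha - x.+1%:R * geo x alpha) * (1 + alpha)^-1 =
    geo x alpha * (x%:R - alpha) / (alpha * (1 + alpha)).
  case: x => [|x]; first by rewrite /geo /= expr0 expr1; field; rewrite a0 a1.
  rewrite /geo /= !exprS -[x.+2%:R]natr1 -[x.+1%:R]natr1; move: (x%:R : R) => X.
  by field; rewrite a0 a1 expf_neq0.
rewrite !dgeo /Hent eqn_add2r addnK !natrD /geo.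
have -> : (i + 2 + (k + 2) - 4 = i + k)%N by lia.
have -> : (i + 2 + (k + 2) - 2 = i.+1 + k.+1)%N by lia.
rewrite !exprD expr_div_n !exprS; move: (alpha ^+ i) (alpha ^+ k) => x y.
case: eqP => ik; field; by rewrite ?a0 ?a1 ?expf_neq0.
Qed.

Lemma quadratic_Hmat q (v : 'rV[R]_(q.-1)) :
  (v *m Hmat alpha q *m v^T) ord0 ord0 = Hv q.-1 (ext v) alpha.
Proof.
rewrite /Hv mu_drift_geo; [|exact: ltW|exact: (ext_ball v).2].
have -> : (v *m Hmat alpha q *m v^T) ord0 ord0 =
   \sum_i \sum_k v ord0 i * v ord0 k * Hent alpha (i + 2) (k + 2).
  rewrite mxE [RHS]exchange_big /=; apply: eq_bigr => k _; rewrite mxE mulr_suml; apply: eq_bigr => i _.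
  by rewrite !mxE; ring.
set g' := fun x : nat => (x%:R * geo x.-1 alpha - x.+1%:R * geo x alpha) * (1 + alpha)^-1.
rewrite /mu; set S1 := \sum_(x < _) ext v x * geo x alpha; set S2 := \sum_(x < _) ext v x * _.
transitivity (\sum_(i < q.-1) (ext v i ^+ 2 * geo i alpha - ext v i * geo i alpha * S1
    - ext v i * g' i * (alpha * (1 + alpha) * S2))); last first.
  by rewrite !sumrB -!mulr_suml -/S1 -/S2; ring.
apply: eq_bigr => i _; rewrite /S1 /S2 !mulr_sumr extE.
have -> : v ord0 i ^+ 2 * geo i alpha = \sum_(k < q.-1) v ord0 i * v ord0 k * (i == k)%:R * geo i alpha.
  rewrite (bigD1 i) //= eqxx big1 => [|k ki]; first by rewrite mulr1 addr0 expr2.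
  by rewrite eq_sym (negbTE ki) mulr0 mul0r.
rewrite -!sumrB; apply: eq_bigr => k _; rewrite Hent_geo extE -/(g' i) -/(g' k).
rewrite -[(i == k :> nat)]/(i == k); ring.
Qed.

Lemma Hmat_ge0 q (v : 'rV[R]_(q.-1)) : 0 <= (v *m Hmat alpha q *m v^T) ord0 ord0.
Proof. by rewrite quadratic_Hmat; apply: Hv_ge0; [exact: ltW | exact: (ext_ball v).2]. Qed.

Lemma Ucoef_gt0 j : 0 < Ucoef alpha j.
Proof. by rewrite divr_gt0 // exprn_gt0 // addr_gt0. Qed.

Lemma Eunif_moment j : exists C : R, exists M0, (0 < M0)%N /\ forall m, (M0 <= m)%N ->
  Ex m (n2 m) (fun s => (comp_sum (ind R j) s - Ucoef alpha (j + 2) * m%:R) ^+ 2) <= C * m%:R.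
Proof.
have [C [M0 [M00 hC]]] := centred_moment alpha_gt0 j.+1 1; exists C, M0; split=> // m hm.
apply: le_trans (hC m (ind R j) hm (ind_ball _ (ltnSn j))).
by apply: Ex_le => [|s _]; [exact: leq_trans hm | rewrite centred_ind].
Qed.

Lemma mean_cvg j : (fun m : nat => Eunif (Gm alpha m) (fun E => (Ucount (j + 2) E)%:R)
  / (Ucoef alpha (j + 2) * m%:R)) @ \oo --> (1 : R).
Proof.
have [C [M0 [M00 hC]]] := Eunif_moment j.
have g0 := Ucoef_gt0 (j + 2).
set g := Ucoef _ _ in hC g0 *.
have cv (c : R) : (fun m => 1 + c * Num.sqrt (m%:R^-1 : R)) @ \oo --> (1 : R).
  rewrite -[X in _ --> X]addr0; apply: cvgD; first exact: cvg_cst.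
  by rewrite -(mulr0 c); apply: cvgMr; exact: sqrt_inv_cvg.
apply: (@squeeze_cvgr _ _ _ _ (fun m => 1 + - ((C + 1) / g) * Num.sqrt m%:R^-1) (fun m => 1 + (C + 1) / g * Num.sqrt m%:R^-1)); [|exact: cv|exact: cv].
exists M0 => // m /= hm; have m0 : (0 < m)%N by apply: leq_trans hm.
have mp : 0 < m%:R :> R by rewrite ltr0n.
have [r0 r1 r2 r3] := sqrt_inv R m0; set r := Num.sqrt _ in r0 r1 r2 r3 *.
have rp : 0 < r by apply: lt_le_trans r3; rewrite invr_gt0.
rewrite (Eunif_Ucount alpha m j id).
set F := fun s => comp_sum (ind R j) s - g * m%:R.
have -> : Ex m (n2 m) (fun s => comp_sum (ind R j) s) = g * m%:R + Ex m (n2 m) F.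
  by rewrite /F ExB Ex_cst // addrC subrK.
have h : `|Ex m (n2 m) F| <= (C + 1) * r * m%:R.
  apply: le_trans (Ex_norm m0 _ _) _.
  (* From 2|F| <= r F^2 + 1/r with r = m^{-1/2}: both terms have expectation O(sqrt m), small
     against the mean of order m. *)
  apply: (@le_trans _ _ (Ex m (n2 m) (fun s => r * F s ^+ 2 + r^-1))).
    apply: Ex_le => // s _; rewrite -[F s ^+ 2]real_normK ?num_real //; move: `|F s| (normr_ge0 (F s)) => y y0.
    have : 0 <= r^-1 * (r * y - 1) ^+ 2 by rewrite mulr_ge0 ?invr_ge0 ?sqr_ge0 // ltW.
    have -> : r^-1 * (r * y - 1) ^+ 2 = r * y ^+ 2 + r^-1 - 2 * y by field; rewrite gt_eqF.
    by lra.
  rewrite Ex_lin Ex_cst //.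
  have -> : r^-1 = r * m%:R.
    by apply: (mulfI (lt0r_neq0 rp)); rewrite mulfV ?gt_eqF // mulrA -expr2 r2 mulVf // gt_eqF.
  rewrite (_ : (C + 1) * r * m%:R = r * (C * m%:R) + r * m%:R); last by ring.
  by rewrite lerD2r; apply: ler_wpM2l (hC m hm).
have -> : (g * m%:R + Ex m (n2 m) F) / (g * m%:R) = 1 + Ex m (n2 m) F / (g * m%:R).
  by field; rewrite !gt_eqF.
have h2 : `|Ex m (n2 m) F / (g * m%:R)| <= (C + 1) / g * r.
  have gm : 0 < g * m%:R by rewrite mulr_gt0.
  rewrite normrM [X in _ * X]gtr0_norm ?invr_gt0 // ler_pdivrMr //.
  by rewrite (_ : (C + 1) / g * r * (g * m%:R) = (C + 1) * r * m%:R) //; field; rewrite gt_eqF.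
by move: h2; rewrite ler_norml !lerD2l mulNr.
Qed.

(** The second moment about any centre dominates the variance, so centring at the limit profile is
    enough. *)
Lemma variance_bound j : exists C : R, \forall m \near \oo,
  Varunif (Gm alpha m) (fun E => (Ucount (j + 2) E)%:R) <= C * m%:R.
Proof.
have [C [M0 [M00 hC]]] := Eunif_moment j.
exists C, M0 => // m /= hm; apply: le_trans (hC m hm).
have m0 : (0 < m)%N by apply: leq_trans hm.
rewrite /Varunif (Eunif_Ucount alpha m j id).
set c := Ucoef _ _ * _; set e := Ex _ _ _.
rewrite (Eunif_Ucount alpha m j (fun u => (u - e) ^+ 2)).
have h : Ex m (n2 m) (fun s => (comp_sum (ind R j) s - e) ^+ 2) =
    Ex m (n2 m) (fun s => (comp_sum (ind R j) s - c) ^+ 2) - (c - e) ^+ 2.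
  rewrite (_ : (fun s => (comp_sum (ind R j) s - e) ^+ 2) =
     (fun s => (2 * (c - e)) * comp_sum (ind R j) s + ((comp_sum (ind R j) s - c) ^+ 2 + (e ^+ 2 - c ^+ 2)))); last first.
    by apply/funext => s; ring.
  by rewrite Ex_lin ExD Ex_cst // -/e; ring.
by rewrite h gerBl sqr_ge0.
Qed.

Lemma clt q (A : 'M[R]_(q.-1)) : A *m A^T = Hmat alpha q ->
  conv_distr_gauss
         (fun (f : 'rV[R]_(q.-1) -> R) (m : nat) => Eunif (Gm alpha m)
            (fun E => f (\row_(i < q.-1)
               (((Ucount (i + 2)%N E)%:R - Ucoef alpha (i + 2)%N * m%:R)
                  / Num.sqrt m%:R)))) A.
Proof.
move=> AH; set d := q.-1 in A AH *.
pose X m s : 'rV[R]_d := \row_i ((comp_sum (ind R i) s - Ucoef alpha (i + 2) * m%:R) / Num.sqrt m%:R).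
have EX (f : 'rV[R]_d -> R) m : Eunif (Gm alpha m) (fun E => f (\row_(i < d)
      (((Ucount (i + 2)%N E)%:R - Ucoef alpha (i + 2)%N * m%:R) / Num.sqrt m%:R))) =
    Ex m (n2 m) (fun s => f (X m s)).
  rewrite -(Eunif_Ex alpha m (F := fun s => f (X m s))); last first.
    by move=> s s' ss'; congr f; apply/rowP => i; rewrite !mxE (comp_sum_inv _ ss').
  apply: Eunif_ext => E EG; congr f; apply/rowP => i.
  by rewrite !mxE (Ucount_comp_sum R i EG).
have /boolp.choice[C0 /boolp.choice[Mi hMi]] : forall i : 'I_d, exists C : R, exists M0, (0 < M0)%N /\ forall m, (M0 <= m)%N ->
   Ex m (n2 m) (fun s => (comp_sum (ind R i) s - Ucoef alpha (i + 2) * m%:R) ^+ 2) <= C * m%:R.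
  by move=> i; exact: Eunif_moment.
(* The sum dominates each threshold, and the successor keeps it positive. *)
pose M0 := (\sum_i Mi i).+1.
pose C := \sum_i `|C0 i|.
have X2 m i : (M0 <= m)%N -> Ex m (n2 m) (fun s => X m s ord0 i ^+ 2) <= C.
  move=> hm; have m0 : (0 < m)%N by apply: leq_trans hm.
  have mp : 0 < m%:R :> R by rewrite ltr0n.
  have him : (Mi i <= m)%N by apply: leq_trans hm; rewrite /M0 (bigD1 i) //= ltnW // ltnS leq_addr.
  rewrite (_ : (fun s => X m s ord0 i ^+ 2) = fun s => m%:R^-1 * (comp_sum (ind R i) s - Ucoef alpha (i + 2) * m%:R) ^+ 2); last first.
    by apply/funext => s; rewrite mxE expr_div_n sqr_sqrtr // mulrC.
  rewrite ExZ //; apply: (@le_trans _ _ (C0 i)).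
    by rewrite ler_pdivrMl // [leRHS]mulrC; apply: (hMi i).2.
  by apply: le_trans (ler_norm _) _; rewrite /C (bigD1 i) //= lerDl sumr_ge0.
have lim := @limit_theorem R d A (fun m f => Ex m (n2 m) (fun s => f (X m s))) M0 C.
move=> f cf bf; under eq_fun do rewrite EX; apply: lim => //.
- by move=> m a f1 g1 hm; rewrite Ex_lin.
- by move=> m f1 g1 hm fg; apply: Ex_le => //; apply: leq_trans hm.
- by move=> m c hm; apply: Ex_cst; apply: leq_trans hm.
move=> s b; rewrite AH quadratic_Hmat -/d.
have [D [M1 [M10 hD]]] := char_centred alpha_gt0 d (\sum_i `|s ord0 i|).
set l := expR _ * _.
apply: (@squeeze_cvgr _ _ _ _ (fun m => l - D * Num.sqrt m%:R^-1) (fun m => l + D * Num.sqrt m%:R^-1)).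
- exists M1 => // m /= hm; have m0 : (0 < m)%N by apply: leq_trans hm.
  have := hD m (ext s) b hm (ext_ball s); rewrite -/l.
  (* The scalar product of the normalised vector with [s] is the centred statistic of [ext s]
     divided by sqrt m. *)
  rewrite (_ : (fun st => cos (Num.sqrt m%:R^-1 * _ + b)) = (fun st => cos ((X m st *m s^T) ord0 ord0 + b))).
    by rewrite ler_norml => /andP[h1 h2]; apply/andP; split; lra.
  apply/funext => st; congr (cos (_ + _)); rewrite centred_ext mxE mulr_sumr; apply: eq_bigr => i _.
  by rewrite !mxE sqrtrV //; ring.
- rewrite -[X in _ --> X]subr0; apply: cvgB; first exact: cvg_cst.
  by rewrite -(mulr0 D); apply: cvgMr; exact: sqrt_inv_cvg.
- rewrite -[X in _ --> X]addr0; apply: cvgD; first exact: cvg_cst.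
  by rewrite -(mulr0 D); apply: cvgMr; exact: sqrt_inv_cvg.
Qed.

End Conclusion.

Theorem theorem1 (R : realType) (alpha : R) (halpha : 0 < alpha) :
  (forall j : nat, (2 <= j)%N ->
     (fun m : nat => Eunif (Gm alpha m) (fun E => (Ucount j E)%:R)
                       / (Ucoef alpha j * m%:R)) @ \oo --> (1 : R)
     /\ exists C : R, \forall m \near \oo,
          Varunif (Gm alpha m) (fun E => (Ucount j E)%:R) <= C * m%:R)
  /\
  (forall q : nat, (2 <= q)%N ->
     (forall v : 'rV[R]_(q.-1), 0 <= (v *m Hmat alpha q *m v^T) ord0 ord0)
     /\
     forall A : 'M[R]_(q.-1), A *m A^T = Hmat alpha q ->
       conv_distr_gauss
         (fun (f : 'rV[R]_(q.-1) -> R) (m : nat) => Eunif (Gm alpha m)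
            (fun E => f (\row_(i < q.-1)
               (((Ucount (i + 2)%N E)%:R - Ucoef alpha (i + 2)%N * m%:R)
                  / Num.sqrt m%:R))))
         A).
Proof.
split=> [j j2|q _].
  rewrite -(subnK j2); split; [exact: mean_cvg | exact: variance_bound].
by split=> [v|A AH]; [exact: Hmat_ge0 | exact: clt].
Qed.
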